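(* For a simple $\mathfrak{D}(G)$-module $M(g,\varrho)$, let $\mathsf{S}(g,\varrho)$ be the socle of the Verma module $\mathsf{M}(g,\varrho)$ as a $\mathfrak{D}$-module, and let $M(\hat g,\hat\varrho)$ be the simple $\mathfrak{D}(G)$-module isomorphic to $\mathfrak{B}^{n_{top}}(V)\otimes M(g,\varrho)$, where $n_{top}$ is the maximum degree of $\mathfrak{B}(V)$. (i) $\mathsf{S}(g,\varrho)$ is the unique (up to isomorphism) simple lowest-weight $\mathfrak{D}$-module of weight $(\hat g,\hat\varrho)$. (ii) Every simple $\mathfrak{D}$-module is isomorphic to $\mathsf{S}(g,\varrho)$ for a unique (up to isomorphism) simple $\mathfrak{D}(G)$-module $M(g,\varrho)$.
   Context: Throughout, $\Bbbk$ is an algebraically closed field of characteristic zero, $G$ is a finite non-abelian group, and $V$ is a (left-left) Yetter–Drinfeld module over $\Bbbk G$ whose Nichols algebra $\mathfrak{B}(V)=\bigoplus_{n\ge 0}\mathfrak{B}^n(V)$ is finite-dimensional (then $\mathfrak{B}^{n_{top}}(V)$ is one-dimensional). Modules are left modules. For a finite-dimensional Hopf algebra $H$, the Drinfeld double is $H\otimes H^*$ as a coalgebra, with multiplication $(h\otimes f)(h'\otimes f')=\langle f_{(1)},h'_{(1)}\rangle\langle f_{(3)},\mathcal{S}(h'_{(3)})\rangle\,(hh'_{(2)}\otimes f'f_{(2)})$; it contains $H$ and $H^{*op}$ as Hopf subalgebras. $\mathfrak{D}(G)$ is the Drinfeld double of $\Bbbk G$, and $\mathfrak{D}$ is the Drinfeld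 double of the bosonization $\mathfrak{B}(V)\#\Bbbk G$. Let $\Bbbk^G=(\Bbbk G)^*$ with basis $\{\delta_h\}$ dual to $G$. Let $\overline V$ be $V^*$ with the Yetter–Drinfeld structure over $\Bbbk^G$ given by $\langle f\cdot y,x\rangle=\langle f,\mathcal{S}(x_{(-1)})\rangle\langle y,x_{(0)}\rangle$ and $\langle y,g\cdot x\rangle=\langle y_{(-1)},g\rangle\langle y_{(0)},x\rangle$. One identifies $(\mathfrak{B}(V)\#\Bbbk G)^{*op}$ with $\mathfrak{B}(\overline V)\#\Bbbk^G$ (as graded Hopf algebras; $f\in\Bbbk^G$ acts as a functional on $\mathfrak{B}^0(V)\#\Bbbk G$ by $\langle f,g\rangle$ and vanishes in other degrees; $y\in\overline V$ acts by $x\#g\mapsto\langle y,x\rangle$ on $V\#\Bbbk G$ and vanishes in other degrees). Inside $\mathfrak{D}$, the subalgebra generated by $\Bbbk G$ and $\Bbbk^G$ is $\mathfrak{D}(G)$, and multiplication gives a linear isomorphism $\mathfrak{B}(V)\otimes\mathfrak{D}(G)\otimes\mathfrak{B}(\overline V)\to\mathfrak{D}$. $\mathfrak{D}^{\geq0}$ is the subalgebra generated by $\mathfrak{D}(G)$ and $\overline V$. $\mathfrak{D}(G)$ acts on $\mathfrak{B}(V)$ by the adjoint action in $\mathfrak{D}$, $\mathrm{ad}(h)x=h_{(1)}x\mathcal{S}(h_{(2)})$. Simple $\mathfrak{D}(G)$-modules: for $g\in G$ with centralizer $\mathcal{C}_g$ and an irreducible representation $(U,\varrho)$ of $\mathcal{C}_g$,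 $M(g,\varrho)=\Bbbk G\otimes_{\Bbbk\mathcal{C}_g}U$ with $f\cdot(x\otimes u)=\langle f,xgx^{-1}\rangle x\otimes u$ for $f\in\Bbbk^G$; every simple $\mathfrak{D}(G)$-module has this form. A $\mathfrak{D}(G)$-module is of weight $(g,\varrho)$ if it is isomorphic to $M(g,\varrho)$. $M(g,\varrho)$ is a $\mathfrak{D}^{\geq 0}$-module with $\overline V$ acting by zero. The Verma module is $\mathsf{M}(g,\varrho)=\mathfrak{D}\otimes_{\mathfrak{D}^{\geq 0}}M(g,\varrho)$. A $\mathfrak{D}$-module $N$ is a lowest-weight module of weight $(g,\varrho)$ if it is generated as a $\mathfrak{D}$-module by a simple $\mathfrak{D}(G)$-submodule $M\subseteq N$ of weight $(g,\varrho)$ with $V M=0$. *)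

(* Defs.v *)
From HB Require Import structures.
From mathcomp Require Import all_boot all_order all_algebra all_fingroup all_field.
From mathcomp Require Import mxrepresentation.
From mathcomp Require Import boolp classical_sets.
Set Implicit Arguments.
Unset Strict Implicit.
Unset Printing Implicit Defensive.

Import GRing.Theory VectorInternalTheory.
Local Open Scope ring_scope.

Section LinearAlgebra.
Variable k : fieldType.

(* The tensor product of two finite-dimensional spaces, as coordinate matrices:
   e_i (x) e_j is the (i,j) matrix unit, for the canonical bases (e_i), (e_j). *)
Definition tens (A B : vectType k) : Type := 'M[k]_(dim A, dim B).
HB.instance Definition _ (A B : vectType k) :=
  Vector.copy (tens A B) 'M[k]_(dim A, dim B).

Definition tpure (A B : vectType k) (a : A) (b : B) : tens A B :=
  (v2r a)^T *m v2r b.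

Definition ebasis (A : vectType k) (i : 'I_(dim A)) : A := r2v (delta_mx 0 i).

(* The linear map on A (x) B induced by the bilinear map f. *)
Definition tlift (A B : vectType k) (C : lmodType k) (t : tens A B)
    (f : A -> B -> C) : C :=
  \sum_i \sum_j t i j *: f (ebasis i) (ebasis j).

(* The span of the u (x) w with u in U and w in W. *)
Definition tens_sub (A B : vectType k) (U : {vspace A}) (W : {vspace B}) :
    {vspace tens A B} :=
  <<[seq tpure u w | u <- vbasis U, w <- vbasis W]>>%VS.

Notation dual A := 'Hom(A, k^o).

Definition dbasis (A : vectType k) (i : 'I_(dim A)) : dual A :=
  linfun (fun x : A => v2r x 0 i : k^o).

(* The smallest subspace satisfying Q (only used when there is one). *)
Definition least_vspace (T : vectType k) (Q : {vspace T} -> Prop) : {vspace T} :=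
  xget 0%VS [set U | Q U /\ forall W, Q W -> (U <= W)%VS]%classic.

(* The quotient T / R, realised on the chosen complement of R. *)
Definition vquot (T : vectType k) (R : {vspace T}) : Type := subvs_of (R^C)%VS.
HB.instance Definition _ (T : vectType k) (R : {vspace T}) :=
  Vector.copy (vquot R) (subvs_of (R^C)%VS).

Definition vclass (T : vectType k) (R : {vspace T}) (t : T) : vquot R :=
  vsproj (R^C)%VS (daddv_pi (R^C)%VS R t).

Definition vrepr (T : vectType k) (R : {vspace T}) (q : vquot R) : T := vsval q.

End LinearAlgebra.

Arguments tens {k} A B.

Notation dual A := 'Hom(A, _^o).

Notation "a \ot b" := (tpure a b) (at level 39, left associativity) : ring_scope.

(* Sweedler notation: the sum of E over t = \sum a (x) b, for E bilinear. *)
Notation "\sw_ ( a , b <- t ) E" := (tlift t (fun a b => E))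
  (at level 41, a name, b name, t at level 35, E at level 41,
   right associativity) : ring_scope.

Section Hopf.
Variable k : fieldType.

(* The structure maps of a finite-dimensional Hopf algebra. The Hopf axioms are
   not part of the record; they hold for the instances built below. *)
Record hopf_data (A : vectType k) := HopfData {
  hmul : A -> A -> A;
  hone : A;
  hcomul : A -> tens A A;
  hcounit : A -> k;
  hanti : A -> A }.

Section Double.
Variables (A : vectType k) (H : hopf_data A).

(* The usual structure maps of the dual Hopf algebra:
   <f f', x> = <f, x_(1)> <f', x_(2)>  and  <f, x y> = <f_(1), x> <f_(2), y>. *)
Definition dmul (f f' : dual A) : dual A :=
  linfun (fun x : A => \sw_(x1, x2 <- hcomul H x) (f x1 * f' x2 : k^o)).

Definition dunit : dual A := linfun (hcounit H : A -> k^o).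

Definition dcomul (f : dual A) : tens (dual A) (dual A) :=
  \sum_i \sum_j f (hmul H (ebasis i) (ebasis j)) *: (dbasis i \ot dbasis j).

(* f o S^-1 : the antipode of the opposite of the dual *)
Definition danti_op (f : dual A) : dual A := (f \o (linfun (hanti H))^-1)%VF.

Definition double_mul (u v : tens A (dual A)) : tens A (dual A) :=
  \sw_(h, f <- u) \sw_(h', f' <- v)
  \sw_(h1, h23 <- hcomul H h') \sw_(h2, h3 <- hcomul H h23)
  \sw_(f1, f23 <- dcomul f) \sw_(f2, f3 <- dcomul f23)
    (f1 h1 * f3 (hanti H h3)) *: (hmul H h h2 \ot dmul f' f2).

(* The antipode is given by S(h f) = S(f) S(h). *)
Definition drinfeld_double : hopf_data (tens A (dual A)) := {|
  hmul := double_mul;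
  hone := hone H \ot dunit;
  hcomul := fun u => \sw_(h, f <- u)
    \sw_(h1, h2 <- hcomul H h) \sw_(f1, f2 <- dcomul f)
      ((h1 \ot f1) \ot (h2 \ot f2));
  hcounit := fun u => \sw_(h, f <- u) (hcounit H h * f (hone H) : k^o);
  hanti := fun u => \sw_(h, f <- u)
    double_mul (hone H \ot danti_op f) (hanti H h \ot dunit) |}.

End Double.

Section Modules.

(* Left modules over the algebra underlying H, possibly infinite-dimensional. *)
Definition is_module (A : vectType k) (H : hopf_data A) (N : lmodType k)
    (act : A -> N -> N) : Prop :=
  [/\ forall (c : k) a b x, act (c *: a + b) x = c *: act a x + act b x,
      forall (c : k) a x y, act a (c *: x + y) = c *: act a x + act a y,
      forall x, act (hone H) x = x
    & forall a b x, act (hmul H a b) x = act a (act b x)].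

Variable A : vectType k.

(* Submodules are given by predicates. The notions below concern a submodule P
   of N, seen as a module; P = wholeT N gives those for N itself. *)
Definition is_submodule (N : lmodType k) (act : A -> N -> N) (P : N -> Prop) :=
  [/\ P 0, forall (c : k) x y, P x -> P y -> P (c *: x + y)
    & forall a x, P x -> P (act a x)].

Definition wholeT (N : lmodType k) : N -> Prop := fun _ => True.

Definition is_simple (N : lmodType k) (act : A -> N -> N) (P : N -> Prop) :=
  [/\ is_submodule act P, exists2 x, P x & x != 0
    & forall Q : N -> Prop, is_submodule act Q -> (forall x, Q x -> P x) ->
        (forall x, Q x -> x = 0) \/ (forall x, P x -> Q x)].

Definition mod_iso (N N' : lmodType k) (act : A -> N -> N) (P : N -> Prop)
    (act' : A -> N' -> N') (P' : N' -> Prop) : Prop :=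
  exists f : N -> N',
  [/\ forall (c : k) x y, P x -> P y -> f (c *: x + y) = c *: f x + f y,
      forall a x, P x -> f (act a x) = act' a (f x),
      forall x, P x -> P' (f x),
      forall x y, P x -> P y -> f x = f y -> x = y
    & forall y, P' y -> exists2 x, P x & f x = y].

(* The smallest submodule containing the simple ones, that is, their sum. *)
Definition socle (N : lmodType k) (act : A -> N -> N) : N -> Prop :=
  fun x => forall Q : N -> Prop, is_submodule act Q ->
    (forall P : N -> Prop, is_simple act P -> forall y, P y -> Q y) -> Q x.

End Modules.

Section Induction.

(* A (x)_S U for a subalgebra S of A and an S-module U; only the values of
   act on S matter. *)
Variables (A : vectType k) (mulA : A -> A -> A) (S : {vspace A}).
Variables (U : vectType k) (act : A -> U -> U).

Definition ind_rel : {vspace tens A U} :=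
  least_vspace (fun W : {vspace tens A U} => forall a b u, b \in S ->
    mulA a b \ot u - a \ot act b u \in W).

Definition induced : Type := vquot ind_rel.
HB.instance Definition _ := Vector.copy induced (vquot ind_rel).

Definition ind_act (a : A) (m : induced) : induced :=
  vclass ind_rel (\sw_(x, u <- vrepr m) (mulA a x \ot u)).

End Induction.

End Hopf.

Arguments wholeT {k} N.

Section GroupAlgebra.
Variables (k : fieldType) (gT : finGroupType).

Definition kG : Type := {ffun gT -> k^o}.
HB.instance Definition _ := Vector.copy kG {ffun gT -> k^o}.

Definition gelt (g : gT) : kG := [ffun h => (h == g)%:R].

Definition group_hopf : hopf_data kG := {|
  hmul := fun a b : kG => \sum_g \sum_h (a g * b h) *: gelt (g * h)%g;
  hone := gelt 1%g;
  hcomul := fun a : kG => \sum_g a g *: (gelt g \ot gelt g);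
  hcounit := fun a : kG => (\sum_g a g : k^o);
  hanti := fun a : kG => \sum_g a g *: gelt g^-1%g |}.

Definition DG : Type := tens kG (dual kG).
HB.instance Definition _ := Vector.copy DG (tens kG (dual kG)).

Definition DG_hopf : hopf_data DG := drinfeld_double group_hopf.

Section SimpleDG.
Variables (g : gT) (n : nat) (rho : mx_representation k 'C[g] n).

(* M(g,rho) is induced from the space of column vectors, on which rho acts from
   the left. *)
Definition centr_alg : {vspace kG} := <<[seq gelt c | c in 'C[g]%g]>>%VS.

Definition centr_act (a : kG) (u : 'cV[k]_n) : 'cV[k]_n :=
  \sum_(c in 'C[g]%g) a c *: (rho c *m u).

Definition Mg : Type := induced (hmul group_hopf) centr_alg centr_act.
HB.instance Definition _ :=
  Vector.copy Mg (induced (hmul group_hopf) centr_alg centr_act).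

(* f . (x (x) u) = <f, x g x^-1> x (x) u *)
Definition Mg_fact (f : dual kG) (m : Mg) : Mg :=
  vclass _ (\sw_(a, u <- vrepr m)
    (\sum_x (a x * f (gelt (x * g * x^-1)%g)) *: (gelt x \ot u))).

Definition Mg_act (z : DG) (m : Mg) : Mg :=
  \sw_(h, f <- z) (ind_act h (Mg_fact f m) : Mg).

End SimpleDG.
End GroupAlgebra.

Arguments Mg_act {k gT g n} rho z m.

Section Nichols.
Variables (k : fieldType) (gT : finGroupType).

(* The coaction is x |-> \sum_g g (x) ycoact g x, so that x_(-1) (x) x_(0) is
   the decomposition of x along the G-grading. *)
Record yd_module (V : vectType k) := YDModule {
  yact : gT -> 'End(V);
  ycoact : gT -> 'End(V);
  yact1 : forall x, yact 1%g x = x;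
  yactM : forall g h x, yact (g * h)%g x = yact g (yact h x);
  ycounit : forall x, \sum_g ycoact g x = x;
  ycoassoc : forall g h x,
    ycoact h (ycoact g x) = if g == h then ycoact g x else 0;
  ycompat : forall g h x,
    ycoact (h * g * h^-1)%g (yact h x) = yact h (ycoact g x) }.

(* B is a Nichols algebra of V: a graded braided Hopf algebra in the category of
   Yetter-Drinfeld modules, with B^0 = k, B^1 = V (via niota), generated by B^1
   and whose primitive elements are those of B^1; ntop is the maximal degree. *)
Record nichols (V : vectType k) (YV : yd_module V) (B : falgType k) := Nichols {
  nyd : yd_module B;
  ncomul : 'Hom(B, tens B B);
  ncounit : dual B;
  nanti : 'End(B);
  ndeg : nat -> {vspace B};
  ntop : nat;
  niota : 'Hom(V, B);

  nact_one : forall g, yact nyd g 1 = 1;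
  nact_mul : forall g x y, yact nyd g (x * y) = yact nyd g x * yact nyd g y;
  ncoact_one : forall g, ycoact nyd g 1 = (g == 1%g)%:R;
  ncoact_mul : forall g x y,
    ycoact nyd g (x * y) = \sum_s ycoact nyd s x * ycoact nyd (s^-1 * g)%g y;

  ncoassoc : forall x,
    \sw_(x1, x2 <- ncomul x) \sw_(y1, y2 <- ncomul x2) (x1 \ot (y1 \ot y2)) =
    \sw_(x1, x2 <- ncomul x) \sw_(y1, y2 <- ncomul x1) (y1 \ot (y2 \ot x2));
  ncounitl : forall x, \sw_(x1, x2 <- ncomul x) ncounit x1 *: x2 = x;
  ncounitr : forall x, \sw_(x1, x2 <- ncomul x) ncounit x2 *: x1 = x;
  nact_comul : forall g x, ncomul (yact nyd g x) =
    \sw_(x1, x2 <- ncomul x) (yact nyd g x1 \ot yact nyd g x2);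
  ncoact_comul : forall g x, ncomul (ycoact nyd g x) =
    \sw_(x1, x2 <- ncomul x)
      \sum_s (ycoact nyd s x1 \ot ycoact nyd (s^-1 * g)%g x2);
  nact_counit : forall g x, ncounit (yact nyd g x) = ncounit x;
  ncoact_counit : forall g x,
    ncounit (ycoact nyd g x) = if g == 1%g then ncounit x else 0;

  (* (x (x) x')(y (x) y') = x (x'_(-1) . y) (x) x'_(0) y' in B (x) B *)
  ncomul_one : ncomul 1 = 1 \ot 1;
  ncomul_mul : forall x y, ncomul (x * y) =
    \sw_(x1, x2 <- ncomul x) \sw_(y1, y2 <- ncomul y)
      \sum_s ((x1 * yact nyd s y1) \ot (ycoact nyd s x2 * y2));
  ncounit_one : ncounit 1 = 1;
  ncounit_mul : forall x y, ncounit (x * y) = ncounit x * ncounit y;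

  nantil : forall x, \sw_(x1, x2 <- ncomul x) (nanti x1 * x2) = (ncounit x)%:A;
  nantir : forall x, \sw_(x1, x2 <- ncomul x) (x1 * nanti x2) = (ncounit x)%:A;
  nact_anti : forall g x, nanti (yact nyd g x) = yact nyd g (nanti x);
  ncoact_anti : forall g x, nanti (ycoact nyd g x) = ycoact nyd g (nanti x);

  ndeg_sum : (\sum_(i < ntop.+1) ndeg i)%VS = fullv;
  ndeg_direct : directv (\sum_(i < ntop.+1) ndeg i);
  ndeg_gt : forall i, (ntop < i)%N -> ndeg i = 0%VS;
  ndeg_top : ndeg ntop != 0%VS;
  nact_deg : forall i g x, x \in ndeg i -> yact nyd g x \in ndeg i;
  ncoact_deg : forall i g x, x \in ndeg i -> ycoact nyd g x \in ndeg i;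
  nmul_deg : forall i j x y,
    x \in ndeg i -> y \in ndeg j -> x * y \in ndeg (i + j)%N;
  ncomul_deg : forall i x, x \in ndeg i ->
    ncomul x \in (\sum_(j < i.+1) tens_sub (ndeg j) (ndeg (i - j)%N))%VS;
  ncounit_deg : forall i x, (0 < i)%N -> x \in ndeg i -> ncounit x = 0;
  nanti_deg : forall i x, x \in ndeg i -> nanti x \in ndeg i;

  ndeg0 : ndeg 0 = <[1]>%VS;
  niota_inj : injective niota;
  niota_deg1 : limg niota = ndeg 1;
  niota_act : forall g x, niota (yact YV g x) = yact nyd g (niota x);
  niota_coact : forall g x, niota (ycoact YV g x) = ycoact nyd g (niota x);
  nprim : forall x, ncomul x = x \ot 1 + 1 \ot x -> x \in ndeg 1;
  ngen : agenv (ndeg 1) = fullv }.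

Variables (V : vectType k) (YV : yd_module V) (B : falgType k).
Variable NB : nichols YV B.

(* B # kG; the value at g of a function is the coefficient of g in B. *)
Definition boson : Type := {ffun gT -> B}.
HB.instance Definition _ := Vector.copy boson {ffun gT -> B}.

Definition smash (x : B) (g : gT) : boson := [ffun h => if h == g then x else 0].

Definition boson_hopf : hopf_data boson := {|
  hmul := fun a b : boson =>
    \sum_g \sum_h smash (a g * yact (nyd NB) g (b h)) (g * h)%g;
  hone := smash 1 1%g;
  hcomul := fun a : boson => \sum_g \sw_(x1, x2 <- ncomul NB (a g))
    \sum_s (smash x1 (s * g)%g \ot smash (ycoact (nyd NB) s x2) g);
  hcounit := fun a : boson => \sum_g ncounit NB (a g);
  (* S(x # g) = (1 # (x_(-1) g)^-1) (S(x_(0)) # 1) *)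
  hanti := fun a : boson => \sum_g \sum_s
    smash (yact (nyd NB) (s * g)^-1%g (nanti NB (ycoact (nyd NB) s (a g))))
          (s * g)^-1%g |}.

Definition DD : Type := tens boson (dual boson).
HB.instance Definition _ := Vector.copy DD (tens boson (dual boson)).

Definition DD_hopf : hopf_data DD := drinfeld_double boson_hopf.

(* The Hopf algebra inclusion of kG in B # kG and its retraction x#g |-> e(x)g;
   the transpose of the latter is the inclusion of k^G in (B # kG)^*. *)
Definition kG_boson (a : kG k gT) : boson := [ffun g => a g *: 1].
Definition boson_kG (t : boson) : kG k gT := [ffun g => ncounit NB (t g)].

Definition DG_DD (z : DG k gT) : DD :=
  \sw_(a, f <- z) (kG_boson a \ot ((f \o linfun boson_kG)%VF : dual boson)).

Definition B_DD (x : B) : DD := smash x 1%g \ot dunit boson_hopf.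

Definition V_DD (x : V) : DD := B_DD (niota NB x).

(* The elements of the image of V^*: the functionals on B # kG given by
   x # g |-> <y, x> on V # kG and vanishing in the degrees other than 1. *)
Definition Vbar_DD (d : DD) : Prop :=
  exists (f : dual boson) (y : dual V),
    [/\ d = hone boson_hopf \ot f,
        forall x g, f (smash (niota NB x) g) = y x
      & forall i b g, i != 1%N -> b \in ndeg NB i -> f (smash b g) = 0].

Definition DD_ge0 : {vspace DD} :=
  least_vspace (fun W : {vspace DD} =>
    [/\ hone DD_hopf \in W, forall z, DG_DD z \in W,
        forall d, Vbar_DD d -> d \in W
      & forall a b, a \in W -> b \in W -> hmul DD_hopf a b \in W]).

(* On DD_ge0 this is the algebra map that is the identity on D(G) and kills the
   image of V^*, namely (b # g) (x) f |-> e(b) g (x) f|kG. *)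
Definition DD_DG (d : DD) : DG k gT :=
  \sw_(t, f <- d) (boson_kG t \ot ((f \o linfun kG_boson)%VF : dual (kG k gT))).

(* ad(z) d = z_(1) d S(z_(2)) *)
Definition ad (z : DG k gT) (d : DD) : DD :=
  \sw_(z1, z2 <- hcomul (DG_hopf k gT) z)
    hmul DD_hopf (hmul DD_hopf (DG_DD z1) d) (DG_DD (hanti (DG_hopf k gT) z2)).

Section Weight.
Variables (g : gT) (n : nat) (rho : mx_representation k 'C[g] n).

Definition verma : Type :=
  induced (hmul DD_hopf) DD_ge0 (fun d (m : Mg rho) => Mg_act rho (DD_DG d) m).
HB.instance Definition _ := Vector.copy verma
  (induced (hmul DD_hopf) DD_ge0 (fun d (m : Mg rho) => Mg_act rho (DD_DG d) m)).

Definition verma_act (d : DD) (w : verma) : verma := ind_act d w.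

(* B^top (x) M(g,rho) is seen inside DD (x) M(g,rho), through B_DD. *)
Definition top_act (z : DG k gT) (t : tens DD (Mg rho)) : tens DD (Mg rho) :=
  \sw_(z1, z2 <- hcomul (DG_hopf k gT) z) \sw_(d, m <- t)
    (ad z1 d \ot Mg_act rho z2 m).

Definition top_mod (t : tens DD (Mg rho)) : Prop :=
  t \in tens_sub (linfun B_DD @: ndeg NB (ntop NB))%VS fullv.

(* P is generated by a simple D(G)-submodule M isomorphic to M(g,rho) such that
   V M = 0. *)
Definition is_lowest_weight (N : lmodType k) (act : DD -> N -> N)
    (P : N -> Prop) : Prop :=
  is_submodule act P /\
  exists M : N -> Prop,
  [/\ forall x, M x -> P x,
      is_simple (fun z => act (DG_DD z)) M,
      mod_iso (fun z => act (DG_DD z)) M (Mg_act rho) (wholeT (Mg rho)),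
      forall v x, M x -> act (V_DD v) x = 0
    & forall Q : N -> Prop, is_submodule act Q -> (forall x, M x -> Q x) ->
        forall x, P x -> Q x].

End Weight.
End Nichols.

Arguments verma_act {k gT V YV B} NB {g n} rho d w.
Arguments top_act {k gT V YV B} NB {g n} rho z t.
Arguments top_mod {k gT V YV B} NB {g n} rho t.

(* Main.v *)
Require Import Defs.
From HB Require Import structures.
From mathcomp Require Import all_boot all_order all_algebra all_fingroup all_field.
From mathcomp Require Import mxrepresentation.
From mathcomp Require Import boolp classical_sets.
Set Implicit Arguments.
Unset Strict Implicit.
Unset Printing Implicit Defensive.
Import GRing.Theory VectorInternalTheory.
Local Open Scope ring_scope.

(* The functional phi dual to B^top makes (x, y) |-> phi(xy) nondegenerate: its
   radical is a left coideal ideal, and a nonzero left coideal of B # kG meets kG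
   because the elements of B of degree >= 2 are not primitive. Hence B^top is a
   line, and in the Verma module B (x) M(g,rho) the vectors killed by B^+ form
   B^top (x) M(g,rho). Every nonzero submodule contains such a vector, and
   B^top (x) M(g,rho) is simple over D(G), so it generates the socle, which is
   simple of lowest weight.

   Let J be the nilpotent ideal of D>=0 given by the functionals vanishing on kG.
   If L is generated by M with VM = 0, then L = D>=0 M = M + JL, and M and JL are
   disjoint when M is simple; so M is isomorphic to L/JL. A Goursat argument in
   L x L' then shows that a simple lowest weight module is determined by its
   lowest weight. Tensoring with the line B^top twists D(G)-modules by a character
   and a central element of G, hence permutes the weights. *)

(** * Linear algebra and tensors *)

(** The Verma module is induced from the side on which $\overline V$ kills M(g,rho), whereas lowest
    weights are read on vectors killed by V. Multiplication by V raises the degree of B, so these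
    vectors sit at the other end, in degree n_top. This is why the weight of the socle is a twist of
    (g,rho), and why recovering (g,rho) from a simple module requires undoing that twist.

    D>=0 is defined as a generated subalgebra and the Verma module as a quotient by a least space of
    relations, so neither comes with a basis. D>=0 turns out to be kG (x) (B # kG)^*, because
    $\overline V$ and k^G generate the dual: the coideal argument behind the Frobenius form, applied
    to an annihilator. The Verma module then gets explicit coordinate maps, well defined by the
    straightening rules of the double.

    A simple module is not assumed finite-dimensional. Finiteness comes from B: its finitely many
    degrees give both a vector killed by V and the nilpotency of J. *)

Definition lin (k : fieldType) (U W : lmodType k) (f : U -> W) : Prop :=
  forall c x y, f (c *: x + y) = c *: f x + f y.

Section Lin.
Variable k : fieldType.
Implicit Types U W X : lmodType k.

Lemma linP U W (f : {linear U -> W}) : lin f.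
Proof. by move=> c x y; rewrite linearP. Qed.

Lemma lin0 U W (f : U -> W) : lin f -> f 0 = 0.
Proof. by move=> hf; have := hf (-1) 0 0; rewrite scaler0 addr0 scaleN1r addNr. Qed.

Lemma linD U W (f : U -> W) x y : lin f -> f (x + y) = f x + f y.
Proof. by move=> hf; have := hf 1 x y; rewrite !scale1r. Qed.

Lemma linZ U W (f : U -> W) c x : lin f -> f (c *: x) = c *: f x.
Proof. by move=> hf; have := hf c x 0; rewrite (lin0 hf) !addr0. Qed.

Lemma linN U W (f : U -> W) x : lin f -> f (- x) = - f x.
Proof. by move=> hf; rewrite -scaleN1r (linZ _ _ hf) scaleN1r. Qed.

Lemma linB U W (f : U -> W) x y : lin f -> f (x - y) = f x - f y.
Proof. by move=> hf; rewrite (linD _ _ hf) (linN _ hf). Qed.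

Lemma lin_sumr U W (f : U -> W) (I : Type) (r : seq I) (P : pred I) (F : I -> U) :
  lin f -> f (\sum_(i <- r | P i) F i) = \sum_(i <- r | P i) f (F i).
Proof. by move=> hf; apply: (big_morph f) => [x y|]; [apply: linD | apply: lin0]. Qed.

Lemma lin_id U : lin (fun x : U => x).
Proof. by []. Qed.

Lemma lin_comp U W X (f : W -> X) (g : U -> W) : lin f -> lin g -> lin (fun x => f (g x)).
Proof. by move=> hf hg c x y; rewrite hg hf. Qed.

Lemma lin_zero U W : lin (fun _ : U => 0 : W).
Proof. by move=> c x y; rewrite scaler0 addr0. Qed.

Lemma lin_add U W (f g : U -> W) : lin f -> lin g -> lin (fun x => f x + g x).
Proof. by move=> hf hg c x y; rewrite hf hg scalerDr addrACA. Qed.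

Lemma lin_opp U W (f : U -> W) : lin f -> lin (fun x => - f x).
Proof. by move=> hf c x y; rewrite hf opprD scalerN. Qed.

Lemma lin_scale U W (f : U -> W) b : lin f -> lin (fun x => b *: f x).
Proof. by move=> hf c x y; rewrite hf scalerDr !scalerA mulrC. Qed.

Lemma lin_scalel U W (f : U -> k^o) (w : W) : lin f -> lin (fun x => f x *: w).
Proof. by move=> hf c x y; rewrite hf scalerDl scalerA. Qed.

Lemma lin_sum U W (I : Type) (r : seq I) (P : pred I) (F : I -> U -> W) :
  (forall i, lin (F i)) -> lin (fun x => \sum_(i <- r | P i) F i x).
Proof.
move=> hF c x y; rewrite scaler_sumr -big_split /=.
by apply: eq_bigr => i _; apply: hF.
Qed.

Lemma lin_if U W (b : bool) (f g : U -> W) :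
  lin f -> lin g -> lin (fun x => if b then f x else g x).
Proof. by case: b. Qed.

Lemma lin_hom (A C : vectType k) U (f : 'Hom(A, C)) (g : U -> A) :
  lin g -> lin (fun x => f (g x)).
Proof. by move=> hg; apply: (@lin_comp _ _ _ f g _ hg); apply: linP. Qed.

Lemma linfunE (A C : vectType k) (f : A -> C) : lin f -> linfun f =1 f.
Proof.
move=> hf x.
pose F := GRing.isLinear.Build k A C *:%R f hf.
pose f' : {linear A -> C} := HB.pack f F.
by rewrite (lfunE f').
Qed.

Lemma lin_mulkl U (f : U -> k^o) (c : k) : lin f -> lin (fun x => (f x * c : k^o)).
Proof. by move=> hf a x y; rewrite hf mulrDl -mulrA. Qed.

Lemma lin_mulkr U (f : U -> k^o) (c : k) : lin f -> lin (fun x => (c * f x : k^o)).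
Proof. by move=> hf a x y; rewrite hf mulrDr /GRing.scale /= mulrCA. Qed.

End Lin.

(** * Contractions of tensors in Sweedler notation *)

Section Tens.
Variable k : fieldType.
Implicit Types (A C : vectType k) (X Y : lmodType k).

Definition bilin (U W X : lmodType k) (f : U -> W -> X) :=
  (forall b, lin (fun a => f a b)) /\ (forall a, lin (f a)).

Lemma lin_tlift A C X Y (f : A -> C -> X) (t : Y -> tens A C) :
  lin t -> lin (fun y => tlift (t y) f).
Proof.
move=> ht c y z; rewrite ht /tlift scaler_sumr -big_split /=; apply: eq_bigr => i _.
rewrite scaler_sumr -big_split /=; apply: eq_bigr => j _.
by rewrite !mxE scalerDl scalerA.
Qed.

Lemma lin_tliftE A C X Y (f : Y -> A -> C -> X) (t : tens A C) :
  (forall a b, lin (fun y => f y a b)) -> lin (fun y => tlift t (f y)).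
Proof. by move=> hf; do 2![apply: lin_sum => ?]; apply: lin_scale. Qed.

Lemma tlift_ext A C X (f g : A -> C -> X) (t : tens A C) :
  (forall a b, f a b = g a b) -> tlift t f = tlift t g.
Proof. by move=> h; do 2![apply: eq_bigr => ? _]; rewrite h. Qed.

Lemma tlift_out A C X Y (g : X -> Y) (f : A -> C -> X) (t : tens A C) :
  lin g -> g (tlift t f) = tlift t (fun a b => g (f a b)).
Proof.
move=> hg; rewrite /tlift (lin_sumr _ _ _ hg); apply: eq_bigr => i _.
by rewrite (lin_sumr _ _ _ hg); apply: eq_bigr => j _; rewrite (linZ _ _ hg).
Qed.

(** Both sides are finite sums over basis vectors, so contractions commute without any linearity of
    [f]. *)
Lemma tlift_swap A C A' C' X (f : A -> C -> A' -> C' -> X) (t : tens A C)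
   (s : tens A' C') :
  tlift t (fun a b => tlift s (fun c d => f a b c d)) =
  tlift s (fun c d => tlift t (fun a b => f a b c d)).
Proof.
rewrite /tlift.
under eq_bigr => i _.
  under eq_bigr => j _.
    rewrite scaler_sumr; under eq_bigr => p _ do rewrite scaler_sumr.
    over.
  rewrite exchange_big /=; under eq_bigr => p _ do rewrite exchange_big /=.
  over.
rewrite exchange_big /=; apply: eq_bigr => p _; rewrite exchange_big /=.
apply: eq_bigr => q _; rewrite scaler_sumr; apply: eq_bigr => i _.
by rewrite scaler_sumr; apply: eq_bigr => j _; rewrite !scalerA mulrC.
Qed.

Lemma tlift_sum A C X (I : Type) (r : seq I) (P : pred I) (F : I -> A -> C -> X)
    (t : tens A C) :
  tlift t (fun a b => \sum_(i <- r | P i) F i a b) = \sum_(i <- r | P i) tlift t (F i).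
Proof.
rewrite /tlift [RHS]exchange_big /=; apply: eq_bigr => i _.
rewrite [RHS]exchange_big /=; apply: eq_bigr => j _.
by rewrite scaler_sumr.
Qed.

Lemma tlift0 A C X (t : tens A C) : tlift t (fun _ _ => 0 : X) = 0.
Proof. by rewrite /tlift; do 2![apply: big1 => ? _]; rewrite scaler0. Qed.

Lemma tliftD A C X (F G : A -> C -> X) (t : tens A C) :
  tlift t (fun a b => F a b + G a b) = tlift t F + tlift t G.
Proof.
rewrite /tlift -big_split /=; apply: eq_bigr => i _.
by rewrite -big_split /=; apply: eq_bigr => j _; rewrite scalerDr.
Qed.

Lemma tliftZ A C X c (F : A -> C -> X) (t : tens A C) :
  tlift t (fun a b => c *: F a b) = c *: tlift t F.
Proof. by rewrite (tlift_out _ _ (g := fun x => c *: x)) //; apply/lin_scale/lin_id. Qed.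

Lemma ebasis_sum A (a : A) : a = \sum_i v2r a 0 i *: ebasis i.
Proof.
rewrite -[LHS]v2rK {1}(row_sum_delta (v2r a)) linear_sum.
by apply: eq_bigr => i _; rewrite linearZ.
Qed.

Lemma v2r_ebasis A (i j : 'I_(dim A)) : v2r (ebasis i : A) 0 j = (i == j)%:R.
Proof. by rewrite /ebasis r2vK !mxE eqxx eq_sym. Qed.

Lemma lin_coord A (i : 'I_(dim A)) : lin (fun a : A => v2r a 0 i : k^o).
Proof. by move=> c x y; rewrite linearP !mxE. Qed.

(** Here bilinearity enters: [tlift] samples [f] on basis vectors only, and the value at a pure
    tensor is recovered by expanding both factors. *)
Lemma tlift_pure A C X (f : A -> C -> X) a b : bilin f -> tlift (a \ot b) f = f a b.
Proof.
move=> [hl hr]; rewrite {2}(ebasis_sum a) (lin_sumr _ _ _ (hl b)).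
apply: eq_bigr => i _; rewrite (linZ _ _ (hl b)) {2}(ebasis_sum b).
rewrite (lin_sumr _ _ _ (hr _)) scaler_sumr; apply: eq_bigr => j _.
by rewrite (linZ _ _ (hr _)) scalerA /tpure !mxE big_ord1 !mxE.
Qed.

Lemma tens_sum A C (t : tens A C) : t = tlift t (fun a b => a \ot b).
Proof.
rewrite {1}(matrix_sum_delta t); apply: eq_bigr => i _; apply: eq_bigr => j _.
congr (_ *: _); rewrite /tpure /ebasis !r2vK; apply/matrixP => p q.
by rewrite !mxE big_ord1 !mxE !eqxx /= -natrM mulnb.
Qed.

Lemma lin_tpurel A C Y (f : Y -> A) (b : C) : lin f -> lin (fun y => f y \ot b).
Proof. by move=> hf c x y; rewrite hf /tpure linearP /= linearP mulmxDl scalemxAl. Qed.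

Lemma lin_tpurer A C Y (f : Y -> C) (a : A) : lin f -> lin (fun y => a \ot f y).
Proof. by move=> hf c x y; rewrite hf /tpure linearP mulmxDr scalemxAr. Qed.

Lemma tens_ind A C (P : tens A C -> Prop) :
  P 0 -> (forall c x y, P x -> P y -> P (c *: x + y)) -> (forall a b, P (a \ot b)) ->
  forall t, P t.
Proof.
move=> h0 hD hp t; rewrite (tens_sum t).
have hs x y : P x -> P y -> P (x + y) by move=> *; rewrite -[x]scale1r; apply: hD.
have hz c x : P x -> P (c *: x) by move=> *; rewrite -[_ *: x]addr0; apply: hD.
by apply: (big_ind P) => // i _; apply: (big_ind P) => // j _; apply: hz.
Qed.

Lemma vect_ext A (a b : A) : (forall f : A -> k^o, lin f -> f a = f b) -> a = b.
Proof.
move=> h; rewrite (ebasis_sum a) (ebasis_sum b); apply: eq_bigr => i _.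
by have /= -> := h _ (lin_coord i).
Qed.

(* tlift only evaluates F at basis vectors, so F need not be bilinear. *)
Lemma tlift_coef A C X (t : tens A C) (F : A -> C -> X) :
  tlift t F = \sum_i \sum_j
    (tlift t (fun a b => v2r a 0 i * v2r b 0 j : k^o)) *: F (ebasis i) (ebasis j).
Proof.
apply: eq_bigr => i _; apply: eq_bigr => j _; congr (_ *: _).
rewrite /tlift (bigD1 i) //= (bigD1 j) //= !v2r_ebasis !eqxx mulr1 big1 => [|p hp].
  rewrite addr0 big1 => [|p hp]; first by rewrite addr0 /GRing.scale /= mulr1.
  by rewrite big1 ?scaler0 // => q _; rewrite !v2r_ebasis (negbTE hp) mul0r scaler0.
by rewrite !v2r_ebasis (negbTE hp) mulr0 scaler0.
Qed.

End Tens.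

Lemma lin_lfun_app (k : fieldType) (U : lmodType k) (C W : vectType k) (F : U -> 'Hom(C, W)) (x : C) :
  lin F -> lin (fun z => F z x).
Proof. by move=> hF c y z; rewrite hF lfunE /= lfunE. Qed.

(* lint closes goals lin f by recursion on f; lint_hyp is rebound whenever new
   linear operations become available. *)
Ltac lint_hyp := fail.
Ltac lint1 :=
  first
  [ assumption
  | apply: lin_id
  | apply: lin_zero
  | match goal with H : lin ?f |- lin (fun x => ?f x) => exact: H end
  | match goal with H : lin ?f |- lin (fun x => ?f (@?g x)) => apply: (lin_comp H) end
  | match goal with H : forall a, lin (?f a) |- lin (fun x => ?f ?b (@?g x)) =>
      apply: (lin_comp (H b)) end
  | match goal with H : forall a b, lin (?f a b) |- lin (fun x => ?f ?b ?c (@?g x)) =>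
      apply: (lin_comp (H b c)) end
  | match goal with H : forall b, lin (fun a => ?f a b) |- lin (fun x => ?f (@?g x) ?b) =>
      apply: (lin_comp (H b)) end
  | match goal with H : forall a b, lin (fun x => ?f a x b) |-
        lin (fun x => ?f ?a (@?g x) ?b) => apply: (lin_comp (H a b)) end
  | match goal with H : forall a b, lin (fun x => ?f x a b) |-
        lin (fun x => ?f (@?g x) ?a ?b) => apply: (lin_comp (H a b)) end
  | match goal with H : bilin ?f |- lin (fun x => ?f ?b (@?g x)) =>
      apply: (lin_comp (proj2 H b)) end
  | match goal with H : bilin ?f |- lin (fun x => ?f (@?g x) ?b) =>
      apply: (lin_comp (proj1 H b)) end
  | lint_hyp
  | apply: lin_add
  | apply: lin_opp
  | apply: lin_scale
  | apply: lin_scalel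
  | apply: lin_tlift
  | apply: lin_tliftE => ? ?
  | apply: lin_sum => ?
  | apply: lin_tpurel
  | apply: lin_tpurer
  | apply: lin_mulkl
  | apply: lin_mulkr
  | apply: lin_if
  | apply: lin_hom
  | apply: lin_lfun_app ].
Ltac lint := repeat (lint1; cbv beta).
Ltac blint := split=> ?; lint.

Section Tens2.
Variable k : fieldType.
Implicit Types (A C : vectType k) (X Y : lmodType k).

(** Variant of [tlift_coef] for a summand that sees the second leg only through a scalar: a single
    sum over basis vectors is then enough. *)
Lemma tlift_splitl A C X (t : tens A C) (h : C -> k^o) (G : A -> X) :
  tlift t (fun a b => h b *: G a) =
  \sum_i (tlift t (fun a b => v2r a 0 i * h b : k^o)) *: G (ebasis i).
Proof.
apply: eq_bigr => i _; rewrite /tlift (bigD1 i) //= [X in (_ + X) *: _]big1.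
  rewrite addr0 scaler_suml; apply: eq_bigr => j _.
  by rewrite v2r_ebasis eqxx mul1r scalerA.
by move=> p hp; apply: big1 => q _; rewrite v2r_ebasis (negbTE hp) mul0r scaler0.
Qed.

Lemma tlift_splitr A C X (t : tens A C) (h : A -> k^o) (G : C -> X) :
  tlift t (fun a b => h a *: G b) =
  \sum_j (tlift t (fun a b => v2r b 0 j * h a : k^o)) *: G (ebasis j).
Proof.
rewrite /tlift exchange_big /=; apply: eq_bigr => j _; rewrite scaler_suml.
apply: eq_bigr => i _; rewrite (bigD1 j) //= v2r_ebasis eqxx mul1r big1 => [|q hq].
  by rewrite addr0 scalerA.
by rewrite v2r_ebasis (negbTE hq) mul0r scaler0.
Qed.

(* Nested contractions only evaluate E at basis vectors, so E need not be
   multilinear in the conclusion. *)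
Lemma coassoc_ext A (D : A -> tens A A) (t : tens A A) :
  (forall E : A -> A -> A -> k^o, (forall b c, lin (fun a => E a b c)) ->
     (forall a c, lin (fun b => E a b c)) -> (forall a b, lin (E a b)) ->
     tlift t (fun a b => tlift (D b) (fun c d => E a c d)) =
     tlift t (fun a b => tlift (D a) (fun c d => E c d b))) ->
  forall X (E : A -> A -> A -> X),
     tlift t (fun a b => tlift (D b) (fun c d => E a c d)) =
     tlift t (fun a b => tlift (D a) (fun c d => E c d b)).
Proof.
move=> h X E; have lc := lin_coord.
(* Both sides become sums over basis triples; their coefficients are the two sides of [h] for the
   trilinear form that multiplies three coordinates. *)
transitivity (\sum_i \sum_j \sum_l tlift t (fun a b => tlift (D b) (fun c d =>
    v2r a 0 i * (v2r c 0 j * v2r d 0 l) : k^o)) *: E (ebasis i) (ebasis j) (ebasis l)).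
  under tlift_ext => a b do rewrite tlift_coef.
  rewrite tlift_sum [RHS]exchange_big /=; apply: eq_bigr => j _.
  rewrite tlift_sum [RHS]exchange_big /=; apply: eq_bigr => l _.
  rewrite tlift_splitl; apply: eq_bigr => i _; congr (_ *: _).
  apply: (tlift_ext (X := k^o)) => a b; rewrite (tlift_out _ _ (g := fun x : k^o => v2r a 0 i * x : k^o)) //.
  by apply: lin_mulkr; apply: lin_id.
transitivity (\sum_i \sum_j \sum_l tlift t (fun a b => tlift (D a) (fun c d =>
    v2r c 0 i * (v2r d 0 j * v2r b 0 l) : k^o)) *: E (ebasis i) (ebasis j) (ebasis l)).
  do 3![apply: eq_bigr => ? _]; congr (_ *: _); apply: h => *.
  - by apply: lin_mulkl; apply: lc.
  - by apply: lin_mulkr; apply: lin_mulkl; apply: lc.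
  - by do 2!apply: lin_mulkr; apply: lc.
apply/esym; under tlift_ext => a b do rewrite tlift_coef.
rewrite tlift_sum; apply: eq_bigr => i _; rewrite tlift_sum; apply: eq_bigr => j _.
rewrite tlift_splitr; apply: eq_bigr => l _; congr (_ *: _).
apply: (tlift_ext (X := k^o)) => a b.
rewrite (tlift_out _ _ (g := fun x : k^o => v2r b 0 l * x : k^o)); last first.
  by apply: lin_mulkr; apply: lin_id.
by apply: (tlift_ext (X := k^o)) => c d; rewrite mulrC -mulrA.
Qed.

End Tens2.

(** * Subspaces given by predicates, and quotients *)

Section Subspaces.
Variable k : fieldType.
Implicit Types (A : vectType k) (X : lmodType k).

Definition subspace X (P : X -> Prop) :=
  P 0 /\ forall (c : k) x y, P x -> P y -> P (c *: x + y).

Lemma subspaceD X (P : X -> Prop) x y : subspace P -> P x -> P y -> P (x + y).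
Proof. by case=> _ h ? ?; rewrite -[x]scale1r; apply: h. Qed.

Lemma subspaceZ X (P : X -> Prop) c x : subspace P -> P x -> P (c *: x).
Proof. by case=> h0 h ?; rewrite -[_ *: _]addr0; apply: h. Qed.

Lemma subspaceB X (P : X -> Prop) x y : subspace P -> P x -> P y -> P (x - y).
Proof. by move=> h ? ?; rewrite -scaleN1r addrC; apply: h.2. Qed.

Lemma subspace_sum X (P : X -> Prop) (I : Type) (r : seq I) (Q : pred I) (F : I -> X) :
  subspace P -> (forall i, Q i -> P (F i)) -> P (\sum_(i <- r | Q i) F i).
Proof.
move=> hP h; apply: (big_ind P) => //; first by case: hP.
by move=> x y; apply: subspaceD.
Qed.

Lemma subspace_tlift (A C : vectType k) X (P : X -> Prop) (t : tens A C) (F : A -> C -> X) :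
  subspace P -> (forall a b, P (F a b)) -> P (tlift t F).
Proof.
by move=> hP h; do 2![apply: subspace_sum => // ? _]; apply: subspaceZ.
Qed.

Lemma subspace_mem A (U : {vspace A}) : subspace (fun x => x \in U).
Proof. by split=> [|c x y hx hy]; rewrite ?mem0v // memvD ?memvZ. Qed.

(** Take a subspace of maximal dimension contained in [P]: adjoining one more element of [P] cannot
    enlarge it. *)
Lemma subspace_vspace A (P : A -> Prop) :
  subspace P -> exists U : {vspace A}, forall x, x \in U <-> P x.
Proof.
move=> hP.
pose Q d := `[< exists U : {vspace A}, \dim U = d /\ forall x, x \in U -> P x >].
have Q0 : exists d, Q d.
  exists 0%N; apply/asboolP; exists 0%VS; rewrite dimv0; split=> // x.
  by rewrite memv0 => /eqP ->; case: hP.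
have Qb d : Q d -> (d <= \dim (fullv : {vspace A}))%N.
  by move/asboolP=> [U [<- _]]; apply: dimvS (subvf _).
case: (ex_maxnP Q0 Qb) => d /asboolP [U [dU hU]] hmax; exists U => x; split; first exact: hU.
move=> Px; have : Q (\dim (U + <[x]>)%VS).
  apply/asboolP; exists (U + <[x]>)%VS; split=> // y /memv_addP [u hu [v]].
  by move=> /vlineP [c ->] ->; apply: subspaceD => //; [apply: hU | apply: subspaceZ].
move/hmax; rewrite -dU => hd.
have /eqP eU : U == (U + <[x]>)%VS by rewrite eqEdim addvSl.
by rewrite eU; apply: (subvP (addvSr _ _)); apply: memv_line.
Qed.

(** [least_vspace] is a choice with default 0, so its value is usable only once a least subspace has
    been exhibited. *)
Lemma least_vspaceE A (Q : {vspace A} -> Prop) U :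
  Q U -> (forall W, Q W -> (U <= W)%VS) -> least_vspace Q = U.
Proof.
move=> QU hU; rewrite /least_vspace; apply: xget_unique => [|W [QW hW]]; first by split.
by apply/eqP; rewrite eqEsubv hW ?hU.
Qed.

Section Vquot.
Variables (A : vectType k) (R : {vspace A}).

Lemma lin_vclass X (f : X -> A) : lin f -> lin (fun x => vclass R (f x)).
Proof. by move=> hf c x y; rewrite /vclass hf !linearP. Qed.

Lemma vreprK (q : vquot R) : vclass R (vrepr q) = q.
Proof.
by rewrite /vclass /vrepr daddv_pi_id ?subvsP ?vsvalK // capvC capv_compl.
Qed.

Lemma vclass_repr (t : A) : t - vrepr (vclass R t) \in R.
Proof.
rewrite /vclass /vrepr vsprojK ?memv_pi //.
rewrite -{1}(@daddv_pi_add _ _ (R^C)%VS R t); first by rewrite addrC addKr memv_pi.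
  by rewrite capvC capv_compl.
by rewrite addvC addv_complf memvf.
Qed.

Lemma vclass_eq0 (t : A) : (t \in R) <-> vclass R t = 0.
Proof.
split=> [tR|h]; last first.
  by have := vclass_repr t; rewrite h (_ : vrepr 0 = 0) ?subr0 //; apply: (linear0 (vsval)).
rewrite /vclass; have := @daddv_pi_add _ _ (R^C)%VS R t; rewrite capvC capv_compl addvC addv_complf memvf.
move/(_ erefl isT) => e; have e2 := @daddv_pi_id _ _ R (R^C)%VS t (capv_compl _) tR.
by move: e; rewrite e2 -[RHS]add0r => /addIr ->; rewrite linear0.
Qed.

End Vquot.
End Subspaces.

Lemma tens_eq (k : fieldType) (A C : vectType k) (X : lmodType k) (F G : tens A C -> X) :
  lin F -> lin G -> (forall a b, F (a \ot b) = G (a \ot b)) -> forall t, F t = G t.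
Proof.
move=> hF hG h; apply: tens_ind => //; first by rewrite !lin0.
by move=> c x y hx hy; rewrite hF hG hx hy.
Qed.

(** * Hopf algebras and their doubles *)

(** Coassociativity is asked for arbitrary [E], which makes it a rewriting rule in any context;
    [coassoc_ext] reduces this form to scalar trilinear [E]. *)
Record hopf_axioms (k : fieldType) (A : vectType k) (H : hopf_data A) : Prop := HopfAxioms {
  ha_mull : forall b, lin (fun a => hmul H a b);
  ha_mulr : forall a, lin (hmul H a);
  ha_mulA : forall a b c, hmul H a (hmul H b c) = hmul H (hmul H a b) c;
  ha_mul1 : forall a, hmul H a (hone H) = a;
  ha_1mul : forall a, hmul H (hone H) a = a;
  ha_comul : lin (hcomul H);
  ha_coassoc : forall (X : lmodType k) x (E : A -> A -> A -> X),
    \sw_(a, b <- hcomul H x) \sw_(c, d <- hcomul H b) E a c d =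
    \sw_(a, b <- hcomul H x) \sw_(c, d <- hcomul H a) E c d b;
  ha_counit : lin (hcounit H : A -> k^o);
  ha_counitl : forall x, \sw_(a, b <- hcomul H x) (hcounit H a *: b) = x;
  ha_counitr : forall x, \sw_(a, b <- hcomul H x) (hcounit H b *: a) = x;
  ha_comulM : forall x y, hcomul H (hmul H x y) =
    \sw_(a, b <- hcomul H x) \sw_(c, d <- hcomul H y) (hmul H a c \ot hmul H b d);
  ha_comul1 : hcomul H (hone H) = hone H \ot hone H;
  ha_counitM : forall x y, hcounit H (hmul H x y) = hcounit H x * hcounit H y;
  ha_counit1 : hcounit H (hone H) = 1;
  ha_anti : lin (hanti H);
  ha_antil : forall x, \sw_(a, b <- hcomul H x) hmul H (hanti H a) b = hcounit H x *: hone H;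
  ha_antir : forall x, \sw_(a, b <- hcomul H x) hmul H a (hanti H b) = hcounit H x *: hone H
}.

Section HopfTheory.
Variables (k : fieldType) (A : vectType k) (H : hopf_data A) (HA : hopf_axioms H).
Local Notation "x ** y" := (hmul H x y) (at level 40, left associativity).
Local Notation one := (hone H).
Local Notation Dl := (hcomul H).
Local Notation ep := (hcounit H).
Local Notation S := (hanti H).
Implicit Types (X Y U : lmodType k).

Lemma lin_hmull U (f : U -> A) b : lin f -> lin (fun x => f x ** b).
Proof. exact: (lin_comp (ha_mull HA b)). Qed.
Lemma lin_hmulr U (f : U -> A) a : lin f -> lin (fun x => a ** f x).
Proof. exact: (lin_comp (ha_mulr HA a)). Qed.
Lemma lin_hcomul U (f : U -> A) : lin f -> lin (fun x => Dl (f x)).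
Proof. exact: (lin_comp (ha_comul HA)). Qed.
Lemma lin_hcounit U (f : U -> A) : lin f -> lin (fun x => ep (f x) : k^o).
Proof. exact: (lin_comp (ha_counit HA)). Qed.
Lemma lin_hanti U (f : U -> A) : lin f -> lin (fun x => S (f x)).
Proof. exact: (lin_comp (ha_anti HA)). Qed.

Ltac lint_hyp ::= first [ apply: lin_hmull | apply: lin_hmulr | apply: lin_hcomul
  | apply: lin_hcounit | apply: lin_hanti ].

Lemma counitl_sw X (g : A -> X) x : lin g -> \sw_(a, b <- Dl x) (ep a *: g b) = g x.
Proof.
move=> hg; rewrite -{2}(ha_counitl HA x) (tlift_out _ _ hg).
by apply: tlift_ext => a b; rewrite (linZ _ _ hg).
Qed.

Lemma counitr_sw X (g : A -> X) x : lin g -> \sw_(a, b <- Dl x) (ep b *: g a) = g x.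
Proof.
move=> hg; rewrite -{2}(ha_counitr HA x) (tlift_out _ _ hg).
by apply: tlift_ext => a b; rewrite (linZ _ _ hg).
Qed.

Lemma antil_sw X (g : A -> X) x :
  lin g -> \sw_(a, b <- Dl x) g (S a ** b) = ep x *: g one.
Proof. by move=> hg; rewrite -(linZ _ _ hg) -(ha_antil HA) (tlift_out _ _ hg). Qed.

Lemma antir_sw X (g : A -> X) x :
  lin g -> \sw_(a, b <- Dl x) g (a ** S b) = ep x *: g one.
Proof. by move=> hg; rewrite -(linZ _ _ hg) -(ha_antir HA) (tlift_out _ _ hg). Qed.

Lemma comulM_sw X (E : A -> A -> X) x y : bilin E ->
  \sw_(a, b <- Dl (x ** y)) E a b =
  \sw_(a, b <- Dl x) \sw_(c, d <- Dl y) E (a ** c) (b ** d).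
Proof.
move=> hE; rewrite (ha_comulM HA) (tlift_out _ _ (g := fun t => tlift t E)); last by lint.
apply: tlift_ext => a b; rewrite (tlift_out _ _ (g := fun t => tlift t E)); last by lint.
by apply: tlift_ext => c d; rewrite tlift_pure.
Qed.

(** Both sides are convolution inverses of the product: the sum of S(x1 y1) (x2 y2) S(y3) S(x3) is
    collapsed once from the right and once from the left. *)
Lemma antiM x y : S (x ** y) = S y ** S x.
Proof.
pose F p q r p' q' r' := S (p ** p') ** (q ** q') ** (S r' ** S r).
transitivity (\sw_(a, x' <- Dl x) \sw_(b, c <- Dl x') \sw_(d, y' <- Dl y)
   \sw_(e, f <- Dl y') F a b c d e f).
  transitivity (\sw_(a, x' <- Dl x) \sw_(b, c <- Dl x') (S (a ** y) ** (b ** S c))).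
    under tlift_ext => a b.
      rewrite (antir_sw (g := fun z => S (a ** y) ** z)); last by lint.
      rewrite (ha_mul1 HA).
      over.
    by rewrite (counitr_sw (g := fun a => S (a ** y))) //; lint.
  apply: tlift_ext => a x'; apply: tlift_ext => b c.
  apply/esym; transitivity (\sw_(d, y' <- Dl y) \sw_(e, f <- Dl y')
     (S (a ** d) ** (b ** (e ** S f) ** S c))).
    by apply: tlift_ext => d y'; apply: tlift_ext => e f; rewrite /F !(ha_mulA HA).
  under tlift_ext => d y'.
    rewrite (antir_sw (g := fun z => S (a ** d) ** (b ** z ** S c))); last by lint.
    rewrite (ha_mul1 HA).
    over.
  by rewrite (counitr_sw (g := fun d => S (a ** d) ** _)) //; lint.
rewrite (ha_coassoc HA).
under tlift_ext => a c.
  under tlift_ext => p q do rewrite (ha_coassoc HA).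
  rewrite tlift_swap.
  under tlift_ext => b f.
    rewrite -(comulM_sw (E := fun u v => S u ** v ** (S f ** S c))); last by blint.
    rewrite (antil_sw (g := fun z => z ** (S f ** S c))); last by lint.
    rewrite (ha_1mul HA) (ha_counitM HA) -scalerA.
    over.
  rewrite tliftZ (counitl_sw (g := fun z => S z ** S c)); last by lint.
  over.
by rewrite (counitl_sw (g := fun z => S y ** S z)) //; lint.
Qed.

Lemma anti1 : S one = one.
Proof.
have := ha_antil HA one; rewrite (ha_comul1 HA) tlift_pure; last by blint.
by rewrite (ha_mul1 HA) (ha_counit1 HA) scale1r.
Qed.

Lemma counit_anti x : ep (S x) = ep x.
Proof.
have hl : lin (fun z => ep z : k^o) by apply: lin_hcounit; apply: lin_id.
have := antil_sw x hl; rewrite (ha_counit1 HA) [in RHS]/GRing.scale /= mulr1 => <-.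
have hl2 : lin (fun z => ep (S z) : k^o) by lint.
rewrite -(counitr_sw x hl2); apply: (tlift_ext (X := k^o)) => a b.
by rewrite (ha_counitM HA) mulrC.
Qed.

(** The convolution argument again, for maps from A to A (x) A: the coproduct of S and the flipped S
    (x) S are both inverse to the coproduct. *)
Lemma anti_comul_sw X (E : A -> A -> X) x : bilin E ->
  \sw_(p, q <- Dl (S x)) E p q = \sw_(a, b <- Dl x) E (S b) (S a).
Proof.
move=> hE.
transitivity (\sw_(a, x' <- Dl x) \sw_(b, x'' <- Dl x') \sw_(c, d <- Dl x'')
  \sw_(p, q <- Dl (S a)) \sw_(r, s <- Dl b) E (p ** r ** S d) (q ** s ** S c)).
  apply/esym; transitivity (\sw_(a, x' <- Dl x) (ep x' *: \sw_(p, q <- Dl (S a)) E p q)); last first.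
    by rewrite (counitr_sw (g := fun a => \sw_(p, q <- Dl (S a)) E p q)) //; lint.
  apply: tlift_ext => a x'.
  transitivity (\sw_(p, q <- Dl (S a)) \sw_(b, x'' <- Dl x') \sw_(r, s <- Dl b)
     \sw_(c, d <- Dl x'') E (p ** r ** S d) (q ** s ** S c)).
    under tlift_ext => b x'' do rewrite tlift_swap.
    rewrite tlift_swap; apply: tlift_ext => p q; apply: tlift_ext => b x''.
    by rewrite tlift_swap.
  rewrite -tliftZ; apply: tlift_ext => p q.
  rewrite -(ha_coassoc HA).
  transitivity (\sw_(r, y <- Dl x') (E (p ** r ** S y) q)); last first.
    transitivity (\sw_(r, y <- Dl x') (E (p ** (r ** S y)) q)).
      by apply: tlift_ext => r y; rewrite (ha_mulA HA).
    by rewrite (antir_sw (g := fun z => E (p ** z) q)) ?(ha_mul1 HA) //; lint.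
  apply: tlift_ext => r y; rewrite (ha_coassoc HA).
  transitivity (\sw_(w, d <- Dl y) (ep w *: E (p ** r ** S d) q)); last first.
    by rewrite (counitl_sw (g := fun d => E (p ** r ** S d) q)) //; lint.
  apply: tlift_ext => w d.
  transitivity (\sw_(s, c <- Dl w) (E (p ** r ** S d) (q ** (s ** S c)))).
    by apply: tlift_ext => s c; rewrite (ha_mulA HA).
  by rewrite (antir_sw (g := fun z => E (p ** r ** S d) (q ** z))) ?(ha_mul1 HA) //; lint.
rewrite (ha_coassoc HA).
transitivity (\sw_(w, y <- Dl x) (ep w *: \sw_(c, d <- Dl y) E (S d) (S c))); last first.
  by rewrite (counitl_sw (g := fun y => \sw_(c, d <- Dl y) E (S d) (S c))) //; lint.
apply: tlift_ext => w y; rewrite -tliftZ.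
rewrite tlift_swap; apply: tlift_ext => c d.
transitivity (\sw_(a, b <- Dl w) \sw_(p, q <- Dl (S a ** b)) E (p ** S d) (q ** S c)).
  by apply: tlift_ext => a b; rewrite (comulM_sw (E := fun p q => E (p ** S d) (q ** S c))) //; blint.
rewrite (antil_sw (g := fun z => \sw_(p, q <- Dl z) E (p ** S d) (q ** S c))); last by lint.
by rewrite (ha_comul1 HA) tlift_pure ?(ha_1mul HA) //; blint.
Qed.

(* The straightening of (1 (x) f)(y (x) 1) in the double pairs f with
   y_(1) x S(y_(3)) and leaves y_(2). *)
Definition straighten X (y x : A) (E : A -> A -> X) : X :=
  \sw_(y1, y' <- Dl y) \sw_(y2, y3 <- Dl y') E (y1 ** x ** S y3) y2.
Local Notation T := straighten.

Lemma straighten_ext X y x (E F : A -> A -> X) :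
  (forall a b, E a b = F a b) -> T y x E = T y x F.
Proof. by move=> h; do 2![apply: tlift_ext => ? ?]; apply: h. Qed.

Lemma straighten_out X Y (g : X -> Y) y x (E : A -> A -> X) :
  lin g -> g (T y x E) = T y x (fun a b => g (E a b)).
Proof.
move=> hg; rewrite /T (tlift_out _ _ hg); apply: tlift_ext => a b.
by rewrite (tlift_out _ _ hg).
Qed.

Lemma lin_straightenl X U (f : U -> A) x (E : A -> A -> X) :
  lin f -> (forall a, lin (E a)) -> (forall b, lin (fun a => E a b)) -> lin (fun z => T (f z) x E).
Proof. by move=> hf h1 h2; rewrite /T; lint. Qed.

Lemma lin_straightenr X U (f : U -> A) y (E : A -> A -> X) :
  lin f -> (forall b, lin (fun a => E a b)) -> lin (fun z => T y (f z) E).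
Proof. by move=> hf h2; rewrite /T; lint. Qed.

Lemma lin_straightenE X U y x (E : U -> A -> A -> X) :
  (forall a b, lin (fun z => E z a b)) -> lin (fun z => T y x (E z)).
Proof. by move=> h; rewrite /T; lint. Qed.

(** Half of the associativity of the double: since S reverses products, straightening past [y ** z]
    is straightening past [z], then past [y]. *)
Lemma straightenM X (E : A -> A -> X) y z x : bilin E ->
  T (y ** z) x E = T z x (fun x' b => T y x' (fun x'' a => E x'' (a ** b))).
Proof.
move=> hE; rewrite /T.
rewrite (comulM_sw (E := fun y1 y' => \sw_(y2, y3 <- Dl y') E (y1 ** x ** S y3) y2)); last by blint.
rewrite tlift_swap; apply: tlift_ext => z1 z'.
rewrite [RHS]tlift_swap; apply: tlift_ext => y1 y'.
rewrite (comulM_sw (E := fun y2 y3 => E (y1 ** z1 ** x ** S y3) y2)); last by blint.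
rewrite tlift_swap; apply: tlift_ext => z2 z3; apply: tlift_ext => y2 y3.
by rewrite antiM !(ha_mulA HA).
Qed.

(** The other half of associativity: both sides amount to splitting [y] into five legs, two on each
    side of the one that is kept, because S reverses coproducts. *)
Lemma straighten_comul X (F : A -> A -> A -> X) y x :
  (forall b c, lin (fun a => F a b c)) -> (forall a c, lin (fun b => F a b c)) ->
  T y x (fun z y2 => \sw_(z1, z2 <- Dl z) F z1 z2 y2) =
  \sw_(x1, x2 <- Dl x) T y x1 (fun z1 y' => T y' x2 (fun z2 y'' => F z1 z2 y'')).
Proof.
move=> h1 h2; rewrite /T.
pose G x1 x2 a b c d e := F (a ** x1 ** S e) (b ** x2 ** S d) c.
transitivity (\sw_(x1, x2 <- Dl x) \sw_(a, t1 <- Dl y) \sw_(b, t2 <- Dl t1)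
   \sw_(c, t3 <- Dl t2) \sw_(d, e <- Dl t3) G x1 x2 a b c d e).
  transitivity (\sw_(y1, y' <- Dl y) \sw_(y2, y3 <- Dl y') \sw_(x1, x2 <- Dl x)
     \sw_(a, b <- Dl y1) \sw_(c, d <- Dl y3) G x1 x2 a b y2 c d).
    apply: tlift_ext => y1 y'; apply: tlift_ext => y2 y3.
    rewrite (comulM_sw (E := fun u v => F u v y2)); last by blint.
    rewrite (comulM_sw (E := fun p q => \sw_(c, d <- Dl (S y3)) F (p ** c) (q ** d) y2)); last by blint.
    rewrite tlift_swap; apply: tlift_ext => x1 x2; apply: tlift_ext => a b.
    by rewrite (anti_comul_sw (E := fun c d => F (a ** x1 ** c) (b ** x2 ** d) y2)) //; blint.
  under tlift_ext => y1 y' do rewrite tlift_swap.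
  rewrite tlift_swap; apply: tlift_ext => x1 x2.
  under tlift_ext => y1 y' do rewrite tlift_swap.
  by rewrite -(ha_coassoc HA).
apply: tlift_ext => x1 x2; apply: tlift_ext => y1 y'; apply/esym.
rewrite -(ha_coassoc HA); apply: tlift_ext => p t.
by rewrite -(ha_coassoc HA).
Qed.

(** * The algebra structure of the Drinfeld double *)

Notation dualA := 'Hom(A, k^o).

(* h (x) f is seen as the endomorphism x |-> f(x) h. *)
Definition tens_ev (u : tens A dualA) (x : A) : A := tlift u (fun h (f : dualA) => f x *: h).

Lemma lin_ev U (F : U -> tens A dualA) x : lin F -> lin (fun z => tens_ev (F z) x).
Proof. by move=> hF; apply: lin_tlift. Qed.

Lemma lin_evx U u (F : U -> A) : lin F -> lin (fun z => tens_ev u (F z)).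
Proof. by move=> hF; apply: lin_tliftE => a b; apply: lin_scalel; apply: lin_hom. Qed.

Lemma ev_pure h f x : tens_ev (h \ot f) x = f x *: h.
Proof.
rewrite /tens_ev (tlift_pure (f := fun h (f : dualA) => f x *: h)) //; blint.
Qed.

Lemma dbasisE (i : 'I_(dim A)) (x : A) : dbasis i x = v2r x 0 i.
Proof. by rewrite linfunE //; apply: lin_coord. Qed.

Lemma dual_sum (f : dualA) : f = \sum_i f (ebasis i) *: dbasis i.
Proof.
apply/lfunP => x; rewrite sum_lfunE {1}(ebasis_sum x) linear_sum /=.
by apply: eq_bigr => i _; rewrite scale_lfunE dbasisE linearZ /GRing.scale /= mulrC.
Qed.

Definition of_fun (F : A -> A) : tens A dualA := \sum_i F (ebasis i) \ot dbasis i.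

Lemma tens_evK u : of_fun (tens_ev u) = u.
Proof.
move: u; apply: tens_eq; rewrite /of_fun.
- by apply: lin_sum => i; apply: lin_tpurel; apply: lin_ev.
- by [].
move=> h f; rewrite {2}(dual_sum f) (lin_sumr (f := fun f => h \ot f)); last by lint.
apply: eq_bigr => i _; rewrite ev_pure (linZ (f := fun f => h \ot f)); last by lint.
by rewrite (linZ (f := fun x => x \ot dbasis i)) //; lint.
Qed.

Lemma ev_inj u v : (forall x, tens_ev u x = tens_ev v x) -> u = v.
Proof. by move=> h; rewrite -(tens_evK u) -(tens_evK v); congr of_fun; apply: funext. Qed.

(** The coproduct of [f] can be contracted when [F] sees its legs only through their values at [x]
    and [y]; the defining pairing f(x y) then appears. *)
Lemma dcomul_sw X (f : dualA) x y (E : k^o -> k^o -> X) (F : dualA -> dualA -> X) :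
  bilin E -> (forall g h, F g h = E (g x) (h y)) ->
  tlift (dcomul H f) F = (f (x ** y) : k^o) *: E 1 1.
Proof.
move=> hE hF.
have eE a b : E a b = (a * b) *: E 1 1.
  have e1 (c : k^o) : c = c *: (1 : k^o) by rewrite /GRing.scale /= mulr1.
  by rewrite {1}(e1 a) (linZ _ _ (hE.1 b)) {1}(e1 b) (linZ _ _ (hE.2 1)) scalerA.
have bF : bilin F.
  split=> g c u v; rewrite !hF add_lfunE scale_lfunE; first by rewrite (hE.1 _).
  by rewrite (hE.2 _).
rewrite /dcomul (lin_sumr (f := fun t => tlift t F)); last by lint.
under eq_bigr => i _.
  rewrite (lin_sumr (f := fun t => tlift t F)); last by lint.
  under eq_bigr => j _.
    rewrite (linZ (f := fun t => tlift t F)); last by lint.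
    rewrite tlift_pure // hF eE !dbasisE.
    over.
  over.
rewrite /= {2}(ebasis_sum x) {2}(ebasis_sum y).
rewrite (lin_sumr (f := fun z => f (z ** _) *: E 1 1)); last by lint.
apply: eq_bigr => i _; rewrite (lin_sumr (f := fun z => f (_ ** z) *: E 1 1)); last by lint.
apply: eq_bigr => j _.
rewrite (linZ (f := fun z => f (_ ** z) *: E 1 1)); last by lint.
rewrite (linZ (f := fun z => f (z ** _) *: E 1 1)); last by lint.
by rewrite !scalerA; congr (_ *: _); rewrite mulrC [v2r y 0 j * _]mulrC.
Qed.

Lemma lin_dmull U (F : U -> dualA) g : lin F -> lin (fun z => dmul H (F z) g).
Proof.
move=> hF c x y; apply/lfunP => z.
have hl (f1 : dualA) : lin (fun z : A => \sw_(a, b <- Dl z) (f1 a * g b : k^o)) by lint.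
rewrite add_lfunE scale_lfunE /dmul !linfunE // hF.
have := @lin_tliftE k A A k^o dualA (fun f a b => f a * g b) (Dl z); apply=> a b.
by lint.
Qed.

Lemma dmulE f g x : dmul H f g x = \sw_(a, b <- Dl x) (f a * g b : k^o).
Proof. by rewrite /dmul linfunE //; lint. Qed.

Lemma dunitE x : dunit H x = ep x.
Proof. by rewrite /dunit linfunE //; apply: lin_hcounit; apply: lin_id. Qed.

Lemma lin_dcomul : lin (dcomul H).
Proof.
move=> c x y; rewrite /dcomul scaler_sumr -big_split /=; apply: eq_bigr => i _.
rewrite scaler_sumr -big_split /=; apply: eq_bigr => j _.
by rewrite add_lfunE scale_lfunE scalerDl -scalerA.
Qed.

Lemma lin_double_mull v : lin (fun u => double_mul H u v).
Proof. by rewrite /double_mul; lint. Qed.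

Lemma lin_double_mulr u : lin (double_mul H u).
Proof. by rewrite /double_mul; lint. Qed.

(** The product of the double read on endomorphisms: [v] consumes x_(1), its value is straightened
    against x_(2), and [u] is applied to the result. With [ev_inj] this replaces manipulations of
    the coproduct of functionals. *)
Lemma ev_mul u v x : tens_ev (double_mul H u v) x =
  \sw_(x1, x2 <- Dl x) T (tens_ev v x1) x2 (fun z y => tens_ev u z ** y).
Proof.
move: u; apply: tens_eq.
- by apply: lin_ev; apply: lin_double_mull.
- apply: lin_tliftE => a b; apply: lin_straightenE => c d.
  by apply: lin_hmull; apply: lin_ev.
move=> h f; move: v; apply: tens_eq.
- by apply: lin_ev; apply: lin_double_mulr.
- apply: lin_tliftE => a b; apply: lin_straightenl; first exact: lin_ev.
    by move=> c; lint.
  by move=> c; apply: lin_hmull; apply: lin_evx.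
move=> h' f'.
rewrite /double_mul tlift_pure; last by blint; apply: lin_dcomul.
rewrite tlift_pure; last by blint; apply: lin_dmull.
transitivity (\sw_(h1, h' <- Dl h') \sw_(h2, h3 <- Dl h') \sw_(x1, x2 <- Dl x)
    ((f (h1 ** (x2 ** S h3)) * f' x1) *: (h ** h2))); last first.
  under tlift_ext => h1 h23 do rewrite tlift_swap.
  rewrite tlift_swap; apply: tlift_ext => x1 x2.
  rewrite ev_pure /T.
  rewrite (linZ (f := fun z => \sw_(y1, y' <- Dl z) \sw_(y2, y3 <- Dl y')
      (tens_ev (h \ot f) (y1 ** x2 ** S y3) ** y2))); last by lint; apply: lin_evx; lint.
  rewrite -tliftZ; apply: tlift_ext => h1 h23; rewrite -tliftZ; apply: tlift_ext => h2 h3.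
  rewrite ev_pure (linZ (f := fun z => z ** h2)); last by lint.
  by rewrite scalerA mulrC !(ha_mulA HA).
have le : lin (fun t => tens_ev t x) by apply: lin_ev.
rewrite (tlift_out _ _ le); apply: tlift_ext => h1 h23.
rewrite (tlift_out _ _ le); apply: tlift_ext => h2 h3.
rewrite (tlift_out _ _ le).
under tlift_ext => f1 f23.
  rewrite (tlift_out _ _ le).
  under tlift_ext => f2 f3.
    rewrite (linZ _ _ le) ev_pure dmulE.
    rewrite (tlift_out _ _ (g := fun c : k^o => (f1 h1 * f3 (S h3)) *: (c *: (h ** h2)))); last by lint.
    over.
  rewrite tlift_swap.
  under tlift_ext => x1 x2.
    rewrite (@dcomul_sw _ f23 x2 (S h3)
      (fun p q => (f1 h1 * q) *: ((f' x1 * p : k^o) *: (h ** h2))) _) //; last by blint.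
    over.
  over.
rewrite tlift_swap; apply: tlift_ext => x1 x2.
rewrite (@dcomul_sw _ f h1 (x2 ** S h3)
      (fun p q => q *: ((p * 1) *: ((f' x1 * 1 : k^o) *: (h ** h2)))) _) //; last by blint.
by rewrite !mulr1 !scale1r scalerA.
Qed.

Lemma double_mulA u v w :
  double_mul H u (double_mul H v w) = double_mul H (double_mul H u v) w.
Proof.
apply: ev_inj => x; rewrite !ev_mul.
(* Common form of both sides, reached by [straightenM] from the left one and by [straighten_comul]
   from the right one. *)
transitivity (\sw_(x1, x' <- Dl x) \sw_(x2, x3 <- Dl x') T (tens_ev w x1) x2 (fun z1 y1 =>
   T y1 x3 (fun z2 y2 => T (tens_ev v z1) z2 (fun z3 y3 => tens_ev u z3 ** y3 ** y2)))).
  rewrite (ha_coassoc HA); apply: tlift_ext => x' x3.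
  have lT : lin (fun y => T y x3 (fun z3 y3 => tens_ev u z3 ** y3)).
    apply: lin_straightenl => [|a|b]; first by lint.
      by lint.
    by apply: lin_hmull; apply: lin_evx; lint.
  rewrite ev_mul (tlift_out _ _ lT); apply: tlift_ext => x1 x2.
  rewrite (straighten_out _ _ _ lT) //; apply: straighten_ext => z1 y1.
  rewrite straightenM; last by split=> b; [apply: lin_hmull; apply: lin_evx|]; lint.
  apply: straighten_ext => z2 y2; apply: straighten_ext => z3 y3.
  by rewrite (ha_mulA HA).
apply: tlift_ext => x1 x'.
rewrite -(straighten_comul (F := fun z1 z2 y2 =>
   T (tens_ev v z1) z2 (fun z3 y3 => tens_ev u z3 ** y3 ** y2))); first last.
- move=> a c; apply: lin_straightenr; first by lint.
  by move=> b; do 2![apply: lin_hmull]; apply: lin_evx; lint.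
- move=> b c; apply: lin_straightenl; first by apply: lin_evx; lint.
    by move=> a; lint.
  by move=> a; do 2![apply: lin_hmull]; apply: lin_evx; lint.
apply: straighten_ext => z y; rewrite ev_mul.
rewrite (tlift_out _ _ (g := fun z => z ** y)); last by lint.
apply: tlift_ext => z1 z2.
by rewrite (straighten_out _ _ _ (g := fun z => z ** y)) //; lint.
Qed.

Lemma ev_hmul h u x : tens_ev (double_mul H (h \ot dunit H) u) x = h ** tens_ev u x.
Proof.
rewrite ev_mul -[in RHS](ha_counitr HA x).
have le : lin (fun z => h ** tens_ev u z) by apply: lin_hmulr; apply: lin_evx; lint.
rewrite (tlift_out _ _ le); apply: tlift_ext => a b.
rewrite (linZ _ _ le).
move: (tens_ev u a) => y; rewrite /T.
transitivity (\sw_(y1, y' <- Dl y) (ep y1 *: (ep b *: (h ** y')))); last first.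
  by rewrite (counitl_sw (g := fun y => ep b *: (h ** y))) //; lint.
apply: tlift_ext => y1 y'.
rewrite scalerA -(counitr_sw (g := fun y => (ep y1 * ep b) *: (h ** y))); last by lint.
apply: tlift_ext => y2 y3; rewrite ev_pure dunitE !(ha_counitM HA) counit_anti.
by rewrite (linZ (f := fun h => h ** y2)) ?scalerA; [congr (_ *: _); rewrite mulrC|lint].
Qed.

Lemma straighten1 X x (E : A -> A -> X) : bilin E -> T one x E = E x one.
Proof.
move=> hE; rewrite /T (ha_comul1 HA) tlift_pure; last by blint.
rewrite (ha_comul1 HA) tlift_pure; last by blint.
by rewrite anti1 (ha_mul1 HA) (ha_1mul HA).
Qed.

Lemma straighten_grouplike X g x (E : A -> A -> X) : bilin E -> Dl g = g \ot g ->
  T g x E = E (g ** x ** S g) g.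
Proof.
move=> hE hg; rewrite /T hg tlift_pure; last by blint.
by rewrite hg tlift_pure //; blint.
Qed.

Lemma ev_mulf u f x :
  tens_ev (double_mul H u (one \ot f)) x = \sw_(x1, x2 <- Dl x) f x1 *: tens_ev u x2.
Proof.
rewrite ev_mul; apply: tlift_ext => x1 x2; rewrite ev_pure.
have bE : bilin (fun z y => tens_ev u z ** y).
  by split=> b; [apply: lin_hmull; apply: lin_evx|]; lint.
rewrite (linZ (f := fun y => T y x2 (fun z y => tens_ev u z ** y))); last first.
  by apply: lin_straightenl => *; [lint|lint|apply: lin_hmull; apply: lin_evx; lint].
by rewrite straighten1 // (ha_mul1 HA).
Qed.

Lemma ev_fmulh f h x : tens_ev (double_mul H (one \ot f) (h \ot dunit H)) x =
  T h x (fun z y => (f z : k^o) *: y).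
Proof.
rewrite ev_mul.
have lT a : lin (fun y => T y a (fun z y => tens_ev (one \ot f) z ** y)).
  by apply: lin_straightenl => *; [lint|lint|apply: lin_hmull; apply: lin_evx; lint].
under tlift_ext => a b do rewrite ev_pure dunitE (linZ _ _ (lT b)).
rewrite (counitl_sw (g := fun b => T h b (fun z y => tens_ev (one \ot f) z ** y))).
  apply: straighten_ext => z y; rewrite ev_pure (linZ (f := fun z => z ** y)); last by lint.
  by rewrite (ha_1mul HA).
by apply: lin_straightenr => [|b]; [lint|apply: lin_hmull; apply: lin_evx; lint].
Qed.

Lemma double_1mul u : double_mul H (one \ot dunit H) u = u.
Proof. by apply: ev_inj => x; rewrite ev_hmul (ha_1mul HA). Qed.

Lemma double_mul1 u : double_mul H u (one \ot dunit H) = u.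
Proof.
apply: ev_inj => x; rewrite ev_mulf.
under tlift_ext => a b do rewrite dunitE.
by rewrite (counitl_sw (g := tens_ev u)) //; apply: lin_evx; lint.
Qed.

Lemma double_hf h f : double_mul H (h \ot dunit H) (one \ot f) = h \ot f.
Proof.
by apply: ev_inj => x; rewrite ev_hmul !ev_pure (linZ (f := fun z => h ** z)) ?(ha_mul1 HA) //; lint.
Qed.

Lemma double_hh h h' :
  double_mul H (h \ot dunit H) (h' \ot dunit H) = (h ** h') \ot dunit H.
Proof.
by apply: ev_inj => x; rewrite ev_hmul !ev_pure (linZ (f := fun z => h ** z)) //; lint.
Qed.

Lemma double_ff f f' :
  double_mul H (one \ot f) (one \ot f') = one \ot dmul H f' f.
Proof.
apply: ev_inj => x; rewrite ev_mulf ev_pure dmulE.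
rewrite (tlift_out _ _ (g := fun c : k^o => c *: one)); last by lint.
by apply: tlift_ext => a b; rewrite ev_pure scalerA.
Qed.

End HopfTheory.

Ltac lint_hyp ::= fail.

Section Generic.
Variable k : fieldType.
Implicit Types (X Y U : lmodType k).

Lemma lin_mull (C : falgType k) U (f : U -> C) b : lin f -> lin (fun x => f x * b).
Proof. by move=> hf c x y; rewrite hf mulrDl scalerAl. Qed.

Lemma lin_mulr (C : falgType k) U (f : U -> C) b : lin f -> lin (fun x => b * f x).
Proof. by move=> hf c x y; rewrite hf mulrDr scalerAr. Qed.

Lemma lin_ffun (I : finType) (C : lmodType k) U (f : U -> {ffun I -> C}) g :
  lin f -> lin (fun x => f x g).
Proof. by move=> hf c x y; rewrite hf !ffunE. Qed.

Lemma tlift_map X (C C' D D' : vectType k) (t : tens C C') (F : C -> C' -> tens D D')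
   (E : D -> D' -> X) :
  tlift (tlift t F) E = tlift t (fun a b => tlift (F a b) E).
Proof. by rewrite (tlift_out _ _ (g := fun t => tlift t E)) //; apply/lin_tlift/lin_id. Qed.

Lemma tlift_suml X (D D' : vectType k) (I : Type) (r : seq I) (P : pred I)
   (F : I -> tens D D') (E : D -> D' -> X) :
  tlift (\sum_(i <- r | P i) F i) E = \sum_(i <- r | P i) tlift (F i) E.
Proof. by rewrite (lin_sumr (f := fun t => tlift t E)) //; apply/lin_tlift/lin_id. Qed.

Lemma sum_eq1 X (gT : finType) (g : gT) (F : gT -> X) : \sum_s (if s == g then F s else 0) = F g.
Proof. by rewrite -big_mkcond big_pred1_eq. Qed.

Lemma subspace_tlift_eq (A C : vectType k) X (F : A -> C -> X) (P : X -> Prop) :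
  subspace P -> subspace (fun t : tens A C => P (tlift t F)).
Proof.
have hl : lin (fun t : tens A C => tlift t F) by apply: lin_tlift; apply: lin_id.
move=> hP; split=> [|c x y hx hy]; first by rewrite (lin0 hl); case: hP.
by rewrite hl; apply: hP.2.
Qed.

Lemma subspace0 X : subspace (fun x : X => x = 0).
Proof. by split=> // c x y -> ->; rewrite scaler0 addr0. Qed.

End Generic.

Lemma tens_sub_ind (k : fieldType) (A C : vectType k) (U : {vspace A}) (W : {vspace C})
    (P : tens A C -> Prop) : subspace P ->
  (forall u w, u \in U -> w \in W -> P (u \ot w)) -> forall t, t \in tens_sub U W -> P t.
Proof.
move=> hP h t; have [X hX] := subspace_vspace hP.
have /subvP hs : (tens_sub U W <= X)%VS.
  apply/span_subvP => z /allpairsP [[u w] /= [hu hw ->]]; apply/hX/h; exact: vbasis_mem.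
by move=> /hs /hX.
Qed.

Lemma tens_sep (k : fieldType) (A C : vectType k) (t t' : tens A C) :
  (forall f : dual C, tlift t (fun a b => (f b : k^o) *: a) = tlift t' (fun a b => (f b : k^o) *: a)) ->
  t = t'.
Proof.
move=> h; rewrite (tens_sum t) (tens_sum t') !tlift_coef.
apply: eq_bigr => i _; apply: eq_bigr => j _; congr (_ *: _).
have e s : tlift s (fun a b => v2r a 0 i * v2r b 0 j : k^o) =
    v2r (tlift s (fun a b => (dbasis j b : k^o) *: a)) 0 i.
  rewrite (tlift_out _ _ (g := fun a : A => v2r a 0 i : k^o)); last exact: lin_coord.
  apply: (tlift_ext (X := k^o)) => a b; rewrite (linZ _ _ (lin_coord _)) dbasisE.
  by rewrite /GRing.scale /= mulrC.
by rewrite !e h.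
Qed.

Lemma dual_neq0 (k : fieldType) (A : vectType k) (a : A) :
  a != 0 -> exists f : dual A, f a != 0.
Proof.
move=> ha; apply: contrapT => h; case/eqP: ha; apply: vect_ext => f hf.
rewrite (lin0 hf); apply: contrapT => /eqP h2; apply: h.
by exists (linfun (f : A -> k^o)); rewrite linfunE.
Qed.

Lemma dual_ext (k : fieldType) (A : vectType k) (a b : A) :
  (forall f : dual A, f a = f b) -> a = b.
Proof. by move=> h; apply: vect_ext => f hf; have := h (linfun (f : A -> k^o)); rewrite !linfunE. Qed.

(* Every functional on the dual is an evaluation, so a proper subspace of the
   dual annihilates a nonzero vector. *)
Lemma dual_annihilator (k : fieldType) (A : vectType k) (T : {vspace (dual A)}) :
  (forall x, (forall f, f \in T -> f x = 0) -> x = 0) -> forall f, f \in T.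
Proof.
move=> h f0; apply: contrapT => /negP hf0.
have : vclass T f0 != 0 by apply/eqP => /vclass_eq0; apply/negP.
case/dual_neq0 => l hl.
pose th f := l (vclass T f).
have hth : lin (th : dual A -> k^o) by apply: (lin_comp (linP l)); apply: lin_vclass; apply: lin_id.
have hx (f : dual A) : f (\sum_i th (dbasis i) *: ebasis i) = th f.
  rewrite {2}(dual_sum f) linear_sum (lin_sumr _ _ _ hth); apply: eq_bigr => i _.
  by rewrite linearZ (linZ _ _ hth) /GRing.scale /= mulrC.
have h0 : \sum_i th (dbasis i) *: ebasis i = 0 :> A.
  by apply: h => f /vclass_eq0 hf; rewrite hx /th hf linear0.
by case/eqP: hl; rewrite -/(th f0) -hx h0 linear0.
Qed.

Lemma tens_sub_mem (k : fieldType) (A C : vectType k) (U : {vspace A}) (W : {vspace C}) u w :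
  u \in U -> w \in W -> u \ot w \in tens_sub U W.
Proof.
move=> hu hw; rewrite (coord_vbasis hu) (coord_vbasis hw).
rewrite (lin_sumr (f := fun u => u \ot _)); last by lint.
apply: memv_suml => i _; rewrite (linZ (f := fun u => u \ot _)); last by lint.
apply: memvZ; rewrite (lin_sumr (f := fun w => _ \ot w)); last by lint.
apply: memv_suml => j _; rewrite (linZ (f := fun w => _ \ot w)); last by lint.
apply/memvZ/memv_span; apply: allpairs_f; apply: mem_nth; by rewrite size_tuple.
Qed.

(** * The group algebra and its double *)

Section GroupHopf.
Variables (k : fieldType) (gT : finGroupType).
Local Notation kG := (kG k gT).
Local Notation HG := (group_hopf k gT).
Local Notation gelt := (@gelt k gT).
Implicit Types (X Y U : lmodType k).

Lemma geltE g h : gelt g h = (h == g)%:R.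
Proof. by rewrite ffunE. Qed.

Lemma kG_sum (a : kG) : a = \sum_g a g *: gelt g.
Proof.
apply/ffunP => h; rewrite sum_ffunE (bigD1 h) //= big1 => [|g hg].
  by rewrite ffunE geltE eqxx addr0 /GRing.scale /= mulr1.
by rewrite ffunE geltE eq_sym (negbTE hg) scaler0.
Qed.

Lemma lin_kG U (f : U -> kG) g : lin f -> lin (fun x => f x g).
Proof. exact: lin_ffun. Qed.

Ltac lint_hyp ::= first [ apply: lin_kG ].

Lemma sum_gelt X (F : gT -> X) h : \sum_g gelt h g *: F g = F h.
Proof.
rewrite (bigD1 h) //= geltE eqxx scale1r big1 ?addr0 // => g hg.
by rewrite geltE (negbTE hg) scale0r.
Qed.

Lemma kG_eq X (F G : kG -> X) :
  lin F -> lin G -> (forall g, F (gelt g) = G (gelt g)) -> forall a, F a = G a.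
Proof.
move=> hF hG h a; rewrite (kG_sum a) (lin_sumr _ _ _ hF) (lin_sumr _ _ _ hG).
by apply: eq_bigr => g _; rewrite (linZ _ _ hF) (linZ _ _ hG) h.
Qed.

Lemma geltM g h : hmul HG (gelt g) (gelt h) = gelt (g * h)%g.
Proof.
rewrite /=; under eq_bigr => a _ do
  (under eq_bigr => b _ do rewrite -scalerA; rewrite -scaler_sumr sum_gelt).
by rewrite (sum_gelt (fun a => gelt (a * h)%g)).
Qed.

Lemma gelt_comul g : hcomul HG (gelt g) = gelt g \ot gelt g.
Proof. by rewrite /= (sum_gelt (fun g => gelt g \ot gelt g)). Qed.

Lemma gelt_counit g : hcounit HG (gelt g) = 1.
Proof.
rewrite /= (bigD1 g) //= geltE eqxx big1 ?addr0 // => h hh.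
by rewrite geltE (negbTE hh).
Qed.

Lemma gelt_anti g : hanti HG (gelt g) = gelt g^-1%g.
Proof. by rewrite /= (sum_gelt (fun g => gelt g^-1%g)). Qed.

Lemma group_mul_lin : (forall b, lin (fun a => hmul HG a b)) /\ (forall a, lin (hmul HG a)).
Proof.
by split=> b; rewrite /=; lint.
Qed.

Lemma group_axioms : hopf_axioms HG.
Proof.
have [hm hm2] := group_mul_lin.
have hc : lin (hcomul HG) by rewrite /=; lint.
have he : lin (hcounit HG : kG -> k^o) by rewrite /=; lint.
have hS : lin (hanti HG) by rewrite /=; lint.
split=> //.
- move=> a b c; move: a; apply: kG_eq => [||x]; [by lint|by lint|].
  move: b; apply: kG_eq => [||y]; [by lint|by lint|].
  move: c; apply: kG_eq => [||z]; [by lint|by lint|].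
  by rewrite !geltM mulgA.
- apply: kG_eq => [||x]; [by lint|by lint|].
  by rewrite [hone _]/= geltM mulg1.
- apply: kG_eq => [||x]; [by lint|by lint|].
  by rewrite [hone _]/= geltM mul1g.
- move=> X x E; move: X E; apply: coassoc_ext => E h1 h2 h3.
  move: x; apply: kG_eq => [||x]; [by apply: lin_tlift|by apply: lin_tlift|].
  by rewrite gelt_comul !tlift_pure ?gelt_comul ?tlift_pure //; split=> ?; lint.
- apply: kG_eq => [||x]; [by lint|by lint|].
  by rewrite gelt_comul tlift_pure ?gelt_counit ?scale1r //; split=> ?; lint.
- apply: kG_eq => [||x]; [by lint|by lint|].
  rewrite gelt_comul (tlift_pure (f := fun a b => hcounit HG b *: a)) ?gelt_counit ?scale1r //.
  by blint.
- move=> a b; move: a; apply: kG_eq => [||x]; [by apply: (lin_comp hc)|by apply: lin_tlift|].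
  move: b; apply: kG_eq => [||y]; [by apply: (lin_comp hc); lint| |].
    by apply: lin_tliftE => ? ?; apply: lin_tlift.
  rewrite geltM !gelt_comul tlift_pure; last first.
    by split=> ?; lint; exact: hm2.
  by rewrite tlift_pure ?geltM //; split=> ?; lint.
- by rewrite [hone _]/= gelt_comul.
- move=> a b; move: a; apply: (kG_eq (X := k^o)) => [||x]; [by lint|by lint|].
  move: b; apply: (kG_eq (X := k^o)) => [||y]; [by lint|by lint|].
  by rewrite geltM !gelt_counit mulr1.
- by rewrite [hone _]/= gelt_counit.
- apply: kG_eq => [||x]; [by lint|by lint|].
  rewrite gelt_comul tlift_pure; last by blint.
  by rewrite gelt_anti geltM mulVg gelt_counit scale1r.
- apply: kG_eq => [||x]; [by lint|by lint|].
  rewrite gelt_comul tlift_pure; last by blint.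
  by rewrite gelt_anti geltM mulgV gelt_counit scale1r.
Qed.

Arguments group_hopf : simpl never.

Definition gdual (h : gT) : dual kG := linfun (fun a : kG => a h : k^o).

Lemma gdualE h (a : kG) : gdual h a = a h.
Proof. by rewrite linfunE //; lint. Qed.

Lemma gdual_sum (f : dual kG) : f = \sum_h f (gelt h) *: gdual h.
Proof.
apply/lfunP => a; move: a; apply: (kG_eq (X := k^o)); [exact: linP|exact: linP|] => g.
rewrite sum_lfunE (bigD1 g) //= big1 => [|h hh]; rewrite scale_lfunE gdualE geltE.
  by rewrite eqxx addr0 /GRing.scale /= mulr1.
by rewrite (negbTE hh) scaler0.
Qed.

Lemma DG_eq X (F G : DG k gT -> X) : lin F -> lin G ->
  (forall g h, F (gelt g \ot gdual h) = G (gelt g \ot gdual h)) -> forall z, F z = G z.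
Proof.
move=> hF hG h; apply: tens_eq => // a f.
move: a; apply: kG_eq => [||g]; [by lint|by lint|].
rewrite (gdual_sum f) (lin_sumr (f := fun f => gelt g \ot f)); last by lint.
rewrite (lin_sumr _ _ _ hF) (lin_sumr _ _ _ hG); apply: eq_bigr => s _.
rewrite (linZ (f := fun f => gelt g \ot f)); last by lint.
by rewrite (linZ _ _ hF) (linZ _ _ hG) h.
Qed.

Lemma dcomul_gdual X (F : dual kG -> dual kG -> X) h : bilin F ->
  tlift (dcomul HG (gdual h)) F = \sum_a F (gdual a) (gdual (a^-1 * h)%g).
Proof.
move=> hF.
have e (x y : kG) : gdual h (hmul HG x y) = \sum_a (gdual a x * gdual (a^-1 * h)%g y : k^o).
  have [hm hm2] := group_mul_lin.
  move: x; apply: (kG_eq (X := k^o)) => [||g]; [by lint|by lint|].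
  move: y; apply: (kG_eq (X := k^o)) => [||s]; [by lint|by lint|].
  rewrite geltM gdualE geltE (bigD1 g) //= !gdualE !geltE eqxx mul1r big1 => [|a ha].
    by rewrite addr0 -(inj_eq (mulgI g^-1%g)) mulKg.
  by rewrite gdualE geltE (negbTE ha) mul0r.
rewrite /dcomul tlift_suml.
under eq_bigr => i _.
  rewrite tlift_suml.
  under eq_bigr => j _.
    rewrite (linZ (f := fun t => tlift t F)); last by apply: lin_tlift; lint.
    rewrite tlift_pure // e scaler_suml.
    over.
  rewrite exchange_big /=.
  over.
rewrite exchange_big /=; apply: eq_bigr => a _.
rewrite [in RHS](dual_sum (gdual a)) (lin_sumr (f := fun f => F f _)); last by lint.
apply: eq_bigr => i _; rewrite (linZ (f := fun f => F f _)); last by lint.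
rewrite [in RHS](dual_sum (gdual (a^-1 * h)%g)) (lin_sumr (f := F (dbasis i))); last by exact: hF.2.
rewrite scaler_sumr; apply: eq_bigr => j _; rewrite (linZ (f := F (dbasis i))); last exact: hF.2.
by rewrite scalerA.
Qed.

Lemma DG_comul_sw X (E : DG k gT -> DG k gT -> X) g h : bilin E ->
  \sw_(z1, z2 <- hcomul (DG_hopf k gT) (gelt g \ot gdual h)) E z1 z2 =
  \sum_a E (gelt g \ot gdual a) (gelt g \ot gdual (a^-1 * h)%g).
Proof.
move=> hE.
have hc : lin (hcomul HG) by apply: ha_comul group_axioms.
have hd := @lin_dcomul k kG HG.
rewrite (_ : hcomul (DG_hopf k gT) _ = tlift (hcomul HG (gelt g)) (fun h1 h2 =>
    tlift (dcomul HG (gdual h)) (fun f1 f2 => (h1 \ot f1) \ot (h2 \ot f2)))); last first.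
  apply: (tlift_pure (f := fun c f => tlift (hcomul HG c) (fun h1 h2 =>
    tlift (dcomul HG f) (fun f1 f2 => (h1 \ot f1) \ot (h2 \ot f2))))).
  by split=> ?; lint; first [exact: hc | exact: hd].
rewrite tlift_map.
rewrite gelt_comul tlift_pure; last by blint.
rewrite tlift_map dcomul_gdual; last by blint.
by apply: eq_bigr => a _; rewrite tlift_pure.
Qed.

Lemma danti_op_gdual b : danti_op HG (gdual b) = gdual b^-1%g.
Proof.
have hS : lin (hanti HG) by apply: ha_anti group_axioms.
(* [danti_op] uses the pseudo-inverse of the antipode; it is a true inverse here because the
   antipode of kG is an involution. *)
have SS x : hanti HG (hanti HG x) = x.
  move: x; apply: kG_eq => [||x]; [by do 2![apply: lin_comp => //]|by lint|].
  by rewrite !gelt_anti invgK.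
apply/lfunP => a; rewrite /danti_op comp_lfunE !gdualE.
set y := (_^-1)%VF a.
have -> : y = hanti HG a.
  rewrite -[y]SS -[hanti HG y](linfunE hS) limg_lfunVK //.
  by rewrite -[a](SS a) -[hanti HG (hanti HG a)](linfunE hS) memv_img ?memvf.
move: a {y}; apply: (kG_eq (X := k^o)) => [||g]; [|by lint|].
  by apply: lin_kG.
by rewrite gelt_anti !geltE -eq_invg_sym eq_sym -(inj_eq invg_inj) invgK.
Qed.

(** The antipode reverses products, which gives delta_(b^-1) g^-1; moving g^-1 to the left
    conjugates the index by g. *)
Lemma DG_anti g b : hanti (DG_hopf k gT) (gelt g \ot gdual b) =
  gelt g^-1%g \ot gdual (g * b^-1 * g^-1)%g.
Proof.
have HA := group_axioms.
have hS : lin (hanti HG) by apply: ha_anti.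
have l1 v := @lin_double_mull k kG HG v.
have l2 u := @lin_double_mulr k kG HG u.
rewrite (_ : hanti _ _ = double_mul HG (hone HG \ot danti_op HG (gdual b))
    (hanti HG (gelt g) \ot dunit HG)); last first.
  apply: (tlift_pure (f := fun h f => double_mul HG (hone HG \ot danti_op HG f)
    (hanti HG h \ot dunit HG))).
  split=> ?; first by apply: (lin_comp (l2 _)); lint; exact: hS.
  apply: (lin_comp (l1 _)); lint; rewrite /danti_op => c x y.
  by apply/lfunP => z; rewrite !(comp_lfunE, add_lfunE, scale_lfunE).
rewrite danti_op_gdual gelt_anti; apply: ev_inj => x.
rewrite (ev_fmulh HA) (straighten_grouplike HA) ?gelt_comul //; last by blint.
rewrite gelt_anti invgK ev_pure; congr (_ *: _).
have [hm hm2] := group_mul_lin.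
move: x; apply: (kG_eq (X := k^o)) => [||s]; [by lint|by lint|].
rewrite !geltM !gdualE !geltE; congr (_%:R); congr nat_of_bool.
by rewrite -(inj_eq (mulgI g)) -(inj_eq (mulIg g^-1%g)) !mulgA mulgV mul1g mulgK.
Qed.

End GroupHopf.

Ltac lint_hyp ::= first [ apply: lin_ffun | apply: lin_kG
  | apply: (lin_comp (proj1 (group_mul_lin _ _) _)) | apply: (lin_comp (proj2 (group_mul_lin _ _) _)) ].

(** * Induced modules and modules over D(G) *)

Section ModIso.
Variables (k : fieldType) (A : vectType k).

Lemma submod_subspace (N : lmodType k) (a : A -> N -> N) P : is_submodule a P -> subspace P.
Proof. by case=> h0 hl _; split. Qed.

Lemma wholeT_submod (N : lmodType k) (a : A -> N -> N) : is_submodule a (wholeT N).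
Proof. by []. Qed.

(** The maps of [mod_iso] are meaningful on the submodules only, so the inverse is made of chosen
    preimages and takes junk values elsewhere. *)
Lemma mod_iso_sym (N N' : lmodType k) (a : A -> N -> N) P (a' : A -> N' -> N') P' :
  is_submodule a P -> mod_iso a P a' P' -> mod_iso a' P' a P.
Proof.
move=> [h0 hl ha] [f [f1 f2 f3 f4 f5]].
have [g hg] : exists g : N' -> N, forall y, P' y -> P (g y) /\ f (g y) = y.
  have h y : exists x, P' y -> P x /\ f x = y.
    by have [/f5 [x Px e]|ny] := pselect (P' y); [exists x|exists 0].
  by have [g hg] := choice h; exists g.
have hinj x : P x -> P' (f x) -> g (f x) = x.
  by move=> Px P'x; have [P1 e] := hg _ P'x; apply: f4.
exists g; split.
- move=> c x y /hg [Px ex] /hg [Py ey]; rewrite -{1}ex -{1}ey -f1 //.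
  by apply: hinj; [apply: hl|apply/f3/hl].
- move=> z x /hg [Px ex]; rewrite -{1}ex -f2 //.
  by apply: hinj; [apply: ha|apply/f3/ha].
- by move=> x /hg [].
- by move=> x y /hg [_ ex] /hg [_ ey] e; rewrite -ex -ey e.
by move=> y Py; exists (f y); [apply: f3|apply: hinj => //; apply: f3].
Qed.

Lemma mod_iso_trans (N N' N'' : lmodType k) (a : A -> N -> N) P (a' : A -> N' -> N') P'
   (a'' : A -> N'' -> N'') P'' :
  mod_iso a P a' P' -> mod_iso a' P' a'' P'' -> mod_iso a P a'' P''.
Proof.
move=> [f [f1 f2 f3 f4 f5]] [g [g1 g2 g3 g4 g5]]; exists (fun x => g (f x)); split.
- by move=> c x y Px Py; rewrite f1 // g1 //; apply: f3.
- by move=> z x Px; rewrite f2 // g2 //; apply: f3.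
- by move=> x Px; apply/g3/f3.
- by move=> x y Px Py e; apply: f4 => //; apply: g4 => //; apply: f3.
by move=> z /g5 [y /f5 [x Px <-] <-]; exists x.
Qed.

Lemma mod_iso_simple (N N' : lmodType k) (a : A -> N -> N) P (a' : A -> N' -> N') P' :
  is_submodule a' P' -> mod_iso a P a' P' -> is_simple a P -> is_simple a' P'.
Proof.
move=> hP' [f [f1 f2 f3 f4 f5]] [hP [x0 Px0 nx0] hs]; have [h0 hl ha] := hP.
have f0 : f 0 = 0.
  by have := f1 (-1) 0 0 h0 h0; rewrite scaler0 addr0 scaleN1r addNr.
split=> //; first by exists (f x0); [exact: f3|apply/eqP => e; case/eqP: nx0; apply: f4 => //; rewrite e f0].
move=> Q [q0 ql qa] hQ; have := hs (fun x => P x /\ Q (f x)) _ _; case.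
- split; first by rewrite f0.
    by move=> c x y [Px Qx] [Py Qy]; split; [exact: hl|rewrite f1 //; apply: ql].
  by move=> z x [Px Qx]; split; [exact: ha|rewrite f2 //; apply: qa].
- by move=> x [].
- move=> h; left => y Qy; have [x Px e] := f5 _ (hQ _ Qy).
  by rewrite -e (h x) ?f0 // e.
move=> h; right => y /f5 [x Px <-]; exact: (h _ Px).2.
Qed.

End ModIso.

Section Induced.
Variables (k : fieldType) (A : vectType k) (mulA : A -> A -> A) (S : {vspace A}).
Variables (U : vectType k) (act : A -> U -> U).
Hypothesis mul_bilin : bilin mulA.
Hypothesis mul_assoc : forall a b c, mulA a (mulA b c) = mulA (mulA a b) c.
Hypothesis act_lin : forall u, lin (fun a => act a u).
Hypothesis act_lin2 : forall a, lin (act a).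

Notation R := (ind_rel mulA S act).
Notation ind := (induced mulA S act).

(** The least space of relations exists, as the intersection of all spaces containing them, so
    [ind_rel] is not the default value 0. *)
Lemma ind_rel_mem a b u : b \in S -> mulA a b \ot u - a \ot act b u \in R.
Proof.
pose Q (W : {vspace tens A U}) := forall a b u, b \in S -> mulA a b \ot u - a \ot act b u \in W.
have hs : subspace (fun t => forall W, Q W -> t \in W).
  split=> [W _|c x y hx hy W hW]; first exact: mem0v.
  by rewrite memvD ?memvZ ?hx ?hy.
have [X hX] := subspace_vspace hs.
have -> : R = X.
  apply: least_vspaceE => [a' b' u' hb|W hW]; first by apply/hX => W; apply.
  by apply/subvP => t /hX; apply.
by move=> hb; apply/hX => W; apply.
Qed.

Lemma ind_rel_min (W : {vspace tens A U}) :
  (forall a b u, b \in S -> mulA a b \ot u - a \ot act b u \in W) -> (R <= W)%VS.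
Proof.
move=> hW; pose Q (W : {vspace tens A U}) := forall a b u, b \in S -> mulA a b \ot u - a \ot act b u \in W.
have hs : subspace (fun t => forall W, Q W -> t \in W).
  split=> [Z _|c x y hx hy Z hZ]; first exact: mem0v.
  by rewrite memvD ?memvZ ?hx ?hy.
have [X hX] := subspace_vspace hs.
have -> : R = X.
  apply: least_vspaceE => [a' b' u' hb|Z hZ]; first by apply/hX => Z; apply.
  by apply/subvP => t /hX; apply.
by apply/subvP => t /hX; apply.
Qed.

Definition ind_cl (a : A) (u : U) : ind := vclass R (a \ot u).

Lemma lin_ind_cll (X : lmodType k) (f : X -> A) u : lin f -> lin (fun x => ind_cl (f x) u).
Proof. by move=> hf; apply: lin_vclass; apply: lin_tpurel. Qed.

Lemma lin_ind_clr (X : lmodType k) (f : X -> U) a : lin f -> lin (fun x => ind_cl a (f x)).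
Proof. by move=> hf; apply: lin_vclass; apply: lin_tpurer. Qed.

Lemma ind_cl_bal a b u : b \in S -> ind_cl (mulA a b) u = ind_cl a (act b u).
Proof.
move=> hb; apply/eqP; rewrite -subr_eq0; apply/eqP.
have lv : lin (vclass R) by apply: (@lin_vclass _ _ R _ (fun x => x)); apply: lin_id.
by rewrite /ind_cl -(linB _ _ lv); apply/vclass_eq0; apply: ind_rel_mem.
Qed.

Lemma ind_clE (m : ind) : m = tlift (vrepr m) ind_cl.
Proof.
have lv : lin (vclass R) by apply: (@lin_vclass _ _ R _ (fun x => x)); apply: lin_id.
by rewrite -(tlift_out _ _ lv) -tens_sum vreprK.
Qed.

Lemma ind_ind (P : ind -> Prop) : subspace P -> (forall a u, P (ind_cl a u)) -> forall m, P m.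
Proof. by move=> hP h m; rewrite (ind_clE m); apply: subspace_tlift. Qed.

(** The universal property of induction. The value is computed on the chosen representative, so the
    map is linear for any [F]; balance over [S] is needed only to evaluate it on classes. *)
Definition ind_lift (X : lmodType k) (F : A -> U -> X) (m : ind) : X := tlift (vrepr m) F.

Lemma lin_ind_lift (X : lmodType k) (F : A -> U -> X) : lin (ind_lift F).
Proof.
by apply: lin_tlift => c x y; apply: (@linP k _ _ (vsval : subvs_of (R^C)%VS -> _)).
Qed.

Lemma ind_lift_cl (X : lmodType k) (F : A -> U -> X) a u : bilin F ->
  (forall a b u, b \in S -> F (mulA a b) u = F a (act b u)) ->
  ind_lift F (ind_cl a u) = F a u.
Proof.
move=> hF hb; have hl : lin (fun t : tens A U => tlift t F) by apply: lin_tlift; apply: lin_id.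
have hs : subspace (fun t : tens A U => tlift t F = 0).
  split=> [|c x y hx hy]; first exact: lin0 hl.
  by rewrite hl hx hy scaler0 addr0.
have [W hW] := subspace_vspace hs.
have /subvP hR : (R <= W)%VS.
  apply: ind_rel_min => a' b' u' hb'; apply/hW.
  by rewrite (linB _ _ hl) !tlift_pure // hb // subrr.
have /hW := hR _ (vclass_repr R (a \ot u)).
by rewrite (linB _ _ hl) tlift_pure // => /eqP; rewrite subr_eq0 => /eqP.
Qed.

Lemma ind_actE c m : ind_act c m = ind_lift (fun x u => ind_cl (mulA c x) u) m.
Proof.
have lv : lin (vclass R) by apply: (@lin_vclass _ _ R _ (fun x => x)); apply: lin_id.
by rewrite /ind_act (tlift_out _ _ lv).
Qed.

Lemma ind_act_cl c a u : ind_act c (ind_cl a u) = ind_cl (mulA c a) u.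
Proof.
rewrite ind_actE ind_lift_cl //.
  split=> [v|a']; first by apply: lin_ind_cll; apply: mul_bilin.2.
  by apply: lin_ind_clr; apply: lin_id.
by move=> a' b' u' hb; rewrite mul_assoc ind_cl_bal.
Qed.

Lemma lin_ind_act c : lin (ind_act c : ind -> ind).
Proof. by move=> d x y; rewrite !ind_actE lin_ind_lift. Qed.

Lemma lin_ind_actl (m : ind) : lin (fun c => ind_act c m).
Proof.
move=> d x y; rewrite !ind_actE /ind_lift -tliftZ -tliftD; apply: tlift_ext => a u.
by rewrite (lin_comp (@lin_ind_cll _ _ u (@lin_id k A)) (mul_bilin.1 a)).
Qed.

End Induced.

Section DGModules.
Variables (k : fieldType) (gT : finGroupType).
Local Notation gelt := (@gelt k gT).
Local Notation gdual := (@gdual k gT).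
Local Notation DG := (DG k gT).

(* A D(G)-module is a G-graded space (W h is the projection onto degree h) with
   a compatible action of G. *)
Record dgmod (N : lmodType k) (a : DG -> N -> N) (G W : gT -> N -> N) : Prop := DGMod {
  dg_linz : forall x, lin (fun z => a z x);
  dg_linG : forall g, lin (G g);
  dg_linW : forall h, lin (W h);
  dg_act : forall g h x, a (gelt g \ot gdual h) x = G g (W h x);
  dg_G1 : forall x, G 1%g x = x;
  dg_GM : forall g h x, G (g * h)%g x = G g (G h x);
  dg_WW : forall h h' x, W h (W h' x) = if h == h' then W h x else 0;
  dg_sumW : forall x, \sum_h W h x = x;
  dg_WG : forall h g x, W h (G g x) = G g (W (g^-1 * h * g)%g x) }.

Section One.
Variables (N : lmodType k) (a : DG -> N -> N) (G W : gT -> N -> N).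
Hypothesis hN : dgmod a G W.

Lemma dg_actE z x : a z x = \sum_g \sum_h (\sw_(c, f <- z) (c g * f (gelt h) : k^o)) *: G g (W h x).
Proof.
move: z; apply: DG_eq; first exact: dg_linz hN x.
  do 2!apply: lin_sum => ?; apply: lin_scalel; apply: lin_tlift; exact: lin_id.
move=> g0 h0; rewrite (dg_act hN).
have hb g h : bilin (fun (c : kG k gT) (f : dual (kG k gT)) => (c g * f (gelt h) : k^o)) by blint.
rewrite (bigD1 g0) //= [X in _ + X]big1 => [|g hg]; last first.
  by apply: big1 => h _; rewrite (tlift_pure _ _ (hb _ _)) geltE (negbTE hg) mul0r scale0r.
rewrite addr0 (bigD1 h0) //= big1 => [|h hh]; last first.
  by rewrite (tlift_pure _ _ (hb _ _)) gdualE !geltE [h0 == h]eq_sym (negbTE hh) mulr0 scale0r.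
by rewrite addr0 (tlift_pure _ _ (hb _ _)) gdualE !geltE !eqxx mulr1 scale1r.
Qed.

Lemma dg_linx z : lin (a z).
Proof.
have h : lin (fun x => \sum_g \sum_h (\sw_(c, f <- z) (c g * f (gelt h) : k^o)) *: G g (W h x)).
  do 2![apply: lin_sum => ?]; apply: lin_scale.
  by apply: (lin_comp (dg_linG hN _)); apply: dg_linW hN _.
by move=> c x y; rewrite !dg_actE h.
Qed.

Lemma dg_G_act g x : G g x = a (gelt g \ot dunit (group_hopf k gT)) x.
Proof.
have -> : dunit (group_hopf k gT) = \sum_h gdual h.
  rewrite [LHS](gdual_sum); apply: eq_bigr => h _.
  by rewrite (dunitE (group_axioms k gT)) gelt_counit scale1r.
rewrite (lin_sumr (f := fun f => gelt g \ot f)); last by lint.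
rewrite (lin_sumr _ _ _ (dg_linz hN x)) -{1}(dg_sumW hN x) (lin_sumr _ _ _ (dg_linG hN g)).
by apply: eq_bigr => h _; rewrite (dg_act hN).
Qed.

Lemma dg_W_act h x : W h x = a (gelt 1 \ot gdual h) x.
Proof. by rewrite (dg_act hN) (dg_G1 hN). Qed.

Lemma dg_submodP (P : N -> Prop) : is_submodule a P <->
  [/\ subspace P, forall g x, P x -> P (G g x) & forall h x, P x -> P (W h x)].
Proof.
split=> [h|[hP hG hW]].
  split; first exact: submod_subspace h.
    by move=> g x Px; rewrite dg_G_act; apply: (let: And3 _ _ f := h in f).
  by move=> g x Px; rewrite dg_W_act; apply: (let: And3 _ _ f := h in f).
split; [by case: hP|by case: hP|] => z x Px; rewrite dg_actE.
by do 2![apply: subspace_sum => // ? _]; apply: subspaceZ => //; apply/hG/hW.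
Qed.

End One.

Lemma dg_morph (N N' : lmodType k) a G W (a' : DG -> N' -> N') G' W' (f : N -> N') (P : N -> Prop) :
  dgmod a G W -> dgmod a' G' W' -> lin f -> 
  (forall h x, P x -> P (W h x)) ->
  (forall g x, P x -> f (G g x) = G' g (f x)) ->
  (forall h x, P x -> f (W h x) = W' h (f x)) ->
  forall z x, P x -> f (a z x) = a' z (f x).
Proof.
move=> hN hN' hf hP hG hW z x Px; rewrite (dg_actE hN) (dg_actE hN').
rewrite (lin_sumr _ _ _ hf); apply: eq_bigr => g _.
rewrite (lin_sumr _ _ _ hf); apply: eq_bigr => h _.
by rewrite (linZ _ _ hf) hG ?hW //; apply: hP.
Qed.

Section Mg.
Variables (g0 : gT) (n : nat) (rho : mx_representation k 'C[g0] n).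
Local Notation Mg := (Mg rho).
Local Notation HG := (group_hopf k gT).
Local Notation C := 'C[g0]%g.

Let mul_bilin : bilin (hmul HG).
Proof. by split=> b; [apply: (group_mul_lin k gT).1|apply: (group_mul_lin k gT).2]. Qed.

Let mul_assoc := ha_mulA (group_axioms k gT).

Lemma lin_mulmxr (X : lmodType k) p q r (M : 'M[k]_(p, q)) (f : X -> 'M[k]_(q, r)) :
  lin f -> lin (fun x => M *m f x).
Proof. by move=> hf c x y; rewrite hf linearP. Qed.

Lemma centr_act_lin u : lin (fun a => centr_act rho a u).
Proof. by rewrite /centr_act; apply: lin_sum => c; apply: lin_scalel; lint. Qed.

(** The vector x (x) u of M(g0,rho); its degree in G is x g0 x^-1. *)
Definition mg (x : gT) (u : 'cV[k]_n) : Mg := ind_cl (hmul HG) (centr_alg k g0) (centr_act rho) (gelt x) u.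

Lemma lin_mg (X : lmodType k) x (f : X -> 'cV[k]_n) : lin f -> lin (fun z => mg x (f z)).
Proof. exact: lin_ind_clr. Qed.

Lemma gelt_centr c : c \in C -> gelt c \in centr_alg k g0.
Proof. by move=> hc; apply: memv_span; apply: map_f; rewrite mem_enum. Qed.

Lemma centr_ind (P : kG k gT -> Prop) : subspace P -> (forall c, c \in C -> P (gelt c)) ->
  forall b, b \in centr_alg k g0 -> P b.
Proof.
move=> hP h; have [X hX] := subspace_vspace hP.
have /subvP hs : (centr_alg k g0 <= X)%VS.
  by apply/span_subvP => z /mapP [c]; rewrite mem_enum => hc ->; apply/hX/h.
by move=> b /hs /hX.
Qed.

Lemma centr_act_gelt c u : c \in C -> centr_act rho (gelt c) u = rho c *m u.
Proof.
move=> hc; rewrite /centr_act (bigD1 c) //= geltE eqxx scale1r big1 ?addr0 // => d /andP [_ hd].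
by rewrite geltE (negbTE hd) scale0r.
Qed.

Lemma mgM x c u : c \in C -> mg (x * c)%g u = mg x (rho c *m u).
Proof.
move=> hc; rewrite -(centr_act_gelt _ hc) /mg -geltM.
by apply: ind_cl_bal; apply: gelt_centr.
Qed.

Lemma mg_ind (P : Mg -> Prop) : subspace P -> (forall x u, P (mg x u)) -> forall m, P m.
Proof.
move=> hP h; apply: ind_ind => // a u; rewrite (kG_sum a).
rewrite (lin_sumr (f := fun a => ind_cl _ _ _ a u)); last by apply: lin_ind_cll; apply: lin_id.
apply: subspace_sum => // x _.
rewrite (linZ (f := fun a => ind_cl _ _ _ a u)); last by apply: lin_ind_cll; apply: lin_id.
by apply: subspaceZ => //; apply: (h x u).
Qed.

Lemma mg_eq (X : lmodType k) (F F' : Mg -> X) : lin F -> lin F' ->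
  (forall x u, F (mg x u) = F' (mg x u)) -> forall m, F m = F' m.
Proof.
move=> hF hF' h; apply: mg_ind => //; split=> [|c x y hx hy]; first by rewrite !lin0.
by rewrite hF hF' hx hy.
Qed.

Definition mg_lift (X : lmodType k) (f : gT -> 'cV[k]_n -> X) (m : Mg) : X :=
  ind_lift (fun (a : kG k gT) u => \sum_x a x *: f x u) m.

Lemma lin_mg_lift (X : lmodType k) (f : gT -> 'cV[k]_n -> X) : lin (mg_lift f).
Proof. exact: lin_ind_lift. Qed.

Lemma mg_lift_mg (X : lmodType k) (f : gT -> 'cV[k]_n -> X) x u : (forall x, lin (f x)) ->
  (forall x c u, c \in C -> f (x * c)%g u = f x (rho c *m u)) ->
  mg_lift f (mg x u) = f x u.
Proof.
move=> hl hc.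
have hb : bilin (fun (a : kG k gT) u => \sum_x a x *: f x u).
  split=> [v|a]; first by apply: lin_sum => y; apply: lin_scalel; lint.
  by apply: lin_sum => y; apply: lin_scale; apply: hl.
rewrite /mg_lift ind_lift_cl //; first by rewrite sum_gelt.
move=> a b v hv; move: b hv; apply: centr_ind => [|c Cc].
  have l1 : lin (fun b => \sum_y hmul HG a b y *: f y v).
    by apply: (lin_comp (hb.1 v)); apply: mul_bilin.2.
  have l2 : lin (fun b => \sum_y a y *: f y (centr_act rho b v)).
    by apply: (lin_comp (hb.2 a)); apply: centr_act_lin.
  split=> [|d b b' e e']; first by rewrite (lin0 l1) (lin0 l2).
  by rewrite l1 l2 e e'.
rewrite centr_act_gelt //; move: a; apply: kG_eq => [||y].
- by apply: (lin_comp (hb.1 v)); apply: mul_bilin.1.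
- exact: hb.1.
by rewrite geltM !sum_gelt hc.
Qed.

Definition Gm (h : gT) (m : Mg) : Mg := ind_act (gelt h) m.
Definition Wm (h : gT) (m : Mg) : Mg := Mg_fact (gdual h) m.

Lemma Gm_mg h x u : Gm h (mg x u) = mg (h * x)%g u.
Proof.
by rewrite /Gm /mg ind_act_cl ?geltM //.
Qed.

Lemma lin_Gm h : lin (Gm h).
Proof. by move=> c x y; rewrite /Gm !ind_actE lin_ind_lift. Qed.

Lemma Mg_factE f (m : Mg) :
  Mg_fact f m = mg_lift (fun x u => (f (gelt (x * g0 * x^-1)%g) : k) *: (mg x u : Mg)) m.
Proof.
rewrite /Mg_fact; set R := ind_rel _ _ _.
have lv : lin (vclass R) by apply: (@lin_vclass _ _ R _ (fun x => x)); apply: lin_id.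
rewrite (tlift_out _ _ lv); apply: tlift_ext => a u.
rewrite (lin_sumr _ _ _ lv); apply: eq_bigr => x _.
by rewrite (linZ _ _ lv) scalerA.
Qed.

Lemma Mg_fact_mg f x u : Mg_fact f (mg x u) = (f (gelt (x * g0 * x^-1)%g) : k) *: (mg x u : Mg).
Proof.
rewrite Mg_factE mg_lift_mg // => [y|y c v hc].
  by apply: lin_scale; apply: lin_mg; apply: lin_id.
(* The degree [x * g0 * x^-1] depends only on the coset of [x] modulo the centralizer of [g0]. *)
rewrite mgM //; congr (f (gelt _) *: _); rewrite invMg !mulgA; congr (_ * _)%g.
by rewrite -(mulgA y) -(mulgA y); congr (_ * _)%g; rewrite -[RHS](mulgK c) (cent1P hc) .
Qed.

Lemma Wm_mg h x u : Wm h (mg x u) = if (x * g0 * x^-1)%g == h then mg x u else 0.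
Proof.
rewrite /Wm Mg_fact_mg gdualE geltE eq_sym.
by case: eqP; rewrite ?scale1r ?scale0r.
Qed.

Lemma lin_Mg_fact f : lin (Mg_fact f : Mg -> Mg).
Proof. by move=> c x y; rewrite !Mg_factE lin_mg_lift. Qed.

Lemma Mg_dgmod : dgmod (Mg_act rho) Gm Wm.
Proof.
have lG := lin_Gm; have lW h : lin (Wm h) by apply: lin_Mg_fact.
have hs (m : Mg) (F F' : Mg -> Mg) : lin F -> lin F' -> (forall x u, F (mg x u) = F' (mg x u)) -> F m = F' m.
  by move=> *; apply: mg_eq.
split=> //.
- by move=> x; apply: lin_tlift; apply: lin_id.
- move=> g h x; rewrite /Mg_act (tlift_pure (f := fun h f => ind_act h (Mg_fact f x))) //.
  split=> [f|c]; first by apply: lin_ind_actl.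
  move=> d f f'.
  have -> : Mg_fact (d *: f + f') x = d *: Mg_fact f x + Mg_fact f' x.
    have lF := lin_Mg_fact.
    apply: (hs x (Mg_fact (d *: f + f')) (fun x => d *: Mg_fact f x + Mg_fact f' x)); [exact: lF|by apply: lin_add => //; apply: lin_scale|].
    by move=> y u; rewrite !Mg_fact_mg add_lfunE scale_lfunE scalerDl scalerA.
  by move=> *; rewrite !ind_actE lin_ind_lift.
- by move=> m; apply: (hs m (Gm 1%g) id) => // x u; rewrite Gm_mg mul1g.
- move=> g h m; apply: (hs m (Gm (g * h)%g) (fun m => Gm g (Gm h m))) => // [|x u]; first by apply: (lin_comp (lG g)).
  by rewrite !Gm_mg mulgA.
- move=> h h' m; apply: (hs m (fun m => Wm h (Wm h' m)) (fun m => if h == h' then Wm h m else 0)); [by apply: (lin_comp (lW h))| |].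
    by apply: lin_if => //; apply: lin_zero.
  move=> x u; rewrite !Wm_mg; case: (h =P h') => [<-|hn].
    by case: eqP => [e|_]; rewrite ?(lin0 (lW h)) // Wm_mg e eqxx.
  case: (_ =P h') => [e|_]; rewrite ?(lin0 (lW h)) // Wm_mg e.
  by case: eqP => // e2; case: hn.
- move=> m; apply: (hs m (fun m => \sum_h Wm h m) id) => //; first exact: lin_sum.
  move=> x u; rewrite (bigD1 (x * g0 * x^-1)%g) //= big1 => [|h hh]; first by rewrite Wm_mg eqxx addr0.
  by rewrite Wm_mg eq_sym (negbTE hh).
move=> h g m; apply: (hs m (fun m => Wm h (Gm g m)) (fun m => Gm g (Wm (g^-1 * h * g)%g m))).
- exact: (lin_comp (lW h)).
- exact: (lin_comp (lG g)).
move=> x u; rewrite Gm_mg !Wm_mg.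
have -> : (g * x * g0 * (g * x)^-1 == h)%g = (x * g0 * x^-1 == g^-1 * h * g)%g.
  rewrite -[RHS](inj_eq (mulgI g)) -[RHS](inj_eq (mulIg g^-1%g)).
  by rewrite !mulgA mulgV mul1g mulgK invMg !mulgA.
by case: eqP => _; rewrite ?Gm_mg ?(lin0 (lG g)).
Qed.

(** The component 1 (x) U has a retraction: [rho] on the centralizer and 0 on the other cosets. *)
Lemma mg1_inj u : mg 1 u = 0 -> u = 0.
Proof.
pose f x (u : 'cV[k]_n) : 'cV[k]_n := if x \in C then rho x *m u else 0.
have h1 x : lin (f x) by apply: lin_if; [apply: lin_mulmxr; apply: lin_id|apply: lin_zero].
have h2 x c v : c \in C -> f (x * c)%g v = f x (rho c *m v).
  by move=> hc; rewrite /f groupMr //; case: ifP => // hx; rewrite mulmxA repr_mxM.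
move=> e; have := mg_lift_mg 1%g u h1 h2; rewrite e (lin0 (lin_mg_lift f)) /f group1.
by rewrite repr_mx1 mul1mx.
Qed.

End Mg.
End DGModules.

(** * Irreducible representations in terms of column vectors *)

Section Irreducible.
Variables (k : fieldType) (gT : finGroupType) (G : {group gT}) (n : nat).
Variable rho : mx_representation k G n.

Definition col_stable (P : 'cV[k]_n -> Prop) :=
  subspace P /\ forall c u, c \in G -> P u -> P (rho c *m u).

(* mx_irreducible speaks of row spaces; a stable space of columns is turned into
   the stable space of the rows annihilating it, and conversely. *)
Lemma irr_cols (P : 'cV[k]_n -> Prop) : mx_irreducible rho -> col_stable P ->
  (exists2 u, P u & u != 0) -> forall u, P u.
Proof.
move=> /mx_irrP [n0 irr] [hP hst] [u0 Pu0 nu0] u.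
have [X hX] := subspace_vspace hP.
(* The columns of [M] form a basis of [P], so the rows of [kermx M] span the annihilator of [P]. *)
pose M := \matrix_(i < n, j < \dim X) (vbasis X)`_j i 0.
have hM v : v \in X -> exists w, v = M *m w.
  move=> hv; exists (\col_j coord (vbasis X) j v); rewrite {1}(coord_vbasis hv).
  apply/colP => i; rewrite summxE !mxE; apply: eq_bigr => j _.
  by rewrite !mxE mulrC.
have hM2 w : M *m w \in X.
  have -> : M *m w = \sum_j w j 0 *: (vbasis X)`_j.
    by apply/colP => i; rewrite summxE !mxE; apply: eq_bigr => j _; rewrite !mxE mulrC.
  by apply: memv_suml => j _; rewrite memvZ // vbasis_mem // mem_nth // size_tuple.
have hann m (r : 'M_(m, n)) : r *m M = 0 <-> forall v, P v -> r *m v = 0.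
  split=> [e v /hX/hM [w ->]|h]; first by rewrite mulmxA e mul0mx.
  apply/matrixP => i j; have : col j (r *m M) = 0 by rewrite colE -mulmxA h //; apply/hX/hM2.
  by move/colP/(_ i); rewrite !mxE.
have mod : mxmodule rho (kermx M).
  apply/mxmoduleP => x Gx; apply/sub_kermxP; apply/hann => v Pv.
  rewrite -mulmxA; apply: (hann _ _).1; [exact: mulmx_ker|exact: hst].
have [k0|kn0] := eqVneq (kermx M) 0.
  have /row_freeP [D hD] : row_free M by rewrite -kermx_eq0 k0.
  by rewrite -[u]mul1mx -hD -mulmxA; apply/hX/hM2.
have /row_fullP [D hD] := irr _ mod kn0.
have M0 : M = 0 by rewrite -[M]mul1mx -hD -mulmxA mulmx_ker mulmx0.
have [w e] := hM u0 (proj2 (hX u0) Pu0).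
by case/eqP: nu0; rewrite e M0 mul0mx.
Qed.

Lemma cols_irr : (0 < n)%N ->
  (forall P, col_stable P -> (exists2 u, P u & u != 0) -> forall u, P u) -> mx_irreducible rho.
Proof.
move=> n0 h; apply/mx_irrP; split=> // U modU nzU.
pose P (u : 'cV[k]_n) := U *m u = 0.
have hP : col_stable P.
  split; first split.
  - by rewrite /P mulmx0.
  - by move=> c u v eu ev; rewrite /P linearP /= eu ev scaler0 addr0.
  move=> c u Gc eu.
  have /submxP [D hD] := mxmoduleP modU _ Gc.
  by rewrite /P mulmxA hD -mulmxA eu mulmx0.
rewrite -sub1mx submxE mul1mx; apply/eqP.
apply: contrapT => /eqP hc.
(* If [U] is not everything, its cokernel has a nonzero column, which lies in the annihilator [P] of
   [U]. Then [P] is everything and [U] is 0. *)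
have [j hj] : exists j, col j (cokermx U) != 0.
  apply: contrapT => hn; case/eqP: hc; apply/matrixP => i j; rewrite mxE.
  have : col j (cokermx U) = 0 by apply: contrapT => /eqP e; apply: hn; exists j.
  by move/colP/(_ i); rewrite !mxE.
have hUj : P (col j (cokermx U)) by rewrite /P colE mulmxA mulmx_coker mul0mx.
have hU (u : 'cV[k]_n) : U *m u = 0 by apply: (h P hP (ex_intro2 _ _ _ hUj hj) u).
case/eqP: nzU; apply/matrixP => i l; have := hU (delta_mx l 0).
by rewrite -colE => /colP/(_ i); rewrite !mxE.
Qed.

End Irreducible.

(** * Simple modules over D(G) *)

Section Classify.
Variables (k : fieldType) (gT : finGroupType).
Local Notation DG := (DG k gT).

(** A nonzero submodule contains a nonzero homogeneous vector, of the form x1 (x) u1, hence its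
    translate 1 (x) u1. Irreducibility of [rho] then yields 1 (x) U, whose translates span. *)
Lemma Mg_simple (g0 : gT) n (rho : mx_representation k 'C[g0] n) :
  mx_irreducible rho -> is_simple (Mg_act rho) (wholeT (Mg rho)).
Proof.
move=> irr; have hM := Mg_dgmod rho; have [n0 _] := (mx_irrP rho).1 irr.
split=> //.
  have [u nu] : exists u : 'cV[k]_n, u != 0.
    exists (delta_mx (Ordinal n0) 0); apply/eqP => /matrixP/(_ (Ordinal n0) 0).
    by rewrite !mxE !eqxx => /eqP; rewrite oner_eq0.
  by exists (mg rho 1%g u) => //; apply/eqP => /mg1_inj /eqP; rewrite (negbTE nu).
move=> Q hQ _; have [hs hG hW] := (dg_submodP hM Q).1 hQ.
have [h0|hn0] := pselect (forall x, Q x -> x = 0); [by left|right=> x _].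
have [m Qm nm] : exists2 m, Q m & m != 0.
  apply: contrapT => h; apply: hn0 => y Qy; apply: contrapT => /eqP ny.
  by apply: h; exists y.
have [h nh] : exists h, Wm h m != 0.
  apply: contrapT => e; case/eqP: nm; rewrite -(dg_sumW hM m) big1 // => h _.
  by apply: contrapT => /eqP nh; apply: e; exists h.
(* The x with x g0 x^-1 = h' form at most one coset of the centralizer, so a single representative
   [x0] describes the whole degree. *)
have hspan h' (m' : Mg rho) : exists x u, Wm h' m' = mg rho x u.
  have [[x0 hx0]|hx0] := pselect (exists x0 : gT, (x0 * g0 * x0^-1)%g = h'); last first.
    exists 1%g, 0; rewrite (lin0 (f := mg rho 1%g)); last by apply: lin_mg; apply: lin_id.
    move: m'; apply: mg_eq; [exact: dg_linW hM h'|exact: lin_zero|] => x' u.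
    by rewrite Wm_mg; case: eqP => // e; case: hx0; exists x'.
  exists x0; move: m'; apply: mg_ind.
    have lm : lin (mg rho x0) by apply: lin_mg; apply: lin_id.
    have lW := dg_linW hM h'.
    split=> [|c y z [u eu] [v ev]]; first by exists 0; rewrite (lin0 lm) (lin0 lW).
    by exists (c *: u + v); rewrite lm lW eu ev.
  move=> x' u; rewrite Wm_mg; case: eqP => [e|_]; last first.
    by exists 0; rewrite (lin0 (f := mg rho x0)) //; apply: lin_mg; apply: lin_id.
  exists (rho (x0^-1 * x')%g *m u); rewrite -mgM ?mulKVg //.
  have e2 : (x' * g0 = x0 * g0 * x0^-1 * x')%g by rewrite hx0 -e mulgKV.
  apply/cent1P; rewrite /commute; first [rewrite -mulgA e2 | rewrite -[RHS]mulgA e2].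
  by rewrite !mulgA mulVg mul1g.
have [x1 [u1 e1]] := hspan h m.
have Q1 : Q (mg rho 1%g u1).
  rewrite -(mulVg x1) -Gm_mg; apply: hG; rewrite -e1; exact: hW.
have nu1 : u1 != 0.
  apply/eqP => e; move: nh; rewrite e1 e (lin0 (f := mg rho x1)) ?eqxx //.
  by apply: lin_mg; apply: lin_id.
have hall : forall u, Q (mg rho 1%g u).
  apply: (irr_cols irr); last by exists u1.
  split=> [|c u Cc Qu]; last by rewrite -mgM // mul1g -[c]mulg1 -Gm_mg; apply: hG.
  have lm : lin (mg rho 1%g) by apply: lin_mg; apply: lin_id.
  by split=> [|c u v Qu Qv]; rewrite ?(lin0 lm) ?lm; [case: hs|apply: hs.2].
by move: x; apply: mg_ind => // x u; rewrite -[x]mulg1 -Gm_mg; apply: hG.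
Qed.

(** [N] may be infinite-dimensional; the image of [L] is parametrised by column vectors through a
    complement of the kernel. *)
Lemma lin_image_coord (A : vectType k) (N : lmodType k) (L : A -> N) : lin L ->
  exists n, exists j : 'cV[k]_n -> N, [/\ lin j, forall u, j u = 0 -> u = 0,
    forall u, exists x, j u = L x & forall x, exists u, L x = j u].
Proof.
move=> hL.
have hs : subspace (fun x => L x = 0).
  by split=> [|c x y hx hy]; rewrite ?(lin0 hL) // hL hx hy scaler0 addr0.
have [K hK] := subspace_vspace hs.
pose b := vbasis (K^C)%VS; exists (\dim (K^C)%VS).
pose e (u : 'cV[k]_(\dim (K^C)%VS)) : A := \sum_i u i 0 *: b`_i.
have he : lin e.
  move=> c u v; rewrite /e scaler_sumr -big_split; apply: eq_bigr => i _.
  by rewrite !mxE scalerDl scalerA.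
have heK u : e u \in (K^C)%VS.
  by apply: memv_suml => i _; rewrite memvZ // vbasis_mem // mem_nth // size_tuple.
exists (fun u => L (e u)); split.
- exact: lin_comp.
- move=> u /hK hu; have : e u \in (K :&: K^C)%VS by rewrite memv_cap hu heK.
  rewrite capv_compl memv0 => /eqP e0; apply/colP => i; rewrite mxE.
  by have /freeP/(_ (fun i => u i 0) e0 i) := basis_free (vbasisP (K^C)%VS).
- by move=> u; exists (e u).
move=> x; have hx : x \in (K + K^C)%VS by rewrite addv_complf memvf.
have /memv_addP [y hy [z hz ->]] := hx.
exists (\col_i coord b i z); rewrite (linD _ _ hL) (proj1 (hK y) hy) add0r; congr (L _).
rewrite {1}(coord_vbasis hz) /e; apply: eq_bigr => i _.
by rewrite mxE.
Qed.

(* rho is realised on a minimal subspace of degree g stable under the centralizer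
   of g. *)
Lemma dg_classify (N : lmodType k) (a : DG -> N -> N) G W (P0 : N -> Prop) :
  dgmod a G W -> is_submodule a P0 -> (exists2 x, P0 x & x != 0) ->
  exists (g : gT) (n : nat) (rho : mx_representation k 'C[g] n), mx_irreducible rho /\
   exists f : Mg rho -> N, [/\ lin f, forall z m, f (Mg_act rho z m) = a z (f m),
     forall m, f m = 0 -> m = 0 & forall m, P0 (f m)].
Proof.
move=> hN hP [x Px nx]; have [hs hG hW] := (dg_submodP hN P0).1 hP.
have [lG lW] := (dg_linG hN, dg_linW hN).
have [g ng] : exists g, W g x != 0.
  apply: contrapT => e; case/eqP: nx; rewrite -(dg_sumW hN x) big1 // => h _.
  by apply: contrapT => /eqP nh; apply: e; exists h.
(* [j] embeds a column space in the degree [g] part of [P0], with image stable under the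
   centralizer. The least possible positive [n] will give an irreducible representation. *)
pose Q n (j : 'cV[k]_n -> N) := [/\ lin j, forall u, j u = 0 -> u = 0,
  forall u, P0 (j u) /\ W g (j u) = j u &
  forall c u, c \in 'C[g]%g -> exists v, G c (j u) = j v].
pose q n := `[< (0 < n)%N /\ exists j, @Q n j >].
have WG c y : c \in 'C[g]%g -> W g y = y -> W g (G c y) = G c y.
  move=> /cent1P hc hy; rewrite (dg_WG hN) (_ : c^-1 * g * c = g)%g ?hy //.
  by rewrite -mulgA -hc mulKg.
have q0 : exists n, q n.
  (* An initial candidate: the span of the centralizer orbit of the degree [g] part of [x]. *)
  pose L (b : kG k gT) := \sum_(s in 'C[g]%g) b s *: G s (W g x).
  have lL : lin L by apply: lin_sum => s; apply: lin_scalel; apply: lin_kG; apply: lin_id.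
  have L1 : L (gelt k 1%g) = W g x.
    rewrite /L (bigD1 1%g) ?group1 //= geltE eqxx scale1r (dg_G1 hN) big1 ?addr0 // => s /andP [_ h].
    by rewrite geltE (negbTE h) scale0r.
  have [n [j [j1 j2 j3 j4]]] := lin_image_coord lL.
  exists n; apply/asboolP; split.
    have [u e] := j4 (gelt k 1%g); case: n j j1 j2 j3 j4 u e => // j j1 _ _ _ u e.
    by case/eqP: ng; rewrite -L1 e (flatmx0 u) (lin0 j1).
  exists j; split=> //.
    move=> u; have [b ->] := j3 u; split.
      by apply: subspace_sum => // s hs'; apply: subspaceZ => //; apply/hG/hW.
    rewrite /L (lin_sumr _ _ _ (lW g)); apply: eq_bigr => s hs'.
    by rewrite (linZ _ _ (lW g)) WG // (dg_WW hN) eqxx.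
  move=> c u hc; have [b ->] := j3 u; have [v e] := j4 [ffun s => b (c^-1 * s)%g].
  exists v; rewrite -e /L (lin_sumr _ _ _ (lG c)) [RHS](reindex_inj (mulgI c)).
  apply: eq_big => [s|s hs']; first by rewrite groupMl.
  by rewrite (linZ _ _ (lG c)) -(dg_GM hN) ffunE mulKg.
case: (ex_minnP q0) => n /asboolP [n0 [j [j1 j2 j3 j4]]] hmin.
have jinj u v : j u = j v -> u = v.
  by move=> e; apply/eqP; rewrite -subr_eq0; apply/eqP/j2; rewrite (linB _ _ j1) e subrr.
have [w hw] : exists w : gT -> 'I_n -> 'cV[k]_n, forall c l, c \in 'C[g]%g ->
    G c (j (delta_mx l 0)) = j (w c l).
  have h (cl : gT * 'I_n) : exists v, cl.1 \in 'C[g]%g -> G cl.1 (j (delta_mx cl.2 0)) = j v.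
    by case: (boolP (cl.1 \in 'C[g]%g)) => [/j4 h|_]; [have [v e] := h (delta_mx cl.2 0); exists v|exists 0].
  by have [w hw] := choice h; exists (fun c l => w (c, l)) => c l; apply: (hw (c, l)).
pose r c : 'M[k]_n := \matrix_(i, l) w c l i 0.
have hr c u : c \in 'C[g]%g -> j (r c *m u) = G c (j u).
  move=> hc.
  have e (v : 'cV[k]_n) : v = \sum_l v l 0 *: delta_mx l 0.
    by rewrite {1}(matrix_sum_delta v); apply: eq_bigr => l _; rewrite big_ord1.
  rewrite {2}(e u) (lin_sumr _ _ _ j1) (lin_sumr _ _ _ (lG c)).
  have -> : r c *m u = \sum_l u l 0 *: w c l.
    by apply/colP => i; rewrite summxE !mxE; apply: eq_bigr => l _; rewrite !mxE mulrC.
  rewrite (lin_sumr _ _ _ j1); apply: eq_bigr => l _.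
  by rewrite (linZ _ _ j1) (linZ _ _ j1) (linZ _ _ (lG c)) hw.
have mx_inj (A A' : 'M[k]_n) : (forall u : 'cV[k]_n, A *m u = A' *m u) -> A = A'.
  move=> h; apply/matrixP => i l; have := h (delta_mx l 0).
  by rewrite -!colE => /colP/(_ i); rewrite !mxE.
have rep : mx_repr 'C[g]%g r.
  split=> [|c d hc hd]; apply: mx_inj => u; apply: jinj.
    by rewrite hr ?group1 // (dg_G1 hN) mul1mx.
  by rewrite -mulmxA !hr ?groupM // (dg_GM hN).
pose rho : mx_representation k 'C[g] n := MxRepresentation rep.
have irr : mx_irreducible rho.
  apply: cols_irr => // P [hsP hst] [u0 Pu0 nu0] u.
  have [X hX] := subspace_vspace hsP.
  have lX : lin (fun y : subvs_of X => vsval y) by move=> c y z; rewrite linearP.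
  have [d [i [i1 i2 i3 i4]]] := lin_image_coord lX.
  have iX y : i y \in X by have [z ->] := i3 y; apply: subvsP.
  have iX2 y : y \in X -> exists z, y = i z.
    by move=> hy; have [z e] := i4 (vsproj X y); exists z; rewrite -e vsprojK.
  (* Restricting [j] to [P] gives a competitor of dimension [d], so minimality of [n] forces [P] to
     be everything. *)
  have qd : q d.
    apply/asboolP; split.
      have [z e] := iX2 u0 (proj2 (hX u0) Pu0); case: d i i1 i2 i3 i4 iX iX2 z e => // i i1 _ _ _ _ _ z e.
      by case/eqP: nu0; rewrite e (flatmx0 z) (lin0 i1).
    exists (fun y => j (i y)); split.
    - exact: lin_comp.
    - by move=> y /j2/i2.
    - by move=> y; apply: j3.
    move=> c y hc; have [z e] := iX2 (r c *m i y) (proj2 (hX _) (hst c _ hc (proj1 (hX _) (iX y)))).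
    by exists z; rewrite -hr // e.
  have nd := hmin _ qd.
  have dimM m : \dim (fullv : {vspace 'cV[k]_m}) = m.
    by rewrite dimvf dim_matrix; apply: muln1.
  have hd : (d <= \dim X)%N.
    pose F := linfun (i : 'cV[k]_d -> 'cV[k]_n).
    have hF y : F y = i y by rewrite linfunE.
    have sF : (F @: fullv <= X)%VS by apply/subvP => z /memv_imgP [y _ ->]; rewrite hF.
    apply: leq_trans (dimvS sF); rewrite limg_dim_eq ?dimM //.
    apply/eqP; rewrite -subv0; apply/subvP => y; rewrite memv_cap memv_ker hF memv0.
    by move=> /andP [_ /eqP/i2 ->].
  have : (\dim (fullv : {vspace 'cV[k]_n}) <= \dim X)%N.
    by rewrite dimM; apply: leq_trans nd hd.
  move=> hXn; have /eqP eX : X == fullv by rewrite eqEdim subvf.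
  by apply/hX; rewrite eX memvf.
exists g, n, rho; split=> //.
pose f0 y u := G y (j u).
have f01 y : lin (f0 y) by apply: (lin_comp (lG y)).
have f02 y c u : c \in 'C[g]%g -> f0 (y * c)%g u = f0 y (rho c *m u).
  by move=> hc; rewrite /f0 (dg_GM hN) -[rho c]/(r c) hr.
pose f := mg_lift f0 : Mg rho -> N.
have hf : lin f by apply: lin_mg_lift.
have fE y u : f (mg rho y u) = G y (j u) by rewrite /f mg_lift_mg.
have hM := Mg_dgmod rho.
have fz z m : f (Mg_act rho z m) = a z (f m).
  apply: (dg_morph (P := wholeT _) hM hN hf) => // [s {}m _|h {}m _].
    move: m; apply: mg_eq; [exact: lin_comp hf (dg_linG hM s)|exact: lin_comp (lG s) hf|].
    by move=> y u; rewrite Gm_mg !fE (dg_GM hN).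
  move: m; apply: mg_eq; [exact: lin_comp hf (dg_linW hM h)|exact: lin_comp (lW h) hf|].
  move=> y u; rewrite Wm_mg fE (dg_WG hN) -(j3 u).2 (dg_WW hN).
  have -> : (y * g * y^-1 == h)%g = (y^-1 * h * y == g)%g.
    by rewrite -[RHS](inj_eq (mulgI y)) -[RHS](inj_eq (mulIg y^-1%g)) !mulgA mulgV mul1g mulgK eq_sym.
  case: eqP => [->|_]; first by rewrite fE (j3 u).2.
  by rewrite (lin0 hf) (lin0 (lG y)).
(* The kernel of [f] is a submodule of the simple [Mg rho], and [f] restricts to the injective [j]
   on 1 (x) U. *)
exists f; split=> // [|m].
  have [_ _ irrM] := Mg_simple irr.
  have := irrM (fun m => f m = 0) _ _; case=> //.
    split=> [|c m m' e e'|z m e]; first exact: lin0 hf.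
      by rewrite hf e e' scaler0 addr0.
    by rewrite fz e (lin0 (dg_linx hN z)).
  move=> h; have := h (mg rho 1%g (delta_mx (Ordinal n0) 0)) I; rewrite fE (dg_G1 hN) => /j2.
  by move/matrixP/(_ (Ordinal n0) 0); rewrite !mxE !eqxx => /eqP; rewrite oner_eq0.
move: m; apply: mg_ind; last by move=> y u; rewrite fE; apply: hG; apply: (j3 u).1.
by split=> [|c m m' e e']; rewrite ?(lin0 hf) ?hf; [case: hs|apply: hs.2].
Qed.

End Classify.

(** * Twists of D(G)-modules by a character and a central element *)

Section Twist.
Variables (k : fieldType) (gT : finGroupType).
Local Notation DG := (DG k gT).

(** The action rebuilt from [G] and [W] by the formula of [dg_actE], so that a twist only has to be
    described on these two families. *)
Definition dg_of (N : lmodType k) (G W : gT -> N -> N) (z : DG) (x : N) : N :=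
  \sum_g \sum_h (\sw_(c, f <- z) (c g * f (gelt k h) : k^o)) *: G g (W h x).

Lemma dg_of_act (N : lmodType k) (G W : gT -> N -> N) g h x :
  dg_of G W (gelt k g \ot gdual k h) x = G g (W h x).
Proof.
have hb s r : bilin (fun (c : kG k gT) (f : dual (kG k gT)) => (c s * f (gelt k r) : k^o)) by blint.
rewrite /dg_of (bigD1 g) //= [X in _ + X]big1 => [|s hs]; last first.
  by apply: big1 => r _; rewrite (tlift_pure _ _ (hb _ _)) geltE (negbTE hs) mul0r scale0r.
rewrite addr0 (bigD1 h) //= big1 => [|r hr]; last first.
  by rewrite (tlift_pure _ _ (hb _ _)) gdualE !geltE [h == r]eq_sym (negbTE hr) mulr0 scale0r.
by rewrite addr0 (tlift_pure _ _ (hb _ _)) gdualE !geltE !eqxx mulr1 scale1r.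
Qed.

Lemma dg_of_linz (N : lmodType k) (G W : gT -> N -> N) x : lin (fun z => dg_of G W z x).
Proof. by do 2![apply: lin_sum => ?]; apply: lin_scalel; apply: lin_tlift; apply: lin_id. Qed.

(* B^top (x) N is N twisted by the character of G on B^top and by the degree of
   B^top, a central element of G. *)
Definition twG (chi : gT -> k) (N : lmodType k) (G : gT -> N -> N) g x : N := chi g *: G g x.
Definition twW (t : gT) (N : lmodType k) (W : gT -> N -> N) h x : N := W (t^-1 * h)%g x.
Definition twA chi t (N : lmodType k) (G W : gT -> N -> N) := dg_of (twG chi G) (twW t W).

Section Chi.
Variables (chi : gT -> k) (t : gT).
Hypothesis chiM : forall g h, chi (g * h)%g = chi g * chi h.
Hypothesis chi1 : chi 1%g = 1.
Hypothesis tC : forall g, commute t g.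

Lemma twist_dgmod (N : lmodType k) (a : DG -> N -> N) G W :
  dgmod a G W -> dgmod (twA chi t G W) (twG chi G) (twW t W).
Proof.
move=> hN; have [lG lW] := (dg_linG hN, dg_linW hN).
split.
- exact: dg_of_linz.
- by move=> g; apply: lin_scale.
- by move=> h; apply: lW.
- exact: dg_of_act.
- by move=> x; rewrite /twG chi1 scale1r (dg_G1 hN).
- by move=> g h x; rewrite /twG chiM (dg_GM hN) (linZ _ _ (lG g)) scalerA.
- by move=> h h' x; rewrite /twW (dg_WW hN) (inj_eq (mulgI _)).
- by move=> x; rewrite -[RHS](dg_sumW hN) [RHS](reindex_inj (mulgI t^-1%g)).
(* Here [t] must be central: shifting degrees by [t] has to commute with conjugation by [g]. *)
move=> h g x; rewrite /twG /twW (linZ _ _ (lW _)) (dg_WG hN); congr (_ *: G g (W _ _)).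
by rewrite !mulgA; congr (_ * _ * _)%g; rewrite -!invMg tC.
Qed.

Lemma chi_neq0 g : chi g != 0.
Proof.
apply/eqP => e; have : chi (g * g^-1)%g = 0 by rewrite chiM e mul0r.
by rewrite mulgV chi1 => /eqP; rewrite oner_eq0.
Qed.

(** The operators of the twist are those of [N] up to nonzero scalars and a reindexing of the
    degrees, hence the same stable subspaces. *)
Lemma twist_submod (N : lmodType k) (a : DG -> N -> N) G W P :
  dgmod a G W -> is_submodule (twA chi t G W) P <-> is_submodule a P.
Proof.
move=> hN; have hT := twist_dgmod hN.
split=> [/(dg_submodP hT)|/(dg_submodP hN)] [hP hG hW].
  apply/(dg_submodP hN); split=> // [g x Px|h x Px].
    rewrite -[G g x]scale1r -(mulVf (chi_neq0 g)) -scalerA; apply: subspaceZ => //.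
    exact: hG.
  by have := hW (t * h)%g x Px; rewrite /twW mulKg.
apply/(dg_submodP hT); split=> // [g x Px|h x Px]; last exact: hW.
by apply: subspaceZ => //; apply: hG.
Qed.

Lemma twist_simple (N : lmodType k) (a : DG -> N -> N) G W P :
  dgmod a G W -> is_simple a P -> is_simple (twA chi t G W) P.
Proof.
move=> hN [hP hx hs]; split=> //; first exact/(twist_submod P hN).
by move=> Q /(twist_submod Q hN) hQ; apply: hs.
Qed.

Lemma mod_iso_lin (A : vectType k) (N N' : lmodType k) (a : A -> N -> N) (a' : A -> N' -> N')
   (f : N -> N') P' :
  lin f -> (forall d x, f (a d x) = a' d (f x)) -> (forall x, f x = 0 -> x = 0) ->
  (forall x, P' (f x)) -> (forall y, P' y -> exists x, f x = y) ->
  mod_iso a (wholeT N) a' P'.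
Proof.
move=> lf hf f0 hP hs; exists f; split=> //.
- by move=> x y _ _ e; apply/eqP; rewrite -subr_eq0; apply/eqP/f0; rewrite (linB _ _ lf) e subrr.
- by move=> y /hs [x <-]; exists x.
Qed.

Lemma twist_iso (N N' : lmodType k) (a : DG -> N -> N) G W (a' : DG -> N' -> N') G' W' :
  dgmod a G W -> dgmod a' G' W' -> mod_iso a (wholeT N) a' (wholeT N') ->
  mod_iso (twA chi t G W) (wholeT N) (twA chi t G' W') (wholeT N').
Proof.
move=> hN hN' [f [f1 f2 f3 f4 f5]]; exists f; split=> // z x _.
have lf : lin f by move=> c u v; apply: f1.
rewrite /twA /dg_of (lin_sumr _ _ _ lf); apply: eq_bigr => g _.
rewrite (lin_sumr _ _ _ lf); apply: eq_bigr => h _; rewrite (linZ _ _ lf); congr (_ *: _).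
rewrite /twG /twW (linZ _ _ lf) (dg_G_act hN) f2 // -(dg_G_act hN'); congr (_ *: G' g _).
by rewrite (dg_W_act hN) f2 // -(dg_W_act hN').
Qed.

End Chi.

(** The inverse twist; both actions are given by the formula of [dg_actE], so they are equal and not
    merely isomorphic. *)
Lemma twistK chi t (N : lmodType k) (a : DG -> N -> N) G W :
  dgmod a G W -> (forall g, chi g != 0) ->
  twA chi t (twG (fun g => (chi g)^-1) G) (twW t^-1%g W) = a.
Proof.
move=> hN hc; apply/funext => z; apply/funext => x; rewrite (dg_actE hN) /twA /dg_of.
apply: eq_bigr => g _; apply: eq_bigr => h _; congr (_ *: _).
by rewrite /twG /twW scalerA divff // scale1r invgK mulKVg.
Qed.

Lemma twistVK chi t (N : lmodType k) (a : DG -> N -> N) G W :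
  dgmod a G W -> (forall g, chi g != 0) ->
  twA (fun g => (chi g)^-1) t^-1%g (twG chi G) (twW t W) = a.
Proof.
move=> hN hc; apply/funext => z; apply/funext => x; rewrite (dg_actE hN) /twA /dg_of.
apply: eq_bigr => g _; apply: eq_bigr => h _; congr (_ *: _).
by rewrite /twG /twW scalerA mulVf // scale1r invgK mulKg.
Qed.

End Twist.

Lemma dg_classify_simple (k : fieldType) (gT : finGroupType) (N : lmodType k)
    (a : DG k gT -> N -> N) G W : dgmod a G W -> is_simple a (wholeT N) ->
  exists (g : gT) (n : nat) (rho : mx_representation k 'C[g] n),
    mx_irreducible rho /\ mod_iso (Mg_act rho) (wholeT (Mg rho)) a (wholeT N).
Proof.
move=> hN [_ hx hs]; have [g [n [rho [irr [f [lf fz f0 _]]]]]] := dg_classify hN (wholeT_submod a) hx.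
exists g, n, rho; split=> //; apply: (mod_iso_lin lf fz f0) => // y _.
case: (hs (fun y => exists x, f x = y)) => // [|h|h]; last exact: h.
  split=> [|c _ _ [u <-] [v <-]|z _ [u <-]]; first by exists 0; apply: lin0 lf.
    by exists (c *: u + v); rewrite lf.
  by exists (Mg_act rho z u); rewrite fz.
have [_ [x _ nx] _] := Mg_simple irr; case/eqP: nx; apply: f0; apply: h.
by exists x.
Qed.

(** * The bosonization of a Nichols algebra *)

Section NicholsDouble.
Variables (k : fieldType) (gT : finGroupType) (V : vectType k) (YV : yd_module gT V).
Variables (B : falgType k) (NB : nichols YV B).
Local Notation act := (yact (nyd NB)).
Local Notation co := (ycoact (nyd NB)).
Local Notation DB := (ncomul NB).
Local Notation eB := (ncounit NB).
Local Notation SB := (nanti NB).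
Local Notation deg := (ndeg NB).
Local Notation top := (ntop NB).
Local Notation boson := (boson gT B).
Local Notation DD := (DD gT B).
Local Notation HB := (boson_hopf NB).
Local Notation T := (straighten HB).
Local Notation piG := (boson_kG NB).
Local Notation "x # g" := (@smash k gT B x g) (at level 38, format "x # g").
Local Notation "u ** v" := (double_mul HB u v) (at level 40, left associativity).
Implicit Types (X Y U : lmodType k).

Lemma lin_smash U (f : U -> B) g : lin f -> lin (fun x => f x # g).
Proof. by move=> hf c x y; apply/ffunP => h; rewrite !ffunE hf; case: eqP; rewrite ?scaler0 ?addr0. Qed.
Lemma lin_boson U (f : U -> boson) g : lin f -> lin (fun x => f x g).
Proof. exact: lin_ffun. Qed.

Lemma smashE x g h : (x # g) h = if h == g then x else 0.
Proof. by rewrite ffunE. Qed.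

Lemma boson_sum (a : boson) : a = \sum_g a g # g.
Proof.
apply/ffunP => h; rewrite sum_ffunE (bigD1 h) //= big1 => [|g hg].
  by rewrite smashE eqxx addr0.
by rewrite smashE eq_sym (negbTE hg).
Qed.

Lemma sum_smash X (F : gT -> B -> X) x g0 : (forall g, F g 0 = 0) ->
  \sum_g F g ((x # g0) g) = F g0 x.
Proof.
move=> h; rewrite (bigD1 g0) //= big1 => [|g hg]; first by rewrite smashE eqxx addr0.
by rewrite smashE (negbTE hg) h.
Qed.

Lemma boson_eq X (F G : boson -> X) :
  lin F -> lin G -> (forall x g, F (x # g) = G (x # g)) -> forall a, F a = G a.
Proof.
move=> hF hG h a; rewrite (boson_sum a) (lin_sumr _ _ _ hF) (lin_sumr _ _ _ hG).
by apply: eq_bigr.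
Qed.

Ltac lint_hyp ::= first [ apply: lin_mull | apply: lin_mulr | apply: lin_smash
  | apply: lin_boson | apply: lin_ffun ].

Lemma smashM x g y h : hmul HB (x # g) (y # h) = (x * act g y) # (g * h)%g.
Proof.
rewrite /= (sum_smash (F := fun g1 z => \sum_h1 (z * act g1 ((y # h) h1)) # (g1 * h1)%g)).
  rewrite (sum_smash (F := fun h1 z => (x * act g z) # (g * h1)%g)) // => h1.
  by rewrite linear0 mulr0; apply: (lin0 (f := fun x => x # _)); lint.
by move=> g1; apply: big1 => h1 _; rewrite mul0r; apply: (lin0 (f := fun x => x # _)); lint.
Qed.

Lemma smash_comul x g : hcomul HB (x # g) =
  \sw_(x1, x2 <- DB x) \sum_s ((x1 # (s * g)%g) \ot (co s x2 # g)).
Proof.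
rewrite /= (sum_smash (F := fun g z => \sw_(x1, x2 <- DB z)
  \sum_s ((x1 # (s * g)%g) \ot (co s x2 # g)))) // => h.
by apply: (lin0 (f := fun z => \sw_(x1, x2 <- DB z)
  \sum_s ((x1 # (s * h)%g) \ot (co s x2 # h)))); lint.
Qed.

Lemma smash_counit x g : hcounit HB (x # g) = eB x.
Proof. by rewrite /= (sum_smash (X := k^o) (F := fun g z => eB z)) // => h; rewrite linear0. Qed.

Lemma smash_anti x g : hanti HB (x # g) =
  \sum_s act (s * g)^-1%g (SB (co s x)) # (s * g)^-1%g.
Proof.
rewrite /= (sum_smash (F := fun g z => \sum_s act (s * g)^-1%g (SB (co s z)) # (s * g)^-1%g)) // => h.
by apply: (lin0 (f := fun z => \sum_s act (s * h)^-1%g (SB (co s z)) # (s * h)^-1%g)); lint.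
Qed.

Lemma ncoassoc_sw X (E : B -> B -> B -> X) x :
  \sw_(a, b <- DB x) \sw_(c, d <- DB b) E a c d =
  \sw_(a, b <- DB x) \sw_(c, d <- DB a) E c d b.
Proof.
move: X E; apply: coassoc_ext => E h1 h2 h3.
pose G (t : tens B (tens B B)) := tlift t (fun a u => tlift u (fun b c => E a b c)).
have hG : lin G by apply: lin_tlift; apply: lin_id.
have := congr1 G (ncoassoc NB x).
rewrite (tlift_out _ _ hG) (tlift_out _ _ hG).
under tlift_ext => a b.
  rewrite (tlift_out _ _ hG).
  under tlift_ext => c d.
    rewrite /G tlift_pure; last by blint.
    rewrite tlift_pure; last by blint.
    over.
  over.
move=> ->; apply: tlift_ext => a b; rewrite (tlift_out _ _ hG); apply: tlift_ext => c d.
by rewrite /G !tlift_pure //; split=> ?; lint.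
Qed.

Lemma ncoact_comul_sw X (E : B -> B -> X) g x : bilin E ->
  \sw_(a, b <- DB (co g x)) E a b =
  \sw_(a, b <- DB x) \sum_s E (co s a) (co (s^-1 * g)%g b).
Proof.
move=> hE; rewrite ncoact_comul tlift_map; apply: tlift_ext => a b; rewrite tlift_suml.
by apply: eq_bigr => s _; rewrite tlift_pure.
Qed.

Lemma nact_comul_sw X (E : B -> B -> X) g x : bilin E ->
  \sw_(a, b <- DB (act g x)) E a b = \sw_(a, b <- DB x) E (act g a) (act g b).
Proof.
by move=> hE; rewrite nact_comul tlift_map; apply: tlift_ext => a b; rewrite tlift_pure.
Qed.

Lemma ncomul_mul_sw X (E : B -> B -> X) x y : bilin E ->
  \sw_(a, b <- DB (x * y)) E a b =
  \sw_(a, b <- DB x) \sw_(c, d <- DB y) \sum_s E (a * act s c) (co s b * d).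
Proof.
move=> hE; rewrite ncomul_mul tlift_map; apply: tlift_ext => a b.
rewrite tlift_map; apply: tlift_ext => c d; rewrite tlift_suml.
by apply: eq_bigr => s _; rewrite tlift_pure.
Qed.

Lemma ncounitl_sw X (g : B -> X) x : lin g -> \sw_(a, b <- DB x) (eB a *: g b) = g x.
Proof.
move=> hg; rewrite -{2}(ncounitl NB x) (tlift_out _ _ hg).
by apply: tlift_ext => a b; rewrite (linZ _ _ hg).
Qed.

Lemma ncounitr_sw X (g : B -> X) x : lin g -> \sw_(a, b <- DB x) (eB b *: g a) = g x.
Proof.
move=> hg; rewrite -{2}(ncounitr NB x) (tlift_out _ _ hg).
by apply: tlift_ext => a b; rewrite (linZ _ _ hg).
Qed.

Lemma co_sum X (F : gT -> B -> X) g x : (forall s, F s 0 = 0) ->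
  \sum_s F s (co s (co g x)) = F g (co g x).
Proof.
move=> h; rewrite -[RHS](sum_eq1 g (fun s => F s (co g x))); apply: eq_bigr => s _.
by rewrite ycoassoc eq_sym; case: eqP.
Qed.

Lemma boson_coassoc X (a : boson) (E : boson -> boson -> boson -> X) :
    \sw_(a, b <- hcomul HB a) \sw_(c, d <- hcomul HB b) E a c d =
    \sw_(a, b <- hcomul HB a) \sw_(c, d <- hcomul HB a) E c d b.
Proof.
move: X E; apply: coassoc_ext => E h1 h2 h3; move: a.
have hl : lin (hcomul HB) by rewrite /=; lint.
apply: boson_eq; [by apply: lin_tlift|by apply: lin_tlift|] => x g.
rewrite smash_comul !tlift_map.
(* Common form, where coassociativity of [B] applies: [p] and [r] are the degrees of the second and
   third legs. *)
transitivity (\sw_(a, b <- DB x) \sw_(c, d <- DB b) (\sum_p \sum_r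
   E (a # (p * (r * g))%g) (co p c # (r * g)%g) (co r d # g))); last first.
  rewrite ncoassoc_sw; apply: (tlift_ext (X := k^o)) => a b; rewrite tlift_suml tlift_sum.
  under eq_bigr => p _ do rewrite tlift_sum.
  rewrite exchange_big /=; apply: eq_bigr => r _.
  rewrite (tlift_pure (f := fun a b => \sw_(c, d <- hcomul HB a) E c d b)); last first.
    by split=> ?; lint; exact: hl.
  rewrite smash_comul tlift_map -tlift_sum; apply: (tlift_ext (X := k^o)) => c d.
  by rewrite tlift_suml; apply: eq_bigr => p _; rewrite tlift_pure ?mulgA //; split=> ?; lint.
apply: (tlift_ext (X := k^o)) => a b; rewrite tlift_suml.
transitivity (\sum_s \sw_(c, d <- DB (co s b)) \sum_r E (a # (s * g)%g) (c # (r * g)%g) (co r d # g)).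
  apply: eq_bigr => s _.
  rewrite (tlift_pure (f := fun a b => \sw_(c, d <- hcomul HB b) E a c d)); last first.
    by split=> ?; lint; exact: hl.
  rewrite smash_comul tlift_map; apply: (tlift_ext (X := k^o)) => c d; rewrite tlift_suml.
  by apply: eq_bigr => r _; rewrite tlift_pure //; split=> ?; lint.
under eq_bigr => s _ do
  (rewrite ncoact_comul_sw; last by blint).
rewrite -tlift_sum; apply: (tlift_ext (X := k^o)) => c d.
rewrite exchange_big /=; apply: eq_bigr => p _.
rewrite (reindex_inj (mulgI p)) /=; apply: eq_bigr => r _; rewrite mulKg mulgA.
rewrite (co_sum (F := fun s z => E (a # (p * r * g)%g) (co p c # (s * g)%g) (z # g))) // => s.
by apply: (lin0 (f := fun z => E _ _ (z # g))); lint.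
Qed.

Lemma boson_comulM (a b : boson) : hcomul HB (hmul HB a b) =
    \sw_(a1, a2 <- hcomul HB a) \sw_(b1, b2 <- hcomul HB b) (hmul HB a1 b1 \ot hmul HB a2 b2).
Proof.
have hm c : lin (fun z => hmul HB z c) by rewrite /=; lint.
have hm2 c : lin (fun z => hmul HB c z) by rewrite /=; lint.
have hc : lin (hcomul HB) by rewrite /=; lint.
move: a; apply: boson_eq; [by apply: (lin_comp hc)|by apply: lin_tlift|] => x g.
move: b; apply: boson_eq; [by apply: (lin_comp hc); lint| |] => [|y h].
  by apply: lin_tliftE => ? ?; apply: lin_tlift.
rewrite smashM !smash_comul.
rewrite ncomul_mul_sw; last by blint.
rewrite tlift_map; apply: tlift_ext => b1 b2; rewrite tlift_suml.
rewrite nact_comul_sw; last by blint.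
rewrite tlift_sum; apply: eq_bigr => s _.
rewrite tlift_pure; last by blint.
rewrite tlift_map; apply: tlift_ext => c1 c2; rewrite tlift_suml.
(* The degree of the second leg of a product is [s] times that of [act g c2], which is the conjugate
   by [g] of the degree [p] of [c2]. *)
rewrite (reindex_inj (mulgI s)) (reindex_inj (conjg_inj g^-1%g)).
apply: eq_bigr => p _; rewrite tlift_pure; last by blint.
rewrite !smashM !yactM; congr (_ \ot _); last first.
  rewrite ncoact_mul (co_sum (F := fun q z => z * co (q^-1 * (s * p ^ g^-1))%g (act g c2))).
    by rewrite mulKg conjgE invgK mulgA ycompat.
  by move=> q; rewrite mul0r.
by congr (_ # _); rewrite conjgE invgK !mulgA mulgKV.
Qed.

Lemma boson_axioms : hopf_axioms HB.
Proof.
have hm c : lin (fun z => hmul HB z c) by rewrite /=; lint.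
have hm2 c : lin (fun z => hmul HB c z) by rewrite /=; lint.
have hc : lin (hcomul HB) by rewrite /=; lint.
have he : lin (hcounit HB : boson -> k^o) by rewrite /=; lint.
have hS : lin (hanti HB) by rewrite /=; lint.
have act1 g : act g 1 = 1 by apply: nact_one.
split=> //.
- move=> a b c; move: a; apply: boson_eq => [||x g]; [by lint|by lint|].
  move: b; apply: boson_eq => [||y h]; [by lint|by lint|].
  move: c; apply: boson_eq => [||z p]; [by lint|by lint|].
  by rewrite !smashM nact_mul yactM mulrA mulgA.
- apply: boson_eq => [||x g]; [by lint|by lint|].
  by rewrite [hone _]/= smashM act1 mulr1 mulg1.
- apply: boson_eq => [||x g]; [by lint|by lint|].
  by rewrite [hone _]/= smashM yact1 mul1r mul1g.
- by move=> X x E; apply: boson_coassoc.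
- apply: boson_eq => [||x g]; [by lint|by lint|].
  rewrite smash_comul tlift_map.
  transitivity (\sw_(a, b <- DB x) (eB a *: (b # g))).
    apply: tlift_ext => a b; rewrite tlift_suml -[b in RHS](ycounit (nyd NB)).
    rewrite (lin_sumr (f := fun z => eB a *: (z # g))); last by lint.
    apply: eq_bigr => s _; rewrite tlift_pure ?smash_counit //.
    by blint.
  by rewrite ncounitl_sw //; lint.
- apply: boson_eq => [||x g]; [by lint|by lint|].
  rewrite smash_comul tlift_map.
  transitivity (\sw_(a, b <- DB x) (eB b *: (a # g))).
    apply: tlift_ext => a b; rewrite tlift_suml.
    rewrite (bigD1 1%g) //= big1 => [|s hs]; last first.
      rewrite (tlift_pure (f := fun a b => hcounit HB b *: a)); last by blint.
      by rewrite smash_counit ncoact_counit (negbTE hs) scale0r.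
    rewrite (tlift_pure (f := fun a b => hcounit HB b *: a)); last by blint.
    by rewrite smash_counit ncoact_counit eqxx mul1g addr0.
  by rewrite ncounitr_sw //; lint.
- exact: boson_comulM.
- rewrite [hone _]/= smash_comul ncomul_one tlift_pure; last by blint.
  rewrite (bigD1 1%g) //= big1 => [|s hs]; last first.
    rewrite ncoact_one (negbTE hs); apply: (lin0 (f := fun z => _ \ot (z # _))).
    by lint.
  by rewrite ncoact_one eqxx mulg1 addr0.
- move=> a b; move: a; apply: (boson_eq (X := k^o)) => [||x g]; [by lint|by lint|].
  move: b; apply: (boson_eq (X := k^o)) => [||y h]; [by lint|by lint|].
  by rewrite smashM !smash_counit ncounit_mul nact_counit.
- by rewrite [hone _]/= smash_counit ncounit_one.
- apply: boson_eq => [||x g]; [by lint|by lint|].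
  rewrite smash_comul tlift_map smash_counit.
  (* The antipode identity of [B] is brought under the coaction: [t] is the total degree of both
     legs, and the group elements produced by the antipode depend only on it. *)
  transitivity (\sum_t (act (t * g)^-1%g (co t (\sw_(a, b <- DB x) (SB a * b))) # ((t * g)^-1 * g)%g)).
    under [RHS]eq_bigr => t _.
      rewrite (tlift_out _ _ (g := fun z => act (t * g)^-1%g (co t z) # ((t * g)^-1 * g)%g)); last by lint.
      over.
    rewrite -tlift_sum; apply: tlift_ext => a b; rewrite tlift_suml.
    under eq_bigr => s _.
      rewrite tlift_pure; last by blint.
      rewrite smash_anti (lin_sumr (f := fun z => hmul HB z _)); last by lint.
      over.
    rewrite exchange_big.
    under [RHS]eq_bigr => t _.
      rewrite ncoact_mul linear_sum (lin_sumr (f := fun z => z # _)); last by lint.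
      over.
    rewrite [RHS]exchange_big; apply: eq_bigr => r _.
    rewrite [RHS](reindex_inj (mulgI r)); apply: eq_bigr => s _.
    by rewrite smashM mulKg ncoact_anti /= nact_mul !mulgA.
  rewrite nantil; under eq_bigr => t _ do rewrite linearZ /= ncoact_one.
  rewrite (bigD1 1%g) //= eqxx linearZ /= act1 mul1g mulVg big1 => [|t /negbTE ->].
    by rewrite addr0; apply: (linZ (f := fun z => z # 1%g)); lint.
  by rewrite scaler0 linear0; apply: (lin0 (f := fun z => z # _)); lint.
- apply: boson_eq => [||x g]; [by lint|by lint|].
  rewrite smash_comul tlift_map smash_counit.
  transitivity (\sw_(a, b <- DB x) ((a * SB b) # 1%g)); last first.
    rewrite -(tlift_out _ _ (g := fun z => z # 1%g)) ?nantir; last by lint.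
    by apply: (linZ (f := fun z => z # 1%g)); lint.
  apply: tlift_ext => a b; rewrite tlift_suml -[b in RHS](ycounit (nyd NB)).
  rewrite (lin_sumr (f := fun z => (a * SB z) # 1%g)); last by lint.
  apply: eq_bigr => s _; rewrite tlift_pure; last by blint.
  rewrite smash_anti (co_sum (F := fun r z => act (r * g)^-1%g (SB z) # (r * g)^-1%g)).
    by rewrite smashM -yactM mulgV yact1.
  by move=> r; rewrite !linear0; apply: (lin0 (f := fun z => z # _)); lint.
Qed.

(** * Generators and commutation rules of the double of B # kG *)

Arguments boson_hopf : simpl never.

Let HA := boson_axioms.

Ltac lint_hyp ::= first [ apply: lin_mull | apply: lin_mulr | apply: lin_smash
  | apply: lin_boson | apply: lin_kG | apply: lin_ffun | apply: lin_ev | apply: lin_evx ].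

Lemma boson_mull_lin c : lin (fun z => hmul HB z c).
Proof. exact: ha_mull HA c. Qed.
Lemma boson_mulr_lin c : lin (fun z => hmul HB c z).
Proof. exact: ha_mulr HA c. Qed.

(* In the double of B # kG, the elements g, f, delta_h and x are written gD g,
   fD f, wD h and bD x. *)
Definition deltaB (h : gT) : dual boson := linfun (fun a : boson => eB (a h) : k^o).
Definition gD (g : gT) : tens boson (dual boson) := 1 # g \ot dunit HB.
Definition fD (f : dual boson) : tens boson (dual boson) := hone HB \ot f.
Definition wD (h : gT) := fD (deltaB h).
Definition bD (x : B) : tens boson (dual boson) := x # 1%g \ot dunit HB.

Lemma lin_bD U (F : U -> B) : lin F -> lin (fun x => bD (F x)).
Proof. by move=> hF; rewrite /bD; lint. Qed.
Lemma lin_fD U (F : U -> dual boson) : lin F -> lin (fun x => fD (F x)).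
Proof. by move=> hF; rewrite /fD; lint. Qed.
Lemma lin_dml U (F : U -> tens boson (dual boson)) v : lin F -> lin (fun x => F x ** v).
Proof. by move=> hF; apply: (lin_comp (@lin_double_mull k boson HB v)). Qed.
Lemma lin_dmr U (F : U -> tens boson (dual boson)) v : lin F -> lin (fun x => v ** F x).
Proof. by move=> hF; apply: (lin_comp (@lin_double_mulr k boson HB v)). Qed.

Lemma deltaBE h a : deltaB h a = eB (a h).
Proof. by rewrite linfunE //; lint. Qed.

Lemma boson_kG_smash x g : piG (x # g) = eB x *: gelt k g.
Proof.
apply/ffunP => h; rewrite ffunE smashE !ffunE.
by case: eqP; rewrite ?linear0 ?scaler0 // /GRing.scale /= mulr1.
Qed.

Lemma lin_piG U (F : U -> boson) : lin F -> lin (fun x => piG (F x)).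
Proof.
by move=> hF c x y; apply/ffunP => h; rewrite !ffunE hF !ffunE linearP.
Qed.

Lemma lin_kG_boson U (F : U -> kG k gT) : lin F -> lin (fun x => kG_boson B (F x)).
Proof. by move=> hF c x y; apply/ffunP => h; rewrite !ffunE hF !ffunE scalerDl scalerA. Qed.

Ltac lint_hyp ::= first [ apply: lin_mull | apply: lin_mulr | apply: lin_smash
  | apply: lin_boson | apply: lin_kG | apply: lin_ffun | apply: lin_ev | apply: lin_evx
  | apply: lin_piG | apply: lin_bD | apply: lin_fD | apply: lin_dml | apply: lin_dmr
  | apply: lin_kG_boson
  | apply: (lin_comp (boson_mull_lin _)) | apply: (lin_comp (boson_mulr_lin _))
  | apply: (lin_comp (ha_anti HA)) | apply: (lin_comp (ha_comul HA))
  | apply: (lin_comp (proj1 (group_mul_lin _ _) _)) | apply: (lin_comp (proj2 (group_mul_lin _ _) _))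
  | apply: (lin_comp (ha_anti (group_axioms _ _))) ].

Lemma piGM a b : piG (hmul HB a b) = hmul (group_hopf k gT) (piG a) (piG b).
Proof.
have [h1 h2] := group_mul_lin k gT.
move: a; apply: boson_eq => [||x g]; [by lint|by lint|].
move: b; apply: boson_eq => [||y h]; [by lint|by lint|].
rewrite smashM !boson_kG_smash ncounit_mul nact_counit.
rewrite (linZ _ _ (h1 _)) (linZ _ _ (h2 _)) geltM scalerA.
by [].
Qed.

Lemma ncounit_anti x : eB (nanti NB x) = eB x.
Proof.
have hl : lin (fun z => eB z : k^o) by lint.
have := congr1 eB (nantil NB x); rewrite (tlift_out _ _ hl) linearZ /= ncounit_one.
rewrite [RHS]/GRing.scale /= mulr1 => <-.
rewrite -(ncounitr_sw (g := fun z => eB (nanti NB z) : k^o)); last by lint.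
by apply: (tlift_ext (X := k^o)) => a b; rewrite ncounit_mul mulrC.
Qed.

Lemma piG_anti a : piG (hanti HB a) = hanti (group_hopf k gT) (piG a).
Proof.
have hS := ha_anti (group_axioms k gT).
move: a; apply: boson_eq => [||x g]; [by lint|by lint|].
rewrite smash_anti boson_kG_smash (linZ _ _ hS) gelt_anti.
rewrite (lin_sumr (f := boson_kG NB)); last by apply: lin_piG.
rewrite (bigD1 1%g) //= big1 => [|s hs]; rewrite boson_kG_smash nact_counit.
  by rewrite mul1g addr0 ncoact_anti ncoact_counit eqxx ncounit_anti.
by rewrite ncoact_anti ncoact_counit (negbTE hs) scale0r.
Qed.

(** Projecting the left leg of the coproduct to kG recovers the coaction of [B]; by [comul_piGr],
    projecting the right leg only leaves [g]. *)
Lemma comul_piGl X (G : kG k gT -> boson -> X) x g : bilin G ->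
  \sw_(a, b <- hcomul HB (x # g)) G (piG a) b =
  \sum_s G (gelt k (s * g)%g) (co s x # g).
Proof.
move=> hG; rewrite smash_comul tlift_map.
transitivity (\sw_(a, b <- DB x) (eB a *: \sum_s G (gelt k (s * g)%g) (co s b # g))).
  apply: tlift_ext => a b; rewrite tlift_suml scaler_sumr; apply: eq_bigr => s _.
  rewrite (tlift_pure (f := fun a b => G (piG a) b)); last by blint.
  by rewrite boson_kG_smash (linZ _ _ (hG.1 _)).
by rewrite ncounitl_sw //; lint.
Qed.

Lemma comul_piGr X (G : boson -> kG k gT -> X) x g : bilin G ->
  \sw_(a, b <- hcomul HB (x # g)) G a (piG b) = G (x # g) (gelt k g).
Proof.
move=> hG; rewrite smash_comul tlift_map.
transitivity (\sw_(a, b <- DB x) (eB b *: G (a # g) (gelt k g))).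
  apply: tlift_ext => a b; rewrite tlift_suml (bigD1 1%g) //= big1 => [|s hs].
    rewrite (tlift_pure (f := fun a b => G a (piG b))); last by blint.
    by rewrite boson_kG_smash ncoact_counit eqxx mul1g addr0 (linZ _ _ (hG.2 _)).
  rewrite (tlift_pure (f := fun a b => G a (piG b))); last by blint.
  by rewrite boson_kG_smash ncoact_counit (negbTE hs) scale0r (lin0 (hG.2 _)).
by rewrite (ncounitr_sw (g := fun a => G (a # g) (gelt k g))) //; lint.
Qed.

(** After projection to kG the two outer legs of [x] become group elements: the first records its
    degree, the last is trivial. *)
Lemma straighten_piG X (F : kG k gT -> boson -> X) x z : bilin F ->
  T (x # 1%g) z (fun p y => F (piG p) y) =
  \sum_s F (hmul (group_hopf k gT) (gelt k s) (piG z)) (co s x # 1%g).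
Proof.
move=> hF; have [h1 h2] := group_mul_lin k gT; have hS := ha_anti (group_axioms k gT).
have hmA := ha_mul1 (group_axioms k gT).
rewrite /straighten.
transitivity (\sw_(a, b <- hcomul HB (x # 1%g)) \sw_(c, d <- hcomul HB b)
   F (hmul (group_hopf k gT) (hmul (group_hopf k gT) (piG a) (piG z))
       (hanti (group_hopf k gT) (piG d))) c).
  by apply: tlift_ext => a b; apply: tlift_ext => c d; rewrite !piGM piG_anti.
rewrite (comul_piGl (G := fun a b => \sw_(c, d <- hcomul HB b)
   F (hmul (group_hopf k gT) (hmul (group_hopf k gT) a (piG z))
       (hanti (group_hopf k gT) (piG d))) c)); last first.
  by blint.
apply: eq_bigr => s _; rewrite mulg1.
rewrite (comul_piGr (G := fun c d => F (hmul (group_hopf k gT) (hmul (group_hopf k gT) _ (piG z))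
       (hanti (group_hopf k gT) d)) c)); last by blint.
by rewrite gelt_anti invg1 hmA.
Qed.

Lemma wD_bD c x : wD c ** bD x = \sum_s bD (co s x) ** wD (s^-1 * c)%g.
Proof.
apply: ev_inj => z; rewrite (ev_fmulh HA).
transitivity (T (x # 1%g) z (fun p y => (piG p c : k^o) *: y)).
  by apply: tlift_ext => p y; apply: tlift_ext => q w; rewrite deltaBE !ffunE.
rewrite (straighten_piG (F := fun a y => (a c : k^o) *: y)); last by blint.
rewrite (lin_sumr (f := fun u => tens_ev u z)); last by lint.
apply: eq_bigr => s _; rewrite (double_hf HA) ev_pure deltaBE; congr (_ *: _).
have [h1 h2] := group_mul_lin k gT.
rewrite -[RHS]/(eB (z _) : k^o) -[RHS](ffunE (fun g => eB (z g))) -/(boson_kG NB z).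
move: (boson_kG NB z); apply: (kG_eq (X := k^o)) => [||g]; [by lint|by lint|].
by rewrite geltM !geltE -(inj_eq (mulgI s^-1%g)) mulKg.
Qed.

Lemma smash_comul_g g : hcomul HB (1 # g) = 1 # g \ot 1 # g.
Proof.
rewrite smash_comul ncomul_one tlift_pure; last by blint.
rewrite (bigD1 1%g) //= big1 => [|s hs].
  by rewrite ncoact_one eqxx mul1g addr0.
rewrite ncoact_one (negbTE hs); apply: (lin0 (f := fun z => _ \ot (z # _))).
by lint.
Qed.

Lemma smash_anti_g g : hanti HB (1 # g) = 1 # g^-1%g.
Proof.
have S1 : nanti NB 1 = 1.
  have := nantil NB 1; rewrite ncomul_one tlift_pure; last by blint.
  by rewrite mulr1 ncounit_one scale1r.
rewrite smash_anti (bigD1 1%g) //= big1 => [|s hs].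
  by rewrite ncoact_one eqxx mul1g addr0 S1 nact_one.
rewrite ncoact_one (negbTE hs) !linear0; apply: (lin0 (f := fun z => z # _)).
by lint.
Qed.

Definition conj_dual (g : gT) (f : dual boson) : dual boson :=
  linfun (fun x : boson => f (hmul HB (hmul HB (1 # g) x) (1 # g^-1%g)) : k^o).

Lemma conj_dualE g f x :
  conj_dual g f x = f (hmul HB (hmul HB (1 # g) x) (1 # g^-1%g)).
Proof. by rewrite linfunE //; lint. Qed.

Lemma gDM g h : gD g ** gD h = gD (g * h).
Proof. by rewrite /gD (double_hh HA) smashM mul1r nact_one. Qed.

Lemma gD1 : gD 1 = hone (DD_hopf NB).
Proof. by []. Qed.

Lemma bDM x y : bD x ** bD y = bD (x * y).
Proof. by rewrite /bD (double_hh HA) smashM mulg1 yact1. Qed.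

Lemma bD1 : bD 1 = hone (DD_hopf NB).
Proof. by []. Qed.

Lemma bD_gD x g : bD x ** gD g = x # g \ot dunit HB.
Proof. by rewrite /bD (double_hh HA) smashM mul1g yact1 mulr1. Qed.

Lemma gD_bD g x : gD g ** bD x = bD (act g x) ** gD g.
Proof. by rewrite bD_gD /gD /bD (double_hh HA) smashM mulg1 mul1r. Qed.

Lemma fDM f f' : fD f ** fD f' = fD (dmul HB f' f).
Proof. by rewrite /fD (double_ff HA). Qed.

Lemma fD_unit : fD (dunit HB) = hone (DD_hopf NB).
Proof. by []. Qed.

Lemma bD_gD_fD x g f : bD x ** gD g ** fD f = x # g \ot f.
Proof. by rewrite bD_gD (double_hf HA). Qed.

Lemma gD_fD g f : gD g ** fD f = 1 # g \ot f.
Proof. by rewrite (double_hf HA). Qed.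

Lemma fD_gD f g : fD f ** gD g = gD g ** fD (conj_dual g f).
Proof.
apply: ev_inj => x; rewrite gD_fD ev_pure (ev_fmulh HA).
rewrite (straighten_grouplike HA) ?smash_comul_g //; last by blint.
by rewrite smash_anti_g conj_dualE.
Qed.

Lemma deltaB_conj g h : conj_dual g (deltaB h) = deltaB (g^-1 * h * g).
Proof.
apply/lfunP => x; rewrite conj_dualE !deltaBE; move: x.
apply: (boson_eq (X := k^o)) => [||x s]; [by lint|by lint|].
rewrite !smashM !smashE mul1r nact_one mulr1 -(inj_eq (mulgI g^-1%g)) -(inj_eq (mulIg g)).
rewrite !mulgA mulVg mul1g -!mulgA mulVg mulg1 !mulgA.
by case: eqP; rewrite ?linear0 // nact_counit.
Qed.

Lemma wD_gD h g : wD h ** gD g = gD g ** wD (g^-1 * h * g).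
Proof. by rewrite /wD fD_gD deltaB_conj. Qed.

Lemma deltaB_mul h h' : dmul HB (deltaB h) (deltaB h') = if h == h' then deltaB h else 0.
Proof.
apply/lfunP => x; rewrite (dmulE HA); move: x.
apply: (boson_eq (X := k^o)) => [||x s]; [by apply: lin_tlift; lint|exact: linP|].
transitivity (\sw_(a, b <- hcomul HB (x # s)) (piG a h * piG b h' : k^o)).
  by apply: (tlift_ext (X := k^o)) => a b; rewrite !deltaBE !ffunE.
have hl : bilin (fun (a : boson) (b : kG k gT) => (piG a h * b h' : k^o)) by blint.
rewrite (comul_piGr (G := fun a b => (piG a h * b h' : k^o))) //.
rewrite boson_kG_smash !ffunE.
case: (altP (h =P h')) => [<-|hn]; rewrite ?deltaBE ?smashE ?lfunE /=.
  by case: eqP; rewrite ?linear0 ?mulr0 ?mulr1 /GRing.scale /= ?mulr1.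
case: eqP => hs; case: eqP => hs'; rewrite /GRing.scale /= ?mulr0 ?mul0r //.
by case/eqP: hn; rewrite hs hs'.
Qed.

Lemma wDM h h' : wD h ** wD h' = if h == h' then wD h else 0.
Proof.
rewrite /wD fDM deltaB_mul eq_sym; case: eqP => [->|_] //.
by apply: (lin0 (f := fD)); apply: lin_fD; apply: lin_id.
Qed.

Lemma deltaB_sum : \sum_h deltaB h = dunit HB.
Proof.
apply/lfunP => x; rewrite sum_lfunE (dunitE HA) /=.
by apply: eq_bigr => g _; rewrite deltaBE.
Qed.

Lemma wD_sum : \sum_h wD h = hone (DD_hopf NB).
Proof. by rewrite -fD_unit -deltaB_sum (lin_sumr (f := fD)) //; apply: lin_fD; apply: lin_id. Qed.

Lemma kG_boson_gelt g : kG_boson B (gelt k g) = 1 # g.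
Proof. by apply/ffunP => h; rewrite !ffunE; case: eqP; rewrite ?scale1r ?scale0r. Qed.

Lemma lin_DG_DD : lin (DG_DD NB).
Proof. by rewrite /DG_DD; apply: lin_tlift; apply: lin_id. Qed.

Lemma DG_DD_pure a f : DG_DD NB (a \ot f) = kG_boson B a \ot (f \o linfun (boson_kG NB))%VF.
Proof.
rewrite /DG_DD tlift_pure //; split=> b.
  by apply: lin_tpurel; apply: lin_kG_boson; apply: lin_id.
apply: lin_tpurer => c x y; apply/lfunP => z.
by rewrite !(comp_lfunE, add_lfunE, scale_lfunE).
Qed.

Lemma DG_DD_gelt g h : DG_DD NB (gelt k g \ot gdual k h) = gD g ** wD h.
Proof.
rewrite DG_DD_pure gD_fD kG_boson_gelt; congr (_ \ot _); apply/lfunP => x.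
rewrite comp_lfunE gdualE deltaBE linfunE ?ffunE //.
by apply: lin_piG; apply: lin_id.
Qed.

Lemma lin_B_DD : lin (B_DD NB).
Proof. exact: (lin_bD (@lin_id k B)). Qed.

Lemma lin_adr (z : DG k gT) : lin (fun d => Defs.ad NB z d).
Proof.
rewrite /Defs.ad; apply: lin_tliftE => z1 z2.
by apply: lin_dml; apply: lin_dmr; apply: lin_id.
Qed.

Lemma lin_hcomul_DG : lin (hcomul (DG_hopf k gT)).
Proof. by apply: lin_tlift; apply: lin_id. Qed.

Lemma lin_hanti_DG : lin (hanti (DG_hopf k gT)).
Proof. by apply: lin_tlift; apply: lin_id. Qed.

(** The adjoint action of D(G) on [B] is its Yetter-Drinfeld structure, so B^top (x) M is governed
    by the character and the degree of B^top. *)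
Lemma ad_bD g a x : Defs.ad NB (gelt k g \ot gdual k a) (bD x) = bD (act g (co a x)).
Proof.
rewrite /Defs.ad (DG_comul_sw (E := fun z1 z2 => hmul (DD_hopf NB)
   (hmul (DD_hopf NB) (DG_DD NB z1) (bD x)) (DG_DD NB (hanti (DG_hopf k gT) z2)))); last first.
  split=> ? /=; [do 2!apply: lin_dml; exact: lin_DG_DD|].
  by apply: lin_dmr; apply: (lin_comp lin_DG_DD); apply: lin_hanti_DG.
have mA := double_mulA HA.
transitivity (\sum_c \sum_s bD (act g (co s x)) **
    (wD (g * (s^-1 * c) * g^-1) ** wD (g * (a^-1 * c) * g^-1))).
  apply: eq_bigr => c _; rewrite DG_anti !DG_DD_gelt /= -(mA (gD g)) wD_bD.
  rewrite (lin_sumr (f := fun z => gD g ** z)); last by lint.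
  rewrite (lin_sumr (f := fun z => z ** _)); last by lint.
  apply: eq_bigr => s _.
  rewrite (mA (gD g)) gD_bD -!mA; congr (_ ** _); rewrite (mA (wD _)) wD_gD !mA gDM mulgV.
  rewrite (double_1mul HA) invgK; congr (wD _ ** wD _); by rewrite !mulgA ?invMg ?invgK ?mulgA.
(* The two idempotents are orthogonal unless [s = a]; for [s = a] they coincide, and they add up to
   1 as [c] varies. *)
rewrite exchange_big (bigD1 a) //= [X in _ + X]big1 => [|s hs].
  rewrite addr0 -(lin_sumr (f := fun z => bD (act g (co a x)) ** z)); last by lint.
  transitivity (bD (act g (co a x)) ** hone (DD_hopf NB)); last exact: double_mul1 HA _.
  congr (_ ** _); rewrite -wD_sum.
  rewrite [RHS](reindex_inj (h := fun c => (g * (a^-1 * c) * g^-1)%g)); last first.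
    by move=> c d /mulIg/mulgI/mulgI.
  by apply: eq_bigr => c _; rewrite wDM eqxx.
apply: big1 => c _; rewrite wDM ifN; first by apply: (lin0 (f := fun z => _ ** z)); lint.
rewrite (inj_eq (mulIg _)) (inj_eq (mulgI _)) (inj_eq (mulIg _)).
by apply: contra hs => /eqP/invg_inj ->.
Qed.

(** * The grading of the Nichols algebra *)

(** The bound is tested because [inord i] falls back to 0 beyond [top]. *)
Definition pr (i : nat) : 'End(B) :=
  if (i < top.+1)%N then sumv_pi (\sum_(j < top.+1) deg j)%VS (inord i) else 0.

Lemma pr_mem i x : pr i x \in deg i.
Proof.
rewrite /pr; case: ltnP => hi; last by rewrite lfunE mem0v.
by have := memv_sum_pi (erefl (\sum_(j < top.+1) deg j)%VS) (inord i) x; rewrite inordK.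
Qed.

Lemma pr_sum x : \sum_(i < top.+1) pr i x = x.
Proof.
rewrite -[RHS](sumv_pi_sum (erefl (\sum_(j < top.+1) deg j)%VS)) ?ndeg_sum ?memvf //.
by apply: eq_bigr => i _; rewrite /pr ltn_ord inord_val.
Qed.

Lemma pr_id i j x : x \in deg j -> pr i x = if i == j then x else 0.
Proof.
move=> hx; case: (leqP j top) => hj; last first.
  move: hx; rewrite ndeg_gt // memv0 => /eqP ->; rewrite linear0; by case: eqP.
case: (leqP i top) => hi; last first.
  rewrite /pr ltnS leqNgt hi /= lfunE /=; case: eqP => // e.
  by move: hi; rewrite e ltnNge hj.
have hu := elimT directv_sum_unique (ndeg_direct NB)
  (fun l : 'I_top.+1 => pr l x) (fun l => if l == inord j then x else 0).
have /hu{}hu : forall l : 'I_top.+1, true -> pr l x \in deg l by move=> l _; apply: pr_mem.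
have /hu{}hu : forall l : 'I_top.+1, true -> (if l == inord j then x else 0) \in deg l.
  by move=> l _; case: eqP => [->|_]; rewrite ?mem0v // inordK.
move: hu; rewrite pr_sum -big_mkcond big_pred1_eq eqxx => /esym/forall_inP.
move/(_ (inord i) isT)/eqP; rewrite inordK // => ->.
by rewrite -val_eqE /= !inordK.
Qed.

Lemma pr_idem i x : pr i (pr i x) = pr i x.
Proof. by rewrite (pr_id _ (pr_mem _ _)) eqxx. Qed.

Lemma B_graded (P : B -> Prop) : subspace P -> (forall i x, x \in deg i -> P x) -> forall x, P x.
Proof.
by move=> hP h x; rewrite -(pr_sum x); apply: subspace_sum => // i _; apply: h (pr_mem _ _).
Qed.

Lemma pr_commute (f : 'End(B)) i x : (forall i x, x \in deg i -> f x \in deg i) ->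
  pr i (f x) = f (pr i x).
Proof.
move=> h; move: x; apply: B_graded.
  split=> [|c x y hx hy]; first by rewrite !linear0.
  by rewrite !linearP /= hx hy.
move=> j x hx; rewrite (pr_id _ hx) (pr_id _ (h _ _ hx)).
by case: eqP; rewrite ?linear0.
Qed.

Lemma pr_co i g x : pr i (co g x) = co g (pr i x).
Proof. by apply: pr_commute => j y; apply: ncoact_deg. Qed.

Lemma one_deg0 : 1 \in deg 0.
Proof. by rewrite ndeg0 memv_line. Qed.

Lemma deg0E x : x \in deg 0 -> x = eB x *: 1.
Proof.
rewrite ndeg0 => /vlineP [c ->]; rewrite linearZ /= ncounit_one.
by rewrite [_ *: (1 : k^o)]/GRing.scale /= mulr1.
Qed.

Lemma pr0E x : pr 0 x = eB x *: 1.
Proof.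
rewrite (deg0E (pr_mem 0 x)); congr (_ *: _); move: x; apply: B_graded.
  split=> [|c x y hx hy]; first by rewrite !linear0.
  by rewrite !linearP /= hx hy.
move=> [|i] x hx; rewrite (pr_id _ hx) //=.
by rewrite linear0 (ncounit_deg _ hx).
Qed.

Lemma ncomul_ind i x (P : tens B B -> Prop) : subspace P -> x \in deg i ->
  (forall j u w, (j <= i)%N -> u \in deg j -> w \in deg (i - j) -> P (u \ot w)) -> P (DB x).
Proof.
move=> hP hx h; have /memv_sumP [t ht ->] := ncomul_deg hx.
apply: subspace_sum => // j _; have := ht j isT; apply: tens_sub_ind => // u w hu hw.
by apply: (h j) => //; rewrite -ltnS.
Qed.

(** The record says only that primitive elements have degree 1. For the converse, the grading leaves
    components in B^0 (x) B^1 and B^1 (x) B^0, and the two counit axioms identify both with [x]. *)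
Lemma deg1_comul x : x \in deg 1 -> DB x = x \ot 1 + 1 \ot x.
Proof.
move=> hx; have l1 : lin (fun z : B => z \ot (1 : B)) by lint.
have l2 : lin (fun z : B => (1 : B) \ot z) by lint.
have [a [b [ha hb e]]] : exists a b, [/\ a \in deg 1, b \in deg 1 & DB x = 1 \ot a + b \ot 1].
  apply: (ncomul_ind (P := fun t => exists a b, [/\ a \in deg 1, b \in deg 1 & t = 1 \ot a + b \ot 1])) hx _.
    split; first by exists 0, 0; rewrite mem0v (lin0 l1) (lin0 l2) addr0; split.
    move=> c t t' [a [b [ha hb ->]]] [a' [b' [ha' hb' ->]]].
    exists (c *: a + a'), (c *: b + b'); rewrite !memvD ?memvZ //; split=> //.
    by rewrite l1 l2 scalerDr addrACA.
  case=> [|[|//]] u w _ hu hw.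
    exists (eB u *: w), 0; rewrite memvZ // mem0v (lin0 l1) addr0; split=> //.
    rewrite {1}(deg0E hu) (linZ _ _ l2) (linZ (f := fun u => u \ot w)) //; lint.
  exists 0, (eB w *: u); rewrite memvZ // mem0v (lin0 l2) add0r; split=> //.
  rewrite {1}(deg0E hw) (linZ _ _ l1) (linZ (f := fun w => u \ot w)) //; lint.
have ea : x = a.
  have lf : lin (fun t : tens B B => tlift t (fun x1 x2 => eB x1 *: x2)) by apply/lin_tlift/lin_id.
  have := ncounitl NB x; rewrite e (linD _ _ lf) !tlift_pure; try by blint.
  by rewrite ncounit_one (ncounit_deg _ hb) // scale1r scale0r addr0.
have eb : x = b.
  have lf : lin (fun t : tens B B => tlift t (fun x1 x2 => eB x2 *: x1)) by apply/lin_tlift/lin_id.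
  have := ncounitr NB x; rewrite e (linD _ _ lf).
  rewrite !(tlift_pure (f := fun x1 x2 => eB x2 *: x1)); try by blint.
  by rewrite ncounit_one (ncounit_deg _ ha) // scale1r scale0r add0r.
by rewrite e addrC -ea -eb.
Qed.

(* hit y x = y(x_(1)) x_(2), where y is first restricted to degree 1. *)
Definition hit (y : dual B) (x : B) : B := \sw_(a, b <- DB x) ((y (pr 1 a) : k^o) *: b).

Lemma lin_hit y : lin (hit y).
Proof. by rewrite /hit; lint. Qed.

Lemma hit_deg y j x : x \in deg j -> hit y x \in deg j.-1.
Proof.
move=> hx; have hP := subspace_tlift_eq (fun a b => (y (pr 1 a) : k^o) *: b) (subspace_mem (deg j.-1)).
apply: (ncomul_ind hP hx) => i u w hi hu hw.
rewrite (tlift_pure (f := fun a b => (y (pr 1 a) : k^o) *: b)); last by blint.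
rewrite (pr_id _ hu); case: eqP => [ei|_]; last by rewrite linear0 scale0r mem0v.
by rewrite memvZ //; move: hw; rewrite -ei subn1.
Qed.

Lemma hit_deg0 y x : x \in deg 0 -> hit y x = 0.
Proof.
move=> /deg0E ->; rewrite (linZ _ _ (lin_hit y)) /hit ncomul_one.
rewrite (tlift_pure (f := fun a b => (y (pr 1 a) : k^o) *: b)); last by blint.
by rewrite (pr_id _ one_deg0) linear0 scale0r scaler0.
Qed.

Lemma pr_hit y i x : pr i (hit y x) = hit y (pr i.+1 x).
Proof.
have hl := lin_hit y; move: x; apply: B_graded.
  split=> [|c x z hx hz]; first by rewrite !linear0 (lin0 hl) linear0.
  by rewrite hl !linearP /= hl hx hz.
case=> [|j] x hx; first by rewrite hit_deg0 // (pr_id _ hx) linear0 (lin0 hl).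
by rewrite (pr_id _ hx) (pr_id _ (hit_deg y hx)) /= eqSS; case: eqP => // _; rewrite (lin0 hl).
Qed.

(** The second clause is not contained in the first: when [n < l] the truncated [n - l] is 0, and
    the contraction vanishes instead of being a scalar. *)
Lemma comul_prr (f : dual B) l n x : x \in deg n ->
  \sw_(a, b <- DB x) ((f (pr l b) : k^o) *: a) \in deg (n - l) /\
  ((n < l)%N -> \sw_(a, b <- DB x) ((f (pr l b) : k^o) *: a) = 0).
Proof.
move=> hx.
have hb : bilin (fun a b : B => (f (pr l b) : k^o) *: a) by blint.
split=> [|hl].
  have hP := subspace_tlift_eq (fun a b => (f (pr l b) : k^o) *: a) (subspace_mem (deg (n - l))).
  apply: (ncomul_ind hP hx) => i u w hi hu hw; rewrite (tlift_pure _ _ hb) (pr_id _ hw).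
  case: eqP => [->|_]; last by rewrite linear0 scale0r mem0v.
  by rewrite memvZ // subKn.
have hP := subspace_tlift_eq (fun a b => (f (pr l b) : k^o) *: a) (@subspace0 k B).
apply: (ncomul_ind hP hx) => i u w hi hu hw; rewrite (tlift_pure _ _ hb) (pr_id _ hw).
case: eqP => [e|_]; last by rewrite linear0 scale0r.
by move: hl; rewrite e ltnNge leq_subr.
Qed.

Lemma comul_pr_same (f : dual B) n x : x \in deg n ->
  \sw_(a, b <- DB x) ((f (pr n b) : k^o) *: a) = (f x : k^o) *: 1.
Proof.
move=> hx; have [] := comul_prr f n hx; rewrite subnn => /deg0E -> _; congr (_ *: _).
rewrite (tlift_out _ _ (g := fun z => eB z : k^o)); last by lint.
have hl : lin (fun z => f (pr n z) : k^o) by lint.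
rewrite (_ : f x = f (pr n x)); last by rewrite (pr_id _ hx) eqxx.
rewrite -(ncounitl_sw x hl); apply: (tlift_ext (X := k^o)) => a b.
by rewrite linearZ /= /GRing.scale /= mulrC.
Qed.

(* An element of degree n >= 2 whose component in B^1 (x) B^(n-1) vanishes has all
   its middle components zero, by coassociativity, hence is primitive. *)
Lemma hit_eq0 n x : (0 < n)%N -> x \in deg n -> (forall y, hit y x = 0) -> x = 0.
Proof.
have [m] := ubnP n; elim: m => // m IH in n x * => lnm n0 hx hy.
(* In degree 1, [x] is primitive and [hit f x] is f(x) 1. *)
have [n1|n2] := leqP n 1.
  have e : n = 1%N by apply/eqP; rewrite eqn_leq n1 n0.
  move: hx; rewrite e => hx; apply: dual_ext => f; rewrite linear0.
  have := hy f; rewrite /hit deg1_comul //.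
  have hl : lin (fun t : tens B B => tlift t (fun a b => (f (pr 1 a) : k^o) *: b)) by apply/lin_tlift/lin_id.
  rewrite (linD _ _ hl) !tlift_pure; try by blint.
  rewrite (pr_id _ hx) (pr_id _ one_deg0) /= linear0 scale0r addr0 => /(congr1 eB).
  by rewrite linearZ /= ncounit_one linear0 /GRing.scale /= mulr1.
(* Contracting the right leg with B^l gives an element of degree n - l, positive and less than n,
   whose hits vanish by coassociativity; the induction hypothesis applies. *)
have hmid (f : dual B) l : (0 < l < n)%N -> \sw_(a, b <- DB x) ((f (pr l b) : k^o) *: a) = 0.
  move=> /andP [l0 ln]; have [hd _] := comul_prr f l hx.
  apply: IH hd _; [|by rewrite subn_gt0|].
    by rewrite ltnS in lnm; apply: leq_trans lnm; rewrite ltn_subrL l0 n0.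
  move=> y; rewrite (tlift_out _ _ (lin_hit y)).
  pose g b := \sw_(c, d <- DB b) ((f (pr l d) : k^o) *: c).
  have hg : lin g by rewrite /g; lint.
  rewrite -[RHS](lin0 hg) -(hy y) [in RHS]/hit (tlift_out _ _ hg).
  transitivity (\sw_(a, b <- DB x) \sw_(c, d <- DB a) ((f (pr l b) * y (pr 1 c) : k^o) *: d)).
    apply: tlift_ext => a b; rewrite (linZ _ _ (lin_hit y)) [hit y a]/hit -tliftZ.
    by apply: tlift_ext => c d; rewrite scalerA.
  rewrite -ncoassoc_sw; apply: tlift_ext => a b; rewrite (linZ _ _ hg) /g -tliftZ.
  by apply: tlift_ext => c d; rewrite scalerA mulrC.
have [hn|hn] := leqP n top; last by move: hx; rewrite ndeg_gt // memv0 => /eqP.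
have hprim : DB x = x \ot 1 + 1 \ot x.
  apply: tens_sep => f.
  have hl : lin (fun t : tens B B => tlift t (fun a b => (f b : k^o) *: a)) by apply/lin_tlift/lin_id.
  rewrite (linD _ _ hl) !(tlift_pure (f := fun a b => (f b : k^o) *: a)); try by blint.
  transitivity (\sum_(l < top.+1) \sw_(a, b <- DB x) ((f (pr l b) : k^o) *: a)).
    rewrite -tlift_sum; apply: tlift_ext => a b; rewrite -{1}(pr_sum b).
    by rewrite (lin_sumr (f := fun z => (f z : k^o) *: a)) //; lint.
  have n0' : (ord0 : 'I_top.+1) != inord n.
    by rewrite -val_eqE /= inordK // eq_sym -lt0n.
  (* Only [l = 0] and [l = n] survive; they give x (x) 1 and 1 (x) x. *)
  rewrite (bigD1 ord0) //= (bigD1 (inord n)) 1?eq_sym //= big1 => [|l /andP [h1 h2]].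
    rewrite addr0 inordK // (comul_pr_same f hx); congr (_ + _).
    transitivity (\sw_(a, b <- DB x) (eB b *: ((f 1 : k^o) *: a))).
      by apply: tlift_ext => a b; rewrite pr0E linearZ -scalerA.
    by rewrite (ncounitr_sw (g := fun a => (f 1 : k^o) *: a)) //; lint.
  have [ln|nl] := ltnP l n; first by apply: hmid; rewrite lt0n -val_eqE in h1 *; rewrite h1.
  apply: (comul_prr f l hx).2; rewrite ltn_neqAle nl andbT.
  by apply: contra h2 => /eqP e; rewrite -val_eqE /= inordK // e.
have := nprim hprim => h1; have := pr_id 1 h1; rewrite (pr_id 1 hx).
by case: eqP n2 => // <-.
Qed.

Definition hitH (y : dual B) (a : boson) : boson := [ffun g => hit y (a g)].

(* Minimal degree argument: the hits by functionals of degree 1 lower the degree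
   and only kill elements of degree 0. *)
Lemma coideal_eq0 (I : boson -> Prop) :
  (forall y a, I a -> I (hitH y a)) ->
  (forall a, I a -> (forall g, a g \in deg 0) -> a = 0) -> forall a, I a -> a = 0.
Proof.
move=> hI h0.
suff h n : forall a, I a -> (forall g i, (n < i)%N -> pr i (a g) = 0) -> a = 0.
  move=> a Ia; apply: (h top) => // g i hi.
  by have := pr_mem i (a g); rewrite ndeg_gt // memv0 => /eqP.
elim: n => [|n IH] a Ia ha.
  apply: h0 => // g; rewrite -(pr_sum (a g)) big_ord_recl big1 ?addr0 ?pr_mem //.
  by move=> i _; apply: ha.
have hy y : hitH y a = 0.
  apply: IH; first exact: hI.
  move=> g i hi; rewrite ffunE pr_hit ha //; exact: lin0 (lin_hit y).
apply: h0 => // g; rewrite -(pr_sum (a g)) big_ord_recl big1 ?addr0 ?pr_mem //.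
move=> i _; apply: (hit_eq0 (n := i.+1)) (pr_mem _ _) _ => // y.
by rewrite -pr_hit; have /ffunP/(_ g) := hy y; rewrite !ffunE => ->; rewrite linear0.
Qed.

Lemma lin_hitH y : lin (hitH y).
Proof. by move=> c a b; apply/ffunP => g; rewrite !ffunE (lin_hit y). Qed.

Lemma hitH_smash y x g : hitH y (x # g) = hit y x # g.
Proof. by apply/ffunP => h; rewrite !ffunE; case: eqP => // _; apply: lin0 (lin_hit y). Qed.

Definition deg1_dual (y : dual B) : dual boson :=
  linfun (fun a : boson => \sum_g y (pr 1 (a g)) : k^o).

Lemma deg1_dualE y x g : deg1_dual y (x # g) = y (pr 1 x).
Proof.
rewrite linfunE; last by lint.
by rewrite (sum_smash (X := k^o) (F := fun g x => y (pr 1 x))) // => h; rewrite !linear0.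
Qed.

(** [hitH y] is contraction of the left leg with an element of $\overline V$, so [coideal_eq0]
    applies to any subspace stable under such contractions. *)
Lemma hitHE y a : hitH y a = \sw_(b, c <- hcomul HB a) ((deg1_dual y b : k^o) *: c).
Proof.
move: a; apply: boson_eq; [exact: lin_hitH|by apply: lin_tlift; lint|] => x g.
rewrite hitH_smash smash_comul tlift_map /hit.
rewrite (tlift_out _ _ (g := fun z => z # g)); last by lint.
apply: tlift_ext => b c; rewrite tlift_suml -{1}(ycounit (nyd NB) c).
rewrite (lin_sumr (f := fun z => (y (pr 1 b) *: z) # g)); last by lint.
apply: eq_bigr => s _; rewrite tlift_pure; last by blint.
by rewrite deg1_dualE (linZ (f := fun z => z # g)) //; lint.
Qed.

(** * The subalgebra D>=0 *)

Definition in_kG (a : boson) := kG_boson B (piG a) = a.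

Lemma subspace_in_kG : subspace in_kG.
Proof.
have l : lin (fun a : boson => kG_boson B (piG a)) by lint.
by split=> [|c x y hx hy]; rewrite /in_kG ?(lin0 l) // l hx hy.
Qed.

Lemma in_kG_ind (P : boson -> Prop) : subspace P -> (forall g, P (1 # g)) ->
  forall a, in_kG a -> P a.
Proof.
move=> hP h a <-; rewrite (kG_sum (piG a)).
rewrite (lin_sumr (f := @kG_boson k gT B)); last by lint.
apply: subspace_sum => // g _; rewrite (linZ (f := @kG_boson k gT B)); last by lint.
by apply: subspaceZ => //; rewrite kG_boson_gelt.
Qed.

Lemma in_kG_g g : in_kG (1 # g).
Proof. by rewrite /in_kG boson_kG_smash ncounit_one scale1r kG_boson_gelt. Qed.

Lemma in_kG_kG c : in_kG (kG_boson B c).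
Proof.
move: c; have l : lin (fun a : kG k gT => kG_boson B (piG (kG_boson B a))) by lint.
apply: kG_eq => // [|g]; first by lint.
by rewrite kG_boson_gelt; apply: in_kG_g.
Qed.

Lemma in_kG_mul a b : in_kG a -> in_kG b -> in_kG (hmul HB a b).
Proof.
have [s0 sl] := subspace_in_kG.
move=> ha hb; move: a ha; apply: in_kG_ind => [|g].
  by split=> [|c x y hx hy]; rewrite ?(lin0 (boson_mull_lin b)) ?boson_mull_lin //; apply: sl.
move: b hb; apply: in_kG_ind => [|h].
  by split=> [|c x y hx hy]; rewrite ?(lin0 (boson_mulr_lin _)) ?boson_mulr_lin //; apply: sl.
by rewrite smashM mul1r nact_one; apply: in_kG_g.
Qed.

Lemma straighten_g X g x (E : boson -> boson -> X) : bilin E ->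
  T (1 # g) x E = E (hmul HB (hmul HB (1 # g) x) (1 # g^-1%g)) (1 # g).
Proof. by move=> hE; rewrite (straighten_grouplike HA) ?smash_comul_g ?smash_anti_g. Qed.

(** By duality, it suffices that the functionals in [W] have no common zero in B # kG. Their common
    zeros are stable under [hitH], because [W] absorbs products with $\overline V$, and contain
    nothing nonzero of degree 0, because [W] contains every delta_h; [coideal_eq0] concludes. *)
Lemma ge0_generated (W : {vspace DD}) :
  [/\ hone (DD_hopf NB) \in W, forall z, DG_DD NB z \in W,
        forall d, Vbar_DD NB d -> d \in W
      & forall a b, a \in W -> b \in W -> hmul (DD_hopf NB) a b \in W] ->
  forall g f, gD g ** fD f \in W.
Proof.
move=> [h1 hG hV hM].
have lf : lin (fD) by apply: lin_fD; apply: lin_id.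
have hw h : wD h \in W.
  have := hG (gelt k 1%g \ot gdual k h); rewrite DG_DD_gelt.
  by rewrite gD1 (double_1mul HA).
have hg g : gD g \in W.
  rewrite -(double_mul1 HA (gD g)) -[_ \ot _]/(hone (DD_hopf NB)) -wD_sum.
  rewrite (lin_sumr (f := fun z => gD g ** z)); last by lint.
  by apply: memv_suml => h _; rewrite -DG_DD_gelt; apply: hG.
have hpsi y : fD (deg1_dual y) \in W.
  apply: hV; exists (deg1_dual y), (y \o niota NB)%VF; split=> // [x g|i b g hi hb].
    rewrite deg1_dualE comp_lfunE (pr_id _ (j := 1)) //.
    by rewrite -(niota_deg1 NB) memv_img ?memvf.
  by rewrite deg1_dualE (pr_id _ hb) eq_sym (negbTE hi) linear0.
have hsub : subspace (fun f : dual boson => fD f \in W).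
  split=> [|c x y hx hy]; first by rewrite (lin0 lf) mem0v.
  by rewrite lf memvD ?memvZ.
have [S hS] := subspace_vspace hsub.
have hf : forall f, f \in S.
  apply: dual_annihilator => a; move: a.
  apply: coideal_eq0 => [y a ha f hf|a ha h0].
    rewrite hitHE (tlift_out _ _ (g := fun z => f z : k^o)); last by lint.
    have hm : dmul HB (deg1_dual y) f \in S.
      by apply/hS; rewrite -fDM; apply: hM; [apply/hS|apply: hpsi].
    rewrite -(ha _ hm) (dmulE HA); apply: (tlift_ext (X := k^o)) => b c.
    by rewrite linearZ.
  apply/ffunP => g; rewrite ffunE (deg0E (h0 g)) -deltaBE.
  by rewrite ha ?scale0r //; apply/hS; apply: hw.
by move=> g f; apply: hM; [apply: hg|apply/hS].
Qed.

Lemma in_kG_ev0 u : (forall x, in_kG (tens_ev u x)) ->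
  exists F : gT -> dual boson, u = \sum_g gD g ** fD (F g).
Proof.
move=> h; exists (fun g => linfun (fun x : boson => piG (tens_ev u x) g : k^o)).
apply: ev_inj => x; rewrite (lin_sumr (f := fun u => tens_ev u x)); last by lint.
rewrite -(h x) {1}(kG_sum (piG (tens_ev u x))).
rewrite (lin_sumr (f := @kG_boson k gT B)); last by lint.
apply: eq_bigr => g _; rewrite gD_fD ev_pure linfunE; last by lint.
by rewrite (linZ (f := @kG_boson k gT B)) ?kG_boson_gelt //; lint.
Qed.

(** D>=0 is kG (x) (B # kG)^*, that is, the endomorphisms with values in kG. These are closed under
    the product because straightening past a group element only conjugates the argument. *)
Lemma DD_ge0P u : u \in DD_ge0 NB <-> forall x, in_kG (tens_ev u x).
Proof.
have hs : subspace (fun u : DD => forall x, in_kG (tens_ev u x)).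
  have [s0 sl] := subspace_in_kG.
  split=> [|c v w hv hw] x; first by rewrite (lin0 (f := fun u => tens_ev u x)) //; lint.
  have hl : lin (fun u : DD => tens_ev u x) by apply: lin_ev; apply: lin_id.
  by rewrite hl; apply: sl.
have [U hU] := subspace_vspace hs.
suff -> : DD_ge0 NB = U by apply: hU.
apply: least_vspaceE; last first.
  move=> W hW; apply/subvP => v /hU /in_kG_ev0 [F ->].
  by apply: memv_suml => g _; apply: ge0_generated.
split.
- apply/hU => x; rewrite -gD1 ev_pure.
  by apply: subspaceZ; [exact: subspace_in_kG|exact: in_kG_g].
- move=> z; apply/hU => x; move: z; apply: tens_ind.
  + have l : lin (fun z => tens_ev (DG_DD NB z) x) by apply: lin_ev; apply: lin_DG_DD.
    by rewrite (lin0 l); case: subspace_in_kG.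
  + have l : lin (fun z => tens_ev (DG_DD NB z) x) by apply: lin_ev; apply: lin_DG_DD.
    by move=> c y z hy hz; rewrite l; apply: subspace_in_kG.2.
  + move=> a f; rewrite DG_DD_pure ev_pure; apply: subspaceZ; first exact: subspace_in_kG.
    exact: in_kG_kG.
- move=> _ [f [y [-> _ _]]]; apply/hU => x; rewrite ev_pure.
  by apply: subspaceZ; [exact: subspace_in_kG|exact: in_kG_g].
- move=> a b /hU ha /hU hb; apply/hU => x; rewrite (ev_mul HA).
  apply: subspace_tlift => [|x1 x2]; first exact: subspace_in_kG.
  move: (tens_ev b x1) (hb x1).
  have hl : lin (fun c => T c x2 (fun z y => hmul HB (tens_ev a z) y)).
    by apply: (lin_straightenl HA) => *; lint.
  apply: in_kG_ind => [|g].
    split=> [|c y z hy hz]; first by rewrite (lin0 hl); case: subspace_in_kG.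
    by rewrite hl; apply: subspace_in_kG.2.
  rewrite straighten_g; last by blint.
  by apply: in_kG_mul; [exact: ha|exact: in_kG_g].
Qed.

Lemma gD_fD_ge0 g f : gD g ** fD f \in DD_ge0 NB.
Proof. by apply/DD_ge0P => x; rewrite gD_fD ev_pure; apply: subspaceZ; [exact: subspace_in_kG|exact: in_kG_g]. Qed.

Lemma ge0_ind (P : DD -> Prop) : subspace P -> (forall g f, P (gD g ** fD f)) ->
  forall u, u \in DD_ge0 NB -> P u.
Proof. by move=> hP h u /DD_ge0P/in_kG_ev0 [F ->]; apply: subspace_sum. Qed.

(** The iterated coproduct of a homogeneous [v] is v (x) 1 (x) 1 + s (x) v (x) 1 + s (x) s (x) v,
    whence three terms. The formula for [f2] is recorded because it can be inverted in [f], which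
    allows [v] to be moved to the right of any functional. *)
Lemma fD_b1 f s v : v \in deg 1 -> co s v = v -> exists f1 f2,
  fD f ** bD v = fD f1 + bD v ** fD f2 +
    gD s ** fD (linfun (fun x : boson =>
      f (hmul HB (hmul HB (1 # s) x) (hanti HB (v # 1%g))) : k^o)) /\
  f2 = linfun (fun x : boson => f (hmul HB (1 # s) x) : k^o).
Proof.
move=> hv hs; pose f1 : dual boson := linfun (fun x : boson => f (hmul HB (v # 1%g) x) : k^o).
exists f1; eexists; split; last by [].
have hd : hcomul HB (v # 1%g) = v # 1%g \ot 1 # 1%g + 1 # s \ot v # 1%g.
  rewrite smash_comul deg1_comul //.
  rewrite (linD (f := fun t => tlift t _)); last by apply: lin_tlift; apply: lin_id.
  rewrite !tlift_pure; try by blint.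
  congr (_ + _).
    rewrite (bigD1 1%g) //= big1 => [|r hr]; first by rewrite ncoact_one eqxx mul1g addr0.
    by rewrite ncoact_one (negbTE hr); apply: (lin0 (f := fun z => _ \ot (z # _))); lint.
  rewrite (bigD1 s) //= big1 => [|r hr]; first by rewrite hs mulg1 addr0.
  rewrite -hs ycoassoc eq_sym (negbTE hr).
  by apply: (lin0 (f := fun z => _ \ot (z # _))); lint.
apply: ev_inj => x; rewrite (ev_fmulh HA) /straighten.
have hE : bilin (fun z y : boson => (f z : k^o) *: y) by blint.
have l1 (F : boson -> boson -> boson) : bilin F -> tlift (hcomul HB (v # 1%g)) F = F (v # 1%g) (1 # 1%g) + F (1 # s) (v # 1%g).
  move=> hF; rewrite hd (linD (f := fun t => tlift t F)); last by apply: lin_tlift; apply: lin_id.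
  by rewrite !tlift_pure.
have l2 (F : boson -> boson -> boson) : bilin F -> tlift (hcomul HB (1 # 1%g)) F = F (1 # 1%g) (1 # 1%g).
  by move=> hF; rewrite smash_comul_g tlift_pure.
rewrite l1; last by blint.
rewrite l2; last by blint.
rewrite l1; last by blint.
rewrite smash_anti_g invg1 -[1 # 1%g]/(hone HB) !(ha_mul1 HA).
rewrite !(linD (f := fun u => tens_ev u x)); try by lint.
rewrite (double_hf HA) gD_fD !ev_pure !linfunE; try by lint.
by rewrite addrA.
Qed.

(** * The Frobenius form *)

(** The right leg reaches degree [top] only in the component 1 (x) x with x of degree [top], so a
    functional of top degree is a cointegral of [B]. *)
Lemma comul_prtop (f : dual B) x :
  \sw_(a, b <- DB x) ((f (pr top b) : k^o) *: a) = (f (pr top x) : k^o) *: 1.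
Proof.
have l1 : lin (fun x => \sw_(a, b <- DB x) ((f (pr top b) : k^o) *: a)) by lint.
have l2 : lin (fun x => (f (pr top x) : k^o) *: (1 : B)) by lint.
move: x; apply: B_graded.
  by split=> [|c x y hx hy]; rewrite ?(lin0 l1) ?(lin0 l2) // l1 l2 hx hy.
move=> i x hx; have [hi|hi|hi] := ltngtP i top.
- by rewrite (comul_prr f top hx).2 // (pr_id _ hx) gtn_eqF // linear0 scale0r.
- move: hx; rewrite (ndeg_gt hi) memv0 => /eqP ->; by rewrite (lin0 l1) (lin0 l2).
by move: hx; rewrite hi => hx; rewrite (comul_pr_same _ hx) (pr_id _ hx) eqxx.
Qed.

(** [La] spans the line B^top, [phi] is its coordinate extended by 0 to lower degrees, and [t] is
    its degree in G. *)
Record top_data (phi : dual B) (La : B) (t : gT) : Prop := TopData {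
  td_La : La \in deg top;
  td_phi : phi La = 1;
  td_pr : forall x, phi (pr top x) = phi x;
  td_co : forall s x, phi (co s x) = if s == t then phi x else 0;
  td_span : forall x, x \in deg top -> x = (phi x : k^o) *: La;
  td_nondeg : forall x, (forall c, phi (c * x) = 0) -> x = 0 }.

Section Cointegral.
Variables (phi : dual B) (La : B) (t : gT).
Hypothesis phi_La : phi La = 1.
Hypothesis phi_pr : forall x, phi (pr top x) = phi x.
Hypothesis phi_co : forall s x, phi (co s x) = if s == t then phi x else 0.

(** The index [t^-1] makes this a cointegral of B # kG: the part of the coproduct of x # g with
    right leg in top degree has left leg proportional to 1 # (t g), the unit exactly when g =
    t^-1. *)
Definition phiH : dual boson := linfun (fun a : boson => phi (a t^-1%g) : k^o).

Lemma phiH_smash x g : phiH (x # g) = if g == t^-1%g then phi x else 0.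
Proof. by rewrite linfunE ?smashE 1?eq_sym; [case: eqP; rewrite ?linear0|lint]. Qed.

Lemma cointegral_H a : \sw_(b, c <- hcomul HB a) ((phiH c : k^o) *: b) = (phiH a : k^o) *: hone HB.
Proof.
move: a; apply: boson_eq => [||x g]; [by apply: lin_tlift; lint|by lint|].
have hb : bilin (fun b c : boson => (phiH c : k^o) *: b) by blint.
rewrite smash_comul tlift_map phiH_smash.
transitivity (\sw_(a, b <- DB x) \sum_s ((if g == t^-1%g then phi (co s b) else 0 : k^o) *: (a # (s * g)%g))).
  apply: tlift_ext => a b; rewrite tlift_suml; apply: eq_bigr => s _.
  by rewrite (tlift_pure _ _ hb) phiH_smash.
case: eqP => [->|_]; last first.
  rewrite scale0r -[RHS](tlift0 _ (DB x)); apply: tlift_ext => a b.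
  by apply: big1 => s _; rewrite scale0r.
transitivity ((\sw_(a, b <- DB x) ((phi (pr top b) : k^o) *: a)) # 1%g); last first.
  by rewrite comul_prtop phi_pr (linZ (f := fun z => z # 1%g)) //; lint.
rewrite (tlift_out _ _ (g := fun z => z # 1%g)); last by lint.
apply: tlift_ext => a b; rewrite (bigD1 t) //= big1 => [|s hs].
  by rewrite phi_co eqxx addr0 mulgV phi_pr (linZ (f := fun z => z # 1%g)) //; lint.
by rewrite phi_co (negbTE hs) scale0r.
Qed.

(** Insert S(h1) h2 in front of x1; the cointegral property applied to h2 x then leaves S(h1). *)
Lemma cointegral_swap h x :
  \sw_(x1, x2 <- hcomul HB x) ((phiH (hmul HB h x2) : k^o) *: x1) =
  \sw_(h1, h2 <- hcomul HB h) ((phiH (hmul HB h2 x) : k^o) *: hanti HB h1).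
Proof.
transitivity (\sw_(h1, h' <- hcomul HB h) \sw_(h2, h3 <- hcomul HB h')
   \sw_(x1, x2 <- hcomul HB x)
     ((phiH (hmul HB h3 x2) : k^o) *: hmul HB (hmul HB (hanti HB h1) h2) x1)).
  rewrite (ha_coassoc HA).
  transitivity (\sw_(h', h3 <- hcomul HB h) (hcounit HB h' *:
     \sw_(x1, x2 <- hcomul HB x) ((phiH (hmul HB h3 x2) : k^o) *: x1))).
    by rewrite (counitl_sw HA (g := fun h3 => \sw_(x1, x2 <- hcomul HB x) ((phiH (hmul HB h3 x2) : k^o) *: x1))) //; lint.
  apply: tlift_ext => h' h3; rewrite tlift_swap -tliftZ; apply: tlift_ext => x1 x2.
  rewrite (antil_sw HA (g := fun z => (phiH (hmul HB h3 x2) : k^o) *: hmul HB z x1)); last by lint.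
  by rewrite (ha_1mul HA).
apply: tlift_ext => h1 h2.
transitivity (hmul HB (hanti HB h1) ((phiH (hmul HB h2 x) : k^o) *: hone HB)); last first.
  by rewrite (linZ (f := fun z => hmul HB (hanti HB h1) z)) ?(ha_mul1 HA) //; lint.
rewrite -cointegral_H (comulM_sw HA); last by blint.
rewrite (tlift_out _ _ (g := fun z => hmul HB (hanti HB h1) z)); last by lint.
apply: tlift_ext => a b.
rewrite (tlift_out _ _ (g := fun z => hmul HB (hanti HB h1) z)); last by lint.
apply: tlift_ext => c d.
by rewrite (linZ (f := fun z => hmul HB (hanti HB h1) z)) ?(ha_mulA HA) //; lint.
Qed.

(* The radical of (h, x) |-> phiH (h x) is a left coideal without nonzero
   elements of degree 0. *)
Lemma phi_nondeg x : (forall c, phi (c * x) = 0) -> x = 0.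
Proof.
move=> hx.
suff h (a : boson) : (forall h, phiH (hmul HB h a) = 0) -> a = 0.
  (* The translate by [t] cancels the action of [t^-1], the only group component on which [phiH] is
     nonzero. *)
  have e0 : act t x # 1%g = 0.
    apply: h => h; move: h; apply: (boson_eq (X := k^o)) => [||c g]; [by lint|by lint|].
    rewrite smashM mulg1 phiH_smash; case: eqP => // ->.
    by rewrite -yactM mulVg yact1 hx.
  have /ffunP/(_ 1%g) := e0; rewrite smashE eqxx ffunE => /(congr1 (act t^-1%g)).
  by rewrite -yactM mulVg yact1 linear0.
move: a; apply: coideal_eq0 => [y a ha h|a ha h0].
  rewrite hitHE.
  transitivity (deg1_dual y (\sw_(x1, x2 <- hcomul HB a) ((phiH (hmul HB h x2) : k^o) *: x1))).
    rewrite (tlift_out _ _ (g := fun z => deg1_dual y z : k^o)); last by lint.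
    rewrite (tlift_out _ _ (g := fun z => phiH (hmul HB h z) : k^o)); last by lint.
    apply: (tlift_ext (X := k^o)) => b c.
    rewrite (linZ (f := fun z => phiH (hmul HB h z) : k^o)); last by lint.
    by rewrite linearZ /GRing.scale /= mulrC.
  rewrite cointegral_swap; under tlift_ext => b c do rewrite ha scale0r.
  by rewrite tlift0 linear0.
apply/ffunP => g; rewrite ffunE (deg0E (h0 g)).
(* For [a] of degree 0, this multiplier moves the coefficient at [g] to the index [t^-1], where
   [phiH] reads it. *)
have := ha (La # (t^-1 * g^-1)%g).
have -> : hmul HB (La # (t^-1 * g^-1)%g) a = \sum_h (eB (a h) *: La) # (t^-1 * g^-1 * h)%g.
  rewrite {1}(boson_sum a) (lin_sumr (f := fun z => hmul HB _ z)); last by apply: boson_mulr_lin.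
  apply: eq_bigr => h _; rewrite smashM (deg0E (h0 h)) linearZ /= nact_one -scalerAr mulr1.
  by rewrite linearZ /= ncounit_one [_ *: (1 : k^o)]/GRing.scale /= mulr1.
rewrite linear_sum (bigD1 g) //= big1 => [|h hh].
  rewrite addr0 phiH_smash mulgKV eqxx linearZ /= phi_La.
  by rewrite [_ *: (1 : k^o)]/GRing.scale /= mulr1 => ->; rewrite scale0r.
by rewrite phiH_smash -mulgA -{2}[t^-1%g]mulg1 (inj_eq (mulgI _)) -(inj_eq (mulgI g)) mulKVg mulg1 (negbTE hh).
Qed.

End Cointegral.

(** B^top is a line by nondegeneracy: elements of positive degree annihilate it, so a top vector
    killed by [phi] is orthogonal to all of [B]. *)
Lemma top_data_exists : exists phi La t, top_data phi La t.
Proof.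
have L0 : vpick (deg top) != 0 by rewrite vpick0 ndeg_top.
have [f hf] := dual_neq0 L0; set x0 := vpick _ in L0 hf.
have hx0 : x0 \in deg top by apply: memv_pick.
(* A component of [x0] not killed by [f] supplies the degree [t]; composing [f] with its projection
   makes [phi] homogeneous. *)
have [t ht] : exists t, f (co t x0) != 0.
  apply: contrapT => h; case/eqP: hf; rewrite -(ycounit (nyd NB) x0) linear_sum big1 // => s _.
  by apply: contrapT => /eqP hs; apply: h; exists s.
pose phi : dual B := linfun (fun x : B => f (co t (pr top x)) / f (co t x0) : k^o).
have phiE x : phi x = f (co t (pr top x)) / f (co t x0) by rewrite linfunE //; lint.
have hphi1 : phi x0 = 1 by rewrite phiE (pr_id _ hx0) eqxx divff.
have hpr x : phi (pr top x) = phi x by rewrite !phiE pr_idem.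
have hco s x : phi (co s x) = if s == t then phi x else 0.
  by rewrite !phiE pr_co ycoassoc; case: eqP => [->|_] //; rewrite linear0 mul0r.
have hnd := phi_nondeg hphi1 hpr hco.
exists phi, x0, t; split=> // x hx; apply/eqP; rewrite -subr_eq0; apply/eqP; apply: hnd => c.
set w := x - _; have hw : w \in deg top by rewrite memvB ?memvZ.
have hw0 : phi w = 0.
  by rewrite linearB linearZ /= hphi1 [_ *: (1 : k^o)]/GRing.scale /= mulr1 subrr.
rewrite -(pr_sum c) mulr_suml linear_sum big1 // => -[[|i] hi] _ /=.
  by rewrite pr0E -scalerAl mul1r linearZ /= hw0 [_ *: (0 : k^o)]scaler0.
have := nmul_deg (pr_mem i.+1 c) hw; rewrite ndeg_gt ?memv0 => [/eqP ->|]; first by rewrite linear0.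
by rewrite addSn ltnS leq_addl.
Qed.

(** * Modules over the double *)

Lemma DD_ind (P : DD -> Prop) : subspace P -> (forall x g f, P (bD x ** gD g ** fD f)) ->
  forall d, P d.
Proof.
move=> hP h; have [p0 pl] := hP; apply: tens_ind => // a f; rewrite (boson_sum a).
rewrite (lin_sumr (f := fun a => a \ot f)); last by lint.
by apply: subspace_sum => // g _; rewrite -(bD_gD_fD).
Qed.

Lemma deg1_iota v : v \in deg 1 -> exists u, v = niota NB u.
Proof. by rewrite -(niota_deg1 NB) => /memv_imgP [u _ ->]; exists u. Qed.

Lemma iota_deg1 u : niota NB u \in deg 1.
Proof. by rewrite -(niota_deg1 NB) memv_img ?memvf. Qed.

Section OneModule.
Variables (N : lmodType k) (a : DD -> N -> N).
Hypothesis hN : is_module (DD_hopf NB) a.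

Lemma md_linz x : lin (fun d => a d x).
Proof. by case: hN => h _ _ _ c d e; apply: h. Qed.

Lemma md_lin d : lin (a d).
Proof. by case: hN => _ h _ _ c x y; apply: h. Qed.

Lemma md1 x : a (hone (DD_hopf NB)) x = x.
Proof. by case: hN. Qed.

Lemma mdM d e x : a (d ** e) x = a d (a e x).
Proof. by case: hN => _ _ _ h; apply: h. Qed.

Lemma md_dgmod : dgmod (fun z => a (DG_DD NB z)) (fun g => a (gD g)) (fun h => a (wD h)).
Proof.
split.
- by move=> x; apply: (lin_comp (md_linz x)); apply: lin_DG_DD.
- by move=> g; apply: md_lin.
- by move=> h; apply: md_lin.
- by move=> g h x; rewrite DG_DD_gelt mdM.
- exact: md1.
- by move=> g h x; rewrite -gDM mdM.
- move=> h h' x; rewrite -mdM wDM; case: eqP => // _.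
  exact: lin0 (md_linz x).
- by move=> x; rewrite -(lin_sumr _ _ _ (md_linz x)) wD_sum md1.
- by move=> h g x; rewrite -!mdM wD_gD.
Qed.

Lemma md_submod (P : N -> Prop) : subspace P -> (forall g x, P x -> P (a (gD g) x)) ->
  (forall f x, P x -> P (a (fD f) x)) -> (forall v x, v \in deg 1 -> P x -> P (a (bD v) x)) ->
  is_submodule a P.
Proof.
move=> hP hg hf hv; have [p0 pl] := hP; split=> // d x Px.
have lb : lin bD by apply: lin_bD; apply: lin_id.
have hb y z : P z -> P (a (bD y) z).
  have hs : subspace (fun y => forall z, P z -> P (a (bD y) z)).
    split=> [u Pu|c u w hu hw v Pv]; first by rewrite (lin0 lb) (lin0 (md_linz u)).
    by rewrite lb md_linz; apply: pl; [apply: hu|apply: hw].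
  have [X hX] := subspace_vspace hs.
  suff /subvP/(_ y (memvf y))/hX : (fullv <= X)%VS by apply.
  rewrite -(ngen NB); apply: agenv_sub_modl.
    by apply/subvP => u /vlineP [c ->]; apply/hX => w Pw; rewrite (linZ _ _ lb) (linZ _ _ (md_linz w)) bD1 md1; apply: subspaceZ.
  apply/prodvP => u w hu /hX hw; apply/hX => v Pv; rewrite -bDM mdM; apply: hv => //; exact: hw.
move: d; apply: DD_ind => [|y g f]; last by rewrite !mdM; apply/hb/hg/hf.
by split=> [|c d e hd he]; rewrite ?(lin0 (md_linz x)) ?md_linz //; apply: pl.
Qed.

Lemma bD_wD s v h : co s v = v -> bD v ** wD h = wD (s * h) ** bD v.
Proof.
move=> hs; rewrite wD_bD -{2}hs (bigD1 s) //= big1 => [|r hr].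
  by rewrite addr0 hs mulKg hs.
rewrite ycoassoc eq_sym (negbTE hr) (lin0 (f := bD)) ?(lin0 (f := fun z => z ** _)) //; lint.
Qed.

Definition v_killed (x : N) := forall v, a (V_DD NB v) x = 0.

Lemma v_killedP x : v_killed x <-> forall v, v \in deg 1 -> a (bD v) x = 0.
Proof.
split=> [h v /deg1_iota [u ->]|h u]; first exact: h.
by apply: h; apply: iota_deg1.
Qed.

Lemma v_killed_submod : is_submodule (fun z => a (DG_DD NB z)) v_killed.
Proof.
apply/(dg_submodP md_dgmod); split.
- split=> [v|c x y hx hy v]; first exact: lin0 (md_lin _).
  by rewrite md_lin hx hy scaler0 addr0.
- move=> g x /v_killedP hx; apply/v_killedP => v hv.
  have e : bD v ** gD g = gD g ** bD (act g^-1%g v) by rewrite gD_bD -yactM mulgV yact1.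
  by rewrite -mdM e mdM hx ?(lin0 (md_lin _)) //; apply: nact_deg.
move=> h x /v_killedP hx; apply/v_killedP => v hv.
rewrite -(ycounit (nyd NB) v) (lin_sumr (f := bD)); last by lint.
rewrite (lin_sumr _ _ _ (md_linz _)) big1 // => s _.
rewrite -mdM (bD_wD (s := s)) ?mdM; last by rewrite ycoassoc eqxx.
by rewrite hx ?(lin0 (md_lin _)) //; apply: ncoact_deg.
Qed.

(** Take the largest n such that B^n does not annihilate [P]: every vector of the form b x, with b
    in B^n, is killed by all elements of positive degree. *)
Lemma v_killed_exists (P : N -> Prop) : is_submodule a P -> (exists2 x, P x & x != 0) ->
  exists x, [/\ P x, x != 0, v_killed x & forall b, a (bD b) x = (eB b : k) *: x].
Proof.
move=> [p0 pl pa] [x0 Px0 nx0].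
pose q n := `[< exists b x, [/\ b \in deg n, P x & a (bD b) x != 0] >].
have q0 : exists n, q n.
  exists 0%N; apply/asboolP; exists 1, x0; rewrite one_deg0; split=> //.
  by rewrite bD1 md1.
have qb n : q n -> (n <= top)%N.
  move=> /asboolP [b [x [hb _ nb]]]; rewrite leqNgt; apply/negP => hn; case/eqP: nb.
  move: hb; rewrite (ndeg_gt hn) memv0 => /eqP ->.
  by rewrite (lin0 (f := bD)) ?(lin0 (md_linz x)) //; lint.
case: (ex_maxnP q0 qb) => n /asboolP [b [x [hb Px nb]]] hmax.
have kill i c : (0 < i)%N -> c \in deg i -> a (bD c) (a (bD b) x) = 0.
  move=> hi hc; apply: contrapT => /eqP hn.
  have /hmax : q (i + n)%N.
    apply/asboolP; exists (c * b), x; split=> //; first exact: nmul_deg.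
    by rewrite -bDM mdM.
  by rewrite leqNgt -{1}[n]add0n ltn_add2r hi.
exists (a (bD b) x); split=> //; first exact: pa.
  by apply/v_killedP => v; apply: kill.
set w := a (bD b) x; move=> c; move: c; apply: B_graded.
  have l1 : lin (fun c => a (bD c) w) by apply: (lin_comp (md_linz w)); apply: lin_bD; apply: lin_id.
  split=> [|c u v hu hv]; first by rewrite (lin0 l1) linear0 scale0r.
  by rewrite l1 hu hv linearP /= scalerDl scalerA.
move=> [|i] c hc; last by rewrite (kill i.+1) // (ncounit_deg _ hc) // scale0r.
rewrite {1}(deg0E hc) (linZ (f := bD)); last by lint.
by rewrite (linZ _ _ (md_linz w)) bD1 md1.
Qed.

(* The functionals on B # kG vanishing on kG span a nilpotent ideal J of D>=0
   over D(G); aug_span 1 P is J P. *)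
Definition vanish_below (n : nat) (f : dual boson) :=
  forall i b g, b \in deg i -> (i < n)%N -> f (b # g) = 0.

Definition aug_span (n : nat) (P : N -> Prop) (x : N) :=
  forall R : N -> Prop, subspace R -> (forall f y, vanish_below n f -> P y -> R (a (fD f) y)) -> R x.

Lemma aug_span_subspace n P : subspace (aug_span n P).
Proof.
split=> [R hR _|c x y hx hy R hR h]; first by case: hR.
by apply: hR.2; [apply: (hx R)|apply: (hy R)].
Qed.

(** The coproduct is graded, so orders of vanishing add up; hence products of more than [top]
    elements of J are 0. *)
Lemma vanish_below_mul m n f f' : vanish_below m f -> vanish_below n f' -> vanish_below (m + n) (dmul HB f f').
Proof.
move=> hf hf' i b g hb hi; rewrite (dmulE HA) smash_comul tlift_map.
have hP := subspace_tlift_eq (fun x1 x2 => tlift (\sum_s ((x1 # (s * g)%g) \ot (co s x2 # g)))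
   (fun a b => (f a * f' b : k^o))) (@subspace0 k k^o).
apply: (ncomul_ind hP hb) => j u w hj hu hw.
rewrite tlift_pure; last by blint.
rewrite tlift_suml big1 // => s _; rewrite tlift_pure; last by blint.
have [hjm|hjm] := ltnP j m; first by rewrite (hf _ _ _ hu) ?mul0r.
rewrite (hf' _ _ _ (ncoact_deg s hw)) ?mulr0 //.
by rewrite ltn_subLR // ; apply: leq_trans hi _; rewrite leq_add2r.
Qed.

(** Nakayama for the nilpotent J: if P is contained in J P, it is contained in J^(top+1) P = 0. *)
Lemma aug_span_nil (P : N -> Prop) : (forall x, P x -> aug_span 1 P x) -> forall x, P x -> x = 0.
Proof.
move=> h1 x Px.
have hn n : forall y, P y -> aug_span n.+1 P y.
  elim: n => [|n IH] y Py; first exact: h1.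
  move=> R hR hRg; apply: (IH y Py) => // f z Kf Pz.
  apply: (h1 z Pz (fun z => R (a (fD f) z))) => [|f' y' Kf' Py'].
    split=> [|c u v hu hv]; first by rewrite (lin0 (md_lin _)); case: hR.
    by rewrite md_lin; apply: hR.2.
  rewrite -mdM fDM; apply: hRg => //.
  by have := vanish_below_mul Kf' Kf; rewrite add1n.
apply: (hn top x Px (fun x => x = 0)); first exact: subspace0.
move=> f y Kf Py; have -> : f = 0.
  apply/lfunP => b; move: b; apply: (boson_eq (X := k^o)) => [||b g]; [exact: linP|exact: linP|].
  rewrite lfunE /= -(pr_sum b) (lin_sumr (f := fun b => b # g)); last by lint.
  by rewrite linear_sum big1 // => i _; apply: (Kf i); [exact: pr_mem|exact: ltn_ord].
rewrite (lin0 (f := fD)) ?(lin0 (md_linz y)) //; lint.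
Qed.

Lemma vanish_below_conj g f : vanish_below 1 f -> vanish_below 1 (conj_dual g f).
Proof.
move=> hf [|//] b s hb _; rewrite conj_dualE !smashM mul1r nact_one mulr1.
by apply: (hf 0%N) => //; apply: nact_deg.
Qed.

Lemma conj_dualK g f : conj_dual g (conj_dual g^-1%g f) = f.
Proof.
apply/lfunP => x; rewrite !conj_dualE; congr (f _); rewrite invgK.
rewrite !(ha_mulA HA) smashM mulVg mul1r nact_one -(ha_mulA HA) smashM mulVg mul1r nact_one.
by rewrite -[1 # 1%g]/(hone HB) (ha_mul1 HA) (ha_1mul HA).
Qed.

(** * Submodules generated by vectors killed by V *)

Section Generated.
Variable P : N -> Prop.
Hypothesis hP : is_submodule a P.

Lemma aug_span_g g x : aug_span 1 P x -> aug_span 1 P (a (gD g) x).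
Proof.
move=> hx R hR hRg; apply: (hx (fun x => R (a (gD g) x))) => [|f y Kf Py].
  split=> [|c u v hu hv]; first by rewrite (lin0 (md_lin _)); case: hR.
  by rewrite md_lin; apply: hR.2.
rewrite -mdM -{1}(conj_dualK g f) -fD_gD mdM; apply: hRg; first exact: vanish_below_conj.
by case: hP => _ _; apply.
Qed.

Lemma aug_span_f f x : aug_span 1 P x -> aug_span 1 P (a (fD f) x).
Proof.
move=> hx R hR hRg; apply: (hx (fun x => R (a (fD f) x))) => [|f' y Kf' Py].
  split=> [|c u v hu hv]; first by rewrite (lin0 (md_lin _)); case: hR.
  by rewrite md_lin; apply: hR.2.
rewrite -mdM fDM; apply: hRg => //.
have hf0 : vanish_below 0 f by [].
by have := vanish_below_mul Kf' hf0; rewrite addn0.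
Qed.

Section WithM.
Variable M : N -> Prop.
Hypothesis hM : is_submodule (fun z => a (DG_DD NB z)) M.
Hypothesis MP : forall x, M x -> P x.
Hypothesis VM : forall x, M x -> v_killed x.

Let Q1 x := forall R, subspace R -> (forall g x, R x -> R (a (gD g) x)) ->
  (forall f x, R x -> R (a (fD f) x)) -> (forall x, M x -> R x) -> R x.

Let Q1_subspace : subspace Q1.
Proof.
split=> [R hR _ _ _|c x y hx hy R hR hg hf hm]; first by case: hR.
by apply: hR.2; [apply: (hx R)|apply: (hy R)].
Qed.

Let Q1_g g x : Q1 x -> Q1 (a (gD g) x).
Proof. by move=> hx R hR hg hf hm; exact: (hg _ _ (hx R hR hg hf hm)). Qed.

Let Q1_f f x : Q1 x -> Q1 (a (fD f) x).
Proof. by move=> hx R hR hg hf hm; exact: (hf _ _ (hx R hR hg hf hm)). Qed.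

(* D>=0 M is stable under V, as V D>=0 is contained in D>=0 + D>=0 V. *)
Let Q1_submod : is_submodule a Q1.
Proof.
apply: md_submod => // v x hv.
suff h : Q1 x -> forall s v, v \in deg 1 -> co s v = v -> Q1 (a (bD v) x).
  move=> /h hx; rewrite -(ycounit (nyd NB) v) (lin_sumr (f := bD)); last by lint.
  rewrite (lin_sumr _ _ _ (md_linz _)); apply: subspace_sum => // s _.
  by apply: (hx s); [apply: ncoact_deg|rewrite ycoassoc eqxx].
(* Membership in [Q1] is carried through the induction because the commutation rule also produces
   terms without [v]. *)
move=> hx; suff [] : Q1 x /\ forall s v, v \in deg 1 -> co s v = v -> Q1 (a (bD v) x) by [].
apply: (hx (fun x => Q1 x /\ forall s v, v \in deg 1 -> co s v = v -> Q1 (a (bD v) x))).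
- have [q0 ql] := Q1_subspace.
  split=> [|c y z [hy hy'] [hz hz']].
    by split=> // s w hw hs; rewrite (lin0 (md_lin _)).
  by split=> [|s w hw hs]; rewrite ?md_lin; apply: ql => //; [apply: (hy' s)|apply: (hz' s)].
- move=> g y [hy hy']; split=> [|s w hw hs]; first exact: Q1_g.
  have e : bD w ** gD g = gD g ** bD (act g^-1%g w) by rewrite gD_bD -yactM mulgV yact1.
  rewrite -mdM e mdM; apply: Q1_g; apply: (hy' (g^-1 * s * g^-1^-1)%g); first exact: nact_deg.
  by rewrite ycompat hs.
- move=> f y [hy hy']; split=> [|s w hw hs]; first exact: Q1_f.
  (* The rule [fD_b1] is solved for v f: [f0] is chosen so that its [f2] is [f]. *)
  pose f0 : dual boson := linfun (fun x : boson => f (hmul HB (1 # s^-1%g) x) : k^o).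
  have [f1 [f2 [e ef2]]] := fD_b1 f0 hw hs.
  have ef : f2 = f.
    apply/lfunP => z; rewrite ef2 !linfunE; try by lint.
    rewrite (ha_mulA HA) smashM mulVg mul1r nact_one -[1 # 1%g]/(hone HB).
    by rewrite (ha_1mul HA).
  rewrite ef in e.
  have -> : a (bD w) (a (fD f) y) = a (fD f0) (a (bD w) y) - a (fD f1) y -
     a (gD s) (a (fD (linfun (fun x : boson => f0 (hmul HB (hmul HB (1 # s) x) (hanti HB (w # 1%g))) : k^o))) y).
    rewrite -!mdM e !(linD _ _ (md_linz y)).
    by rewrite addrAC addrK addrAC subrr add0r.
  apply: (subspaceB (P := Q1) Q1_subspace); last exact: Q1_g (Q1_f _ hy).
  apply: (subspaceB (P := Q1) Q1_subspace); [exact: Q1_f (hy' s w hw hs)|exact: Q1_f hy].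
- move=> y My; split=> [R hR _ _ hm|s w hw _]; first exact: hm.
  by rewrite ((v_killedP y).1 (VM My)) //; case: Q1_subspace.
Qed.

(** Modulo J every functional acts through D(G), which preserves [M]. The submodule [P] may be
    larger than the one generated by [M], as happens in the product used for [lw_unique]. *)
Lemma generated_split x : (forall Q, is_submodule a Q -> (forall x, M x -> Q x) -> Q x) ->
  exists2 m, M m & aug_span 1 P (x - m).
Proof.
move=> hx; have {hx} hx : Q1 x by apply: hx => // m Mm R _ _ _; apply.
have [m0 ml _] := hM; have [hMs hMg hMw] := (dg_submodP md_dgmod M).1 hM.
have hJ := aug_span_subspace 1 P; have [j0 jl] := hJ.
apply: (hx (fun x => exists2 m, M m & aug_span 1 P (x - m))).
- split=> [|c y z [m Mm hm] [m' Mm' hm']]; first by exists 0; rewrite ?subr0.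
  exists (c *: m + m'); first exact: ml.
  by rewrite opprD addrACA -scalerBr; apply: jl.
- move=> g y [m Mm hm]; exists (a (gD g) m); first exact: hMg.
  by rewrite -(linB _ _ (md_lin _)); apply: aug_span_g.
- move=> f y [m Mm hm].
  (* [f0] is a combination of the delta_h agreeing with [f] on kG, so it acts through D(G) while
     [f - f0] lies in J. *)
  pose f0 : dual boson := \sum_h (f (1 # h) : k) *: deltaB h.
  have e0 : a (fD f0) m = \sum_h (f (1 # h) : k) *: a (wD h) m.
    rewrite (lin_sumr (f := fD)); last by lint.
    rewrite (lin_sumr _ _ _ (md_linz m)); apply: eq_bigr => h _.
    rewrite (linZ (f := fD)) ?(linZ _ _ (md_linz m)) //; lint.
  exists (a (fD f0) m).
    by rewrite e0; apply: subspace_sum => // h _; apply: subspaceZ => //; apply: hMw.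
  have -> : a (fD f) y - a (fD f0) m = a (fD f) (y - m) + a (fD (f - f0)) m.
    rewrite (linB _ _ (md_lin _)) (linB (f := fD)); last by lint.
    by rewrite (linB _ _ (md_linz m)) addrA subrK.
  apply: (subspaceD (P := aug_span 1 P)) => //; first exact: aug_span_f.
  move=> R hR; apply; last exact: MP.
  move=> [|//] b s /deg0E -> _.
  rewrite (linZ (f := fun b => b # s)); last by lint.
  rewrite linearZ /= (_ : (f - f0) (1 # s) = 0) ?[_ *: (0 : k^o)]scaler0 //.
  rewrite add_lfunE opp_lfunE sum_lfunE.
  rewrite (bigD1 s) //= big1 => [|h hh]; rewrite scale_lfunE deltaBE smashE.
    by rewrite eqxx ncounit_one addr0 [_ *: (1 : k^o)]/GRing.scale /= mulr1 subrr.
  by rewrite (negbTE hh) linear0 scaler0.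
by move=> m Mm; exists m; rewrite ?subrr.
Qed.

End WithM.
End Generated.
End OneModule.

(** * Lowest-weight modules *)

Record lw_gen (N : lmodType k) (a : DD -> N -> N) (M P : N -> Prop) : Prop := LwGen {
  lw_sub : forall x, M x -> P x;
  lw_simple : is_simple (fun z => a (DG_DD NB z)) M;
  lw_kill : forall x, M x -> v_killed a x;
  lw_min : forall Q, is_submodule a Q -> (forall x, M x -> Q x) -> forall x, P x -> Q x }.

(** The intersection of [M] with J P is a D(G)-submodule of the simple [M]. If it were [M], then P =
    M + J P = J P, and P = 0 by nilpotency. *)
Lemma lw_cap (N : lmodType k) (a : DD -> N -> N) M P : is_module (DD_hopf NB) a ->
  is_submodule a P -> lw_gen a M P -> forall m, M m -> aug_span a 1 P m -> m = 0.
Proof.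
move=> hN hP [MP [hM [x0 Mx0 nx0] hs] VM Mmin].
have [m0 ml ma] := hM; have [_ hMg hMw] := (dg_submodP (md_dgmod hN) M).1 hM.
have hJ := aug_span_subspace a 1 P; have [j0 jl] := hJ.
case: (hs (fun m => M m /\ aug_span a 1 P m)) => [|m [] //|h m Mm Jm|h].
- apply/(dg_submodP (md_dgmod hN)); split.
  + by split=> [|c x y [Mx Jx] [My Jy]]; split=> //; [apply: ml|apply: jl].
  + by move=> g x [Mx Jx]; split; [apply: hMg|apply: aug_span_g].
  + by move=> h x [Mx Jx]; split; [apply: hMw|apply: aug_span_f].
- by apply: h.
have nil := aug_span_nil hN (P := P).
case/eqP: nx0; apply: nil (MP _ Mx0) => x Px.
have [|m Mm Jx] := generated_split hN hP hM MP VM (x := x).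
  by move=> Q hQ MQ; apply: Mmin.
by rewrite -(subrK m x); apply: (subspaceD (P := aug_span a 1 P) hJ Jx); apply: (h m Mm).2.
Qed.

Lemma lw_split (N : lmodType k) (a : DD -> N -> N) M P x : is_module (DD_hopf NB) a ->
  is_submodule a P -> lw_gen a M P -> P x -> exists2 m, M m & aug_span a 1 P (x - m).
Proof.
move=> hN hP [MP [hM _ _] VM Mmin] Px; apply: (generated_split hN hP hM MP VM) => Q hQ MQ.
exact: Mmin.
Qed.

(** [M] and [M'] are both complements of J P in [P], so projection along J P, which is D(G)-stable,
    maps one isomorphically onto the other. *)
Lemma lw_weight_unique (N : lmodType k) (a : DD -> N -> N) M M' P :
  is_module (DD_hopf NB) a -> is_submodule a P -> lw_gen a M P -> lw_gen a M' P ->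
  mod_iso (fun z => a (DG_DD NB z)) M (fun z => a (DG_DD NB z)) M'.
Proof.
move=> hN hP hM hM'; have cap := lw_cap hN hP hM; have cap' := lw_cap hN hP hM'.
have hJ := aug_span_subspace a 1 P.
have [[m0 ml ma] _ _] := lw_simple hM; have [[m0' ml' ma'] _ _] := lw_simple hM'.
have [g hg] : exists g : N -> N, forall x, M x -> M' (g x) /\ aug_span a 1 P (x - g x).
  have h x : exists y, M x -> M' y /\ aug_span a 1 P (x - y).
    have [/(lw_sub hM) Px|nM] := pselect (M x); last by exists 0.
    by have [m Mm Jm] := lw_split hN hP hM' Px; exists m.
  by have [g hg] := choice h; exists g.
have subM y z : M' y -> M' z -> M' (y - z).
  by move=> My Mz; rewrite addrC -scaleN1r; apply: ml'.
have uniq x y : M x -> M' y -> aug_span a 1 P (x - y) -> g x = y.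
  move=> Mx My Jy; have [Mg Jg] := hg x Mx.
  apply/eqP; rewrite -subr_eq0; apply/eqP; apply: cap'; first exact: subM.
  have -> : g x - y = (x - y) - (x - g x) by rewrite opprB [RHS]addrC addrA subrK.
  exact: (subspaceB (P := aug_span a 1 P) hJ).
have [_ _ dgJ] : is_submodule (fun z => a (DG_DD NB z)) (aug_span a 1 P).
  apply/(dg_submodP (md_dgmod hN)); split=> // s x; first exact: aug_span_g.
  exact: aug_span_f.
exists g; split.
- move=> c x y Mx My; have [Mgx Jx] := hg x Mx; have [Mgy Jy] := hg y My.
  apply: uniq; [exact: ml|exact: ml'|].
  by rewrite opprD addrACA -scalerBr; apply: hJ.2.
- move=> z x Mx; have [Mgx Jx] := hg x Mx; apply: uniq; [exact: ma|exact: ma'|].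
  by rewrite -(linB _ _ (md_lin hN _)); apply: dgJ.
- by move=> x /hg [].
- move=> x y Mx My e; have [Mgx Jx] := hg x Mx; have [Mgy Jy] := hg y My.
  apply/eqP; rewrite -subr_eq0; apply/eqP; apply: cap.
    by rewrite addrC -scaleN1r; apply: ml.
  have -> : x - y = (x - g x) - (y - g y) by rewrite e opprB addrA subrK.
  exact: (subspaceB (P := aug_span a 1 P) hJ).
move=> y My; have [m Mm Jm] := lw_split hN hP hM (lw_sub hM' My).
exists m => //; apply: uniq => //.
by rewrite -opprB -scaleN1r; apply: (subspaceZ (P := aug_span a 1 P)).
Qed.

(* Goursat: the submodule of N1 x N2 generated by the graph of M1 ~ M2 is the graph
   of an isomorphism. *)
Lemma lw_unique (N1 N2 : lmodType k) (a1 : DD -> N1 -> N1) (a2 : DD -> N2 -> N2) M1 M2 P1 P2 :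
  is_module (DD_hopf NB) a1 -> is_module (DD_hopf NB) a2 ->
  is_simple a1 P1 -> is_simple a2 P2 -> lw_gen a1 M1 P1 -> lw_gen a2 M2 P2 ->
  mod_iso (fun z => a1 (DG_DD NB z)) M1 (fun z => a2 (DG_DD NB z)) M2 ->
  mod_iso a1 P1 a2 P2.
Proof.
move=> hN1 hN2 [hP1 [x1 Px1 nx1] s1] [hP2 [x2 Px2 nx2] s2] hM1 hM2 [th [t1 t2 t3 t4 t5]].
pose N := (N1 * N2)%type : lmodType k.
pose a d (x : N) : N := (a1 d x.1, a2 d x.2).
have hN : is_module (DD_hopf NB) a.
  split.
  - by move=> c d e [x y]; rewrite /a /= (md_linz hN1) (md_linz hN2).
  - by move=> c d [x y] [x' y']; rewrite /a /= (md_lin hN1) (md_lin hN2).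
  - by move=> [x y]; rewrite /a /= (md1 hN1) (md1 hN2).
  - by move=> d e [x y]; rewrite /a /= (mdM hN1) (mdM hN2).
have [p10 p1l p1a] := hP1; have [p20 p2l p2a] := hP2.
have [[m10 m1l m1a] [y1 My1 ny1] s1'] := lw_simple hM1.
pose P (x : N) := P1 x.1 /\ P2 x.2.
have hP : is_submodule a P.
  split=> [|c x y [h1 h2] [h3 h4]|d x [h1 h2]]; first by split.
    by split; [apply: p1l|apply: p2l].
  by split; [apply: p1a|apply: p2a].
pose M (x : N) := M1 x.1 /\ x.2 = th x.1.
have th0 : th 0 = 0.
  by have := t1 (-1) 0 0 m10 m10; rewrite scaler0 addr0 scaleN1r addNr.
have hM : is_submodule (fun z => a (DG_DD NB z)) M.
  split=> [|c x y [h1 h2] [h3 h4]|d x [h1 h2]]; first by split.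
    by split=> /=; [apply: m1l|rewrite t1 // -h2 -h4].
  by split=> /=; [apply: m1a|rewrite t2 // -h2].
have MP x : M x -> P x.
  by move=> [h1 h2]; split; [apply: lw_sub hM1 _ h1|rewrite h2; apply/(lw_sub hM2)/t3].
have VM x : M x -> v_killed a x.
  move=> [h1 h2] v; rewrite /a (lw_kill hM1 h1) h2 (lw_kill hM2) //; exact: t3.
pose Ga (x : N) := forall Q, is_submodule a Q -> (forall x, M x -> Q x) -> Q x.
have [g0 gl ga] : is_submodule a Ga.
  split=> [Q [q0 _ _] _|c x y hx hy Q hQ MQ|d x hx Q hQ MQ] //.
    by case: (hQ) => _ ql _; apply: ql; [apply: hx|apply: hy].
  by case: (hQ) => _ _; apply; apply: hx.
have GaM x : M x -> Ga x by move=> Mx Q _; apply.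
have GaP x : Ga x -> P x by apply.
have split_Ga x : Ga x -> exists2 m, M m & aug_span a 1 P (x - m).
  by move=> hx; apply: (generated_split hN hP hM MP VM).
have J1 x : aug_span a 1 P x -> aug_span a1 1 P1 x.1.
  move=> hx R hR hRg; apply: (hx (fun x => R x.1)) => [|f y Kf [Py _]]; last exact: hRg.
  by case: hR => r0 rl; split=> // c u v; apply: rl.
have J2 x : aug_span a 1 P x -> aug_span a2 1 P2 x.2.
  move=> hx R hR hRg; apply: (hx (fun x => R x.2)) => [|f y Kf [_ Py]]; last exact: hRg.
  by case: hR => r0 rl; split=> // c u v; apply: rl.
have dom x : P1 x -> exists y, Ga (x, y).
  move: x; apply: (lw_min hM1) => [|x Mx]; last by exists (th x); apply: GaM.
  split=> [|c x y [x' hx] [y' hy]|d x [x' hx]]; first by exists 0.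
    by exists (c *: x' + y'); apply: (gl c (x, x') (y, y')).
  by exists (a2 d x'); apply: (ga d (x, x')).
have cod y : P2 y -> exists x, Ga (x, y).
  move: y; apply: (lw_min hM2) => [|y /t5 [x Mx <-]]; last by exists x; apply: GaM.
  split=> [|c x y [x' hx] [y' hy]|d x [x' hx]]; first by exists 0.
    by exists (c *: x' + y'); apply: (gl c (x', x) (y', y)).
  by exists (a1 d x'); apply: (ga d (x', x)).
(* These [y] form a submodule of the simple [P2]. Were it all of [P2], splitting (0, z) as (m, th m)
   plus an element of J P would put m in J P1, so m = 0 by [lw_cap], and then P2 = J P2 = 0. *)
have Ga2 y : Ga (0, y) -> y = 0.
  case: (s2 (fun y => Ga (0, y))) => [|{}y /GaP [] //|h|h].
  - split=> // [c u v hu hv|d u hu].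
      by have := gl c _ _ hu hv; rewrite /GRing.add /= /add_pair /= scaler0 addr0.
    by have := ga d _ hu; rewrite /a /= (lin0 (md_lin hN1 d)).
  - exact: h.
  case/eqP: nx2; apply: (aug_span_nil hN2 (P := P2)) => // z Pz.
  have [[m m'] [Mm em] Jm] := split_Ga _ (h z Pz).
  have m_0 : m = 0.
    apply: (lw_cap hN1 hP1 hM1) => //; have /= := J1 _ Jm; rewrite sub0r => Jn.
    by rewrite -[m]opprK -scaleN1r; apply: (subspaceZ (P := aug_span a1 1 P1)) => //; exact: aug_span_subspace.
  have /= := J2 _ Jm; move: em; rewrite /= m_0 th0 => ->; by rewrite subr0.
have Ga1 x : Ga (x, 0) -> x = 0.
  case: (s1 (fun x => Ga (x, 0))) => [|{}x /GaP [] //|h|h].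
  - split=> // [c u v hu hv|d u hu].
      by have := gl c _ _ hu hv; rewrite /GRing.add /= /add_pair /= scaler0 addr0.
    by have := ga d _ hu; rewrite /a /= (lin0 (md_lin hN2 d)).
  - exact: h.
  case/eqP: nx1; apply: (aug_span_nil hN1 (P := P1)) => // z Pz.
  have [[m m'] [Mm em] Jm] := split_Ga _ (h z Pz).
  have m_0 : th m = 0.
    apply: (lw_cap hN2 hP2 hM2); first exact: t3.
    have /= := J2 _ Jm; move: em => /= ->; rewrite sub0r => Jn.
    by rewrite -[th m]opprK -scaleN1r; apply: (subspaceZ (P := aug_span a2 1 P2)) => //; exact: aug_span_subspace.
  have m0' : m = 0 by apply: t4 => //; rewrite m_0 th0.
  by have /= := J1 _ Jm; rewrite m0' subr0.
have [f hf] : exists f : N1 -> N2, forall x, P1 x -> Ga (x, f x).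
  have h x : exists y, P1 x -> Ga (x, y).
    by have [/dom [y hy]|n] := pselect (P1 x); [exists y|exists 0].
  by have [f hf] := choice h; exists f.
have GaB x y x' y' : Ga (x, y) -> Ga (x', y') -> Ga (x - x', y - y').
  by move=> h h'; have := gl (-1) _ _ h' h; rewrite scaleN1r addrC.
have uniq x y : P1 x -> Ga (x, y) -> f x = y.
  move=> Px h; apply/eqP; rewrite -subr_eq0; apply/eqP; apply: Ga2.
  by have := GaB _ _ _ _ (hf x Px) h; rewrite subrr.
exists f; split.
- by move=> c x y Px Py; apply: uniq; [apply: p1l|apply: (gl c (x, f x) (y, f y)); apply: hf].
- by move=> d x Px; apply: uniq; [apply: p1a|apply: (ga d (x, f x)); apply: hf].
- by move=> x /hf /GaP [].
- move=> x y Px Py e; apply/eqP; rewrite -subr_eq0; apply/eqP; apply: Ga1.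
  by have := GaB _ _ _ _ (hf x Px) (hf y Py); rewrite e subrr.
move=> y /cod [x hx]; have [Px _] := GaP _ hx.
by exists x => //; apply: uniq.
Qed.

(** * Verma modules and their socles *)

Section Verma.
Local Notation dkG f := (f \o linfun (@kG_boson k gT B) : dual (kG k gT))%VF.
Variables (g0 : gT) (n : nat) (rho : mx_representation k 'C[g0] n).
Local Notation Mg := (Mg rho).
Local Notation Mact := (Mg_act rho).
Local Notation verma := (verma NB rho).
Local Notation vact := (verma_act NB rho).

Let hM := Mg_dgmod rho.

Lemma dd_bilin : bilin (hmul (DD_hopf NB)).
Proof. by split=> d; [apply: lin_dml; apply: lin_id|apply: lin_dmr; apply: lin_id]. Qed.

Let dd_assoc := double_mulA HA.

Definition ge0_act (d : DD) (m : Mg) : Mg := Mact (DD_DG NB d) m.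

(* The component of d along the functional beta on B. *)
Definition qD (beta : dual B) (d : DD) : DG k gT :=
  \sw_(t, f <- d) (([ffun g => beta (t g)] : kG k gT) \ot dkG f).

Lemma lin_qD beta : lin (qD beta).
Proof. by apply: lin_tlift; apply: lin_id. Qed.

Lemma lin_dkG : lin (fun f : dual boson => dkG f).
Proof. by move=> c x y; apply/lfunP => z; rewrite !(comp_lfunE, add_lfunE, scale_lfunE). Qed.

Lemma dkGE f (a : kG k gT) : dkG f a = f (kG_boson B a).
Proof. by rewrite comp_lfunE linfunE //; lint. Qed.

Lemma qD_pure beta x g f : qD beta (bD x ** gD g ** fD f) = (beta x : k) *: (gelt k g \ot dkG f).
Proof.
rewrite bD_gD_fD /qD tlift_pure; last first.
  split=> [h|t]; last by apply: lin_tpurer; apply: lin_dkG.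
  by apply: lin_tpurel => c a b; apply/ffunP => s; rewrite !ffunE linearP.
have -> : [ffun s => beta ((x # g) s)] = (beta x : k) *: gelt k g.
  apply/ffunP => s; rewrite !ffunE.
  by case: eqP; rewrite ?linear0 ?scaler0 // /GRing.scale /= mulr1.
exact: (linZ (f := fun z => z \ot _) _ _ (lin_tpurel _ (@lin_id k _))).
Qed.

Lemma DD_DG_qD d : DD_DG NB d = qD eB d.
Proof. by []. Qed.

Lemma Mact_pure g f (m : Mg) : Mact (gelt k g \ot f) m = Gm g (Mg_fact f m).
Proof.
have lA := dg_linz hM m; have lG := dg_linG hM g.
have lF : lin (fun f => Mg_fact f m).
  move=> c f1 f2; move: m {lA}; apply: mg_eq; [exact: lin_Mg_fact|by apply: lin_add; [apply: lin_scale|]; apply: lin_Mg_fact|].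
  by move=> x u; rewrite !Mg_fact_mg add_lfunE scale_lfunE scalerDl scalerA.
have l1 : lin (fun f => Mact (gelt k g \ot f) m).
  by apply: (lin_comp lA); apply: lin_tpurer; apply: lin_id.
have l2 : lin (fun f => Gm g (Mg_fact f m)) by apply: (lin_comp lG).
have h0 h : Mact (gelt k g \ot gdual k h) m = Gm g (Mg_fact (gdual k h) m) by apply: dg_act hM _ _ _.
rewrite (gdual_sum f) (lin_sumr _ _ _ l1) (lin_sumr _ _ _ l2).
by apply: eq_bigr => h _; rewrite (linZ _ _ l1) (linZ _ _ l2) h0.
Qed.

Lemma ge0_act_lin m : lin (fun d => ge0_act d m).
Proof. by apply: (lin_comp (dg_linz hM m)); apply: lin_qD. Qed.

Lemma ge0_act_gf g f m : ge0_act (gD g ** fD f) m = Gm g (Mg_fact (dkG f) m).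
Proof.
rewrite /ge0_act DD_DG_qD -[gD g](double_1mul HA) -[_ \ot _]/(hone (DD_hopf NB)) -bD1.
by rewrite qD_pure ncounit_one scale1r Mact_pure.
Qed.

Lemma Mg_fact_unit (m : Mg) : Mg_fact (dkG (dunit HB)) m = m.
Proof.
move: m; apply: mg_eq; [exact: lin_Mg_fact|exact: lin_id|] => x u.
by rewrite Mg_fact_mg dkGE kG_boson_gelt (dunitE HA) smash_counit ncounit_one scale1r.
Qed.

Lemma ge0_act_g g m : ge0_act (gD g) m = Gm g m.
Proof.
rewrite -[gD g](double_mul1 HA) -[_ \ot _]/(hone (DD_hopf NB)) -fD_unit ge0_act_gf.
by rewrite Mg_fact_unit.
Qed.

Lemma dkG_deltaB h : dkG (deltaB h) = gdual k h.
Proof.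
apply/lfunP => a; rewrite dkGE deltaBE gdualE ffunE linearZ /= ncounit_one.
by rewrite /GRing.scale /= mulr1.
Qed.

Lemma ge0_act_w h m : ge0_act (wD h) m = Wm h m.
Proof.
have -> : wD h = gD 1 ** wD h by rewrite gD1 (double_1mul HA).
by rewrite ge0_act_gf dkG_deltaB (dg_G1 hM).
Qed.

Definition vcl (d : DD) (m : Mg) : verma := ind_cl (hmul (DD_hopf NB)) (DD_ge0 NB) ge0_act d m.
(* These classes x (x) m exhibit the Verma module as B (x) M(g,rho). *)
Definition vten (x : B) (m : Mg) : verma := vcl (bD x) m.

Lemma vact_cl d e m : vact d (vcl e m) = vcl (d ** e) m.
Proof. exact: (ind_act_cl (DD_ge0 NB) ge0_act dd_bilin dd_assoc). Qed.

Lemma vcl_bal d e m : e \in DD_ge0 NB -> vcl (d ** e) m = vcl d (ge0_act e m).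
Proof. by move=> he; apply: ind_cl_bal. Qed.

Lemma lin_vcll (X : lmodType k) (f : X -> DD) m : lin f -> lin (fun x => vcl (f x) m).
Proof. exact: lin_ind_cll. Qed.
Lemma lin_vclr (X : lmodType k) (f : X -> Mg) d : lin f -> lin (fun x => vcl d (f x)).
Proof. exact: lin_ind_clr. Qed.

Lemma lin_vact d : lin (vact d).
Proof. exact: lin_ind_act. Qed.

(** Since D = B D>=0, the factor g f of a product b g f is absorbed by M(g,rho). *)
Lemma verma_ind (P : verma -> Prop) : subspace P -> (forall x m, P (vten x m)) -> forall w, P w.
Proof.
move=> hP h; apply: ind_ind => // d m; move: d; apply: DD_ind.
  have l : lin (fun d => vcl d m) by apply: lin_vcll; apply: lin_id.
  by split=> [|c d e hd he]; rewrite -/(vcl _ m) ?(lin0 l) ?l; [case: hP|apply: hP.2].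
move=> x g f; rewrite -/(vcl _ m) -dd_assoc vcl_bal ?gD_fD_ge0 //; exact: h.
Qed.

Lemma verma_eq (X : lmodType k) (F F' : verma -> X) : lin F -> lin F' ->
  (forall x m, F (vten x m) = F' (vten x m)) -> forall w, F w = F' w.
Proof.
move=> hF hF' h; apply: verma_ind => //; split=> [|c x y hx hy]; first by rewrite !lin0.
by rewrite hF hF' hx hy.
Qed.

Lemma verma_module : is_module (DD_hopf NB) vact.
Proof.
split.
- by move=> c d e w; exact: (lin_ind_actl dd_bilin (w : induced (hmul (DD_hopf NB)) (DD_ge0 NB) ge0_act)).
- by move=> c d x y; apply: lin_vact.
- move=> w; move: w; apply: verma_eq; [exact: lin_vact|exact: lin_id|] => x m.
  by rewrite vact_cl (double_1mul HA).
- move=> d e w; move: w; apply: verma_eq; [exact: lin_vact|exact: lin_comp (lin_vact d) (lin_vact e)|].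
  by move=> x m; rewrite !vact_cl dd_assoc.
Qed.

Lemma lin_vtenr (X : lmodType k) (f : X -> Mg) x : lin f -> lin (fun z => vten x (f z)).
Proof. exact: lin_vclr. Qed.
Lemma lin_vtenl (X : lmodType k) (f : X -> B) m : lin f -> lin (fun z => vten (f z) m).
Proof. by move=> hf; apply: lin_vcll; apply: lin_bD. Qed.

Lemma vact_b y x m : vact (bD y) (vten x m) = vten (y * x) m.
Proof. by rewrite vact_cl bDM. Qed.

Lemma gD_ge0 g : gD g \in DD_ge0 NB.
Proof. by rewrite -[gD g](double_mul1 HA); apply: gD_fD_ge0. Qed.

Lemma fD_ge0 f : fD f \in DD_ge0 NB.
Proof. by rewrite -[fD f](double_1mul HA); apply: gD_fD_ge0. Qed.

Lemma vact_g g x m : vact (gD g) (vten x m) = vten (act g x) (Gm g m).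
Proof. by rewrite vact_cl gD_bD vcl_bal ?gD_ge0 // ge0_act_g. Qed.

Lemma vact_w h x m : vact (wD h) (vten x m) = \sum_s vten (co s x) (Wm (s^-1 * h)%g m).
Proof.
rewrite vact_cl wD_bD (lin_sumr (f := fun d => vcl d m)); last by apply: lin_vcll; apply: lin_id.
by apply: eq_bigr => s _; rewrite vcl_bal ?fD_ge0 // ge0_act_w.
Qed.

(** In the description of the Verma module as B (x) M(g,rho), this is beta (x) id. *)
Definition Theta (beta : dual B) (w : verma) : Mg := ind_lift (fun d m => Mact (qD beta d) m) w.

Lemma lin_Theta beta : lin (Theta beta).
Proof. exact: lin_ind_lift. Qed.

(** The content is that [qD] is balanced over D>=0, so that the coordinates of x (x) m are well
    defined. It is enough to compare y g f' with s f. *)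
Lemma Theta_vten beta x m : Theta beta (vten x m) = (beta x : k) *: m.
Proof.
have hb : bilin (fun d m => Mact (qD beta d) m).
  split=> [m'|d]; first by apply: (lin_comp (dg_linz hM m')); apply: lin_qD.
  exact: dg_linx hM _.
have lr (y : DD) : lin (fun z : DD => y ** z) by apply: lin_dmr; apply: lin_id.
have ll (y : DD) : lin (fun z : DD => z ** y) by apply: lin_dml; apply: lin_id.
rewrite /Theta ind_lift_cl //.
  have -> : bD x = bD x ** gD 1 ** fD (dunit HB) by rewrite !(double_mul1 HA).
  rewrite qD_pure (linZ (f := fun z => Mact z m)); last exact: dg_linz hM m.
  by rewrite Mact_pure Mg_fact_unit (dg_G1 hM).
move=> d e m' he; move: e he; apply: ge0_ind.
  have l1 : lin (fun e => Mact (qD beta (d ** e)) m') by apply: (lin_comp (hb.1 m') (lr d)).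
  have l2 : lin (fun e => Mact (qD beta d) (ge0_act e m')).
    by apply: (lin_comp (hb.2 d)); apply: ge0_act_lin.
  by split=> [|c e e' h h']; rewrite ?(lin0 l1) ?(lin0 l2) // l1 l2 h h'.
move=> s f; move: d; apply: DD_ind.
  have l1 : lin (fun d => Mact (qD beta (d ** (gD s ** fD f))) m') by apply: (lin_comp (hb.1 m') (ll _)).
  have l2 := hb.1 (ge0_act (gD s ** fD f) m').
  by split=> [|c d d' h h']; rewrite ?(lin0 l1) ?(lin0 l2) // l1 l2 h h'.
move=> y g f'.
(* Normal form of the product: [s] moves left past [f'], which is conjugated, and the functionals
   multiply in the opposite order. *)
have e : bD y ** gD g ** fD f' ** (gD s ** fD f) =
    bD y ** gD (g * s)%g ** fD (dmul HB f (conj_dual s f')).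
  rewrite -fDM -gDM !dd_assoc; congr (_ ** _).
  by rewrite -(dd_assoc _ _ (gD s)) fD_gD !dd_assoc.
rewrite -/(ge0_act _ _) -[hmul _ _ _]/(bD y ** gD g ** fD f' ** (gD s ** fD f)) e.
rewrite !qD_pure ge0_act_gf.
rewrite !(linZ (f := fun z => Mact z _)); try exact: dg_linz hM _.
congr (_ *: _); rewrite !Mact_pure (dg_GM hM); congr (Gm g _).
move: m'; apply: mg_eq.
- by apply: (lin_comp (dg_linG hM s)); apply: lin_Mg_fact.
- by move=> c p q; rewrite lin_Mg_fact (dg_linG hM s) lin_Mg_fact.
move=> x' u; rewrite !Mg_fact_mg !(linZ _ _ (dg_linG hM s)) !Gm_mg.
rewrite (linZ _ _ (lin_Mg_fact (dkG f'))) Mg_fact_mg scalerA; congr (_ *: _).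
rewrite !dkGE !kG_boson_gelt (dmulE HA) smash_comul_g tlift_pure; last by blint.
rewrite conj_dualE !smashM !nact_one !mulr1; congr (_ * f' (1 # _)).
by rewrite invMg !mulgA.
Qed.

Lemma vten_sum w : w = \sum_i vten (ebasis i) (Theta (dbasis i) w).
Proof.
move: w; apply: verma_eq; first exact: lin_id.
  by apply: lin_sum => i; apply: lin_vtenr; apply: lin_Theta.
move=> x m; rewrite {1}(ebasis_sum x) (lin_sumr (f := fun x => vten x m)); last first.
  by apply: lin_vtenl; apply: lin_id.
apply: eq_bigr => i _; rewrite Theta_vten dbasisE.
rewrite (linZ (f := fun x => vten x m)); last by apply: lin_vtenl; apply: lin_id.
by rewrite (linZ (f := vten _)) //; apply: lin_vtenr; apply: lin_id.
Qed.

End Verma.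

(** * The top degree of the Verma module *)

Section TopVerma.
Variables (phi : dual B) (La : B) (t : gT).
Hypothesis td : top_data phi La t.

Definition topchar (g : gT) : k := phi (act g La).
Local Notation chi := topchar.

Lemma La_neq0 : La != 0.
Proof. by apply/eqP => e; have := td_phi td; rewrite e linear0 => /esym/eqP; rewrite oner_eq0. Qed.

Lemma act_La g : act g La = chi g *: La.
Proof. by rewrite {1}(td_span td (nact_deg g (td_La td))). Qed.

Lemma co_La s : co s La = if s == t then La else 0.
Proof.
rewrite (td_span td (ncoact_deg s (td_La td))) (td_co td) (td_phi td).
by case: eqP; rewrite ?scale1r ?scale0r.
Qed.

Lemma topcharM g h : chi (g * h)%g = chi g * chi h.
Proof.
by rewrite {1}/topchar yactM (act_La h) !linearZ /= [LHS]mulrC.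
Qed.

Lemma topchar1 : chi 1%g = 1.
Proof. by rewrite /topchar yact1 (td_phi td). Qed.

Lemma topchar_neq0 g : chi g != 0.
Proof. exact: (chi_neq0 topcharM topchar1). Qed.

(** [act g] sends degree t to degree g t g^-1, but [La] is an eigenvector, so both degrees agree. *)
Lemma top_central g : commute t g.
Proof.
have := ycompat (nyd NB) t g La; rewrite co_La eqxx act_La linearZ /= co_La.
case: eqP => [e _|_]; last first.
  rewrite scaler0 => /esym/eqP; rewrite scaler_eq0 (negbTE (topchar_neq0 g)).
  by rewrite (negbTE La_neq0).
by rewrite /commute -{1}e mulgKV.
Qed.

Lemma mul_La c : c * La = (eB c : k) *: La.
Proof.
rewrite -{1}(pr_sum c) mulr_suml big_ord_recl pr0E -scalerAl mul1r big1 ?addr0 // => i _.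
have := nmul_deg (pr_mem i.+1 c) (td_La td).
by rewrite ndeg_gt ?memv0 => [/eqP ->|] //; rewrite addSn ltnS leq_addl.
Qed.

Section WithRho.
Variables (g0 : gT) (n : nat) (rho : mx_representation k 'C[g0] n).
Local Notation Mg := (Mg rho).
Local Notation Mact := (Mg_act rho).
Local Notation verma := (verma NB rho).
Local Notation vact := (verma_act NB rho).
Local Notation vten := (@vten g0 n rho).
Local Notation Theta := (@Theta g0 n rho).
Local Notation twact := (twA chi t (@Gm k gT g0 n rho) (@Wm k gT g0 n rho)).

Let hM := Mg_dgmod rho.
Let hV := verma_module rho.
Let hT := twist_dgmod topcharM topchar1 top_central hM.

Lemma vten_LaK m : Theta phi (vten La m) = m.
Proof. by rewrite Theta_vten (td_phi td) scale1r. Qed.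

Lemma Theta_vact c w : Theta phi (vact (bD c) w) =
  \sum_i (phi (c * ebasis i) : k) *: Theta (dbasis i) w.
Proof.
rewrite {1}(vten_sum w) (lin_sumr _ _ _ (lin_vact _)) (lin_sumr _ _ _ (lin_Theta _)).
by apply: eq_bigr => i _; rewrite vact_b Theta_vten.
Qed.

(** For the difference w' of both sides, the phi-coordinate of c w' vanishes for every c in [B];
    nondegeneracy of [phi] then kills all coordinates of w'. *)
Lemma integral_vten w : (forall c, vact (bD c) w = (eB c : k) *: w) -> w = vten La (Theta phi w).
Proof.
move=> hw; apply/eqP; rewrite -subr_eq0; apply/eqP.
set w' := w - _; have lT : lin (Theta phi) by apply: lin_Theta.
have h0 c : Theta phi (vact (bD c) w') = 0.
  rewrite /w' (linB _ _ (lin_vact _)) hw vact_b mul_La (linB _ _ lT) (linZ _ _ lT).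
  rewrite (linZ (f := fun x => vten x _)); last by apply: lin_vtenl; apply: lin_id.
  by rewrite (linZ _ _ lT) vten_LaK subrr.
rewrite (vten_sum w') big1 // => i _.
suff -> : Theta (dbasis i) w' = 0.
  by apply: (lin0 (f := vten _)); apply: lin_vtenr; apply: lin_id.
apply: dual_ext => l; rewrite linear0.
(* A functional [l] on M turns w' into an element [z] of [B], to which nondegeneracy applies. *)
pose z := \sum_j (l (Theta (dbasis j) w') : k) *: ebasis j : B.
have z0 : z = 0.
  apply: (td_nondeg td) => c; have /(congr1 l) := h0 c; rewrite Theta_vact !linear_sum linear0 /= => e.
  rewrite /z mulr_sumr linear_sum -[RHS]e; apply: eq_bigr => j _.
  by rewrite -scalerAr !linearZ /= /GRing.scale /= mulrC.
have /(congr1 (dbasis i)) := z0; rewrite linear0 /z linear_sum (bigD1 i) //= big1 => [|j hj].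
  rewrite addr0 linearZ /= dbasisE v2r_ebasis eqxx /GRing.scale /= mulr1; exact.
by rewrite linearZ /= dbasisE v2r_ebasis (negbTE hj) /GRing.scale /= mulr0.
Qed.

Definition verma_top (w : verma) : Prop := exists m, w = vten La m.

Lemma vten_La_act z m : vact (DG_DD NB z) (vten La m) = vten La (twact z m).
Proof.
have lf : lin (vten La) by apply: lin_vtenr; apply: lin_id.
apply/esym; apply: (dg_morph (f := vten La) (P := wholeT _) hT (md_dgmod hV)) => // [g {}m _|h {}m _].
  rewrite vact_g act_La (linZ _ _ lf).
  by rewrite (linZ (f := fun x => vten x _)) //; apply: lin_vtenl; apply: lin_id.
rewrite vact_w (bigD1 t) //= co_La eqxx big1 ?addr0 // => s hs; rewrite co_La (negbTE hs).
by apply: (lin0 (f := fun x => vten x _)); apply: lin_vtenl; apply: lin_id.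
Qed.

Lemma verma_top_submod : is_submodule (fun z => vact (DG_DD NB z)) verma_top.
Proof.
have lf : lin (vten La) by apply: lin_vtenr; apply: lin_id.
split=> [|c _ _ [m ->] [m' ->]|z _ [m ->]].
- by exists 0; rewrite (lin0 lf).
- by exists (c *: m + m'); rewrite lf.
by exists (twact z m); rewrite vten_La_act.
Qed.

Lemma verma_top_iso : mod_iso twact (wholeT Mg) (fun z => vact (DG_DD NB z)) verma_top.
Proof.
apply: (mod_iso_lin (f := vten La)).
- by apply: lin_vtenr; apply: lin_id.
- by move=> z m; rewrite vten_La_act.
- by move=> m e; rewrite -[m]vten_LaK e (lin0 (lin_Theta _)).
- by move=> m; exists m.
by move=> w [m ->]; exists m.
Qed.

Lemma verma_top_simple : mx_irreducible rho -> is_simple (fun z => vact (DG_DD NB z)) verma_top.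
Proof.
move=> irr; apply: (mod_iso_simple verma_top_submod verma_top_iso).
by apply: (twist_simple topcharM topchar1 top_central hM); apply: Mg_simple.
Qed.

Lemma verma_top_killed w : verma_top w -> v_killed vact w.
Proof.
move=> [m ->]; apply/v_killedP => v hv; rewrite vact_b mul_La (ncounit_deg _ hv) // scale0r.
by apply: (lin0 (f := fun x => vten x _)); apply: lin_vtenl; apply: lin_id.
Qed.

(** With [vten_La_act], this exhibits [top_mod] and the top degree of the Verma module as the same
    twist of M(g,rho). *)
Lemma top_act_La z m : top_act NB rho z (bD La \ot m) = bD La \ot twact z m.
Proof.
have l1 : lin (fun z => top_act NB rho z (bD La \ot m)).
  by apply: lin_tlift; apply: lin_hcomul_DG.
have l2 : lin (fun z => bD La \ot twact z m) by apply: lin_tpurer; apply: dg_linz hT m.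
have lz (z1 : DG k gT) : lin (fun z => Defs.ad NB z (bD La)).
  by apply: lin_tlift; apply: lin_hcomul_DG.
have la (z2 : DG k gT) : lin (Mact z2) by apply: dg_linx hM z2.
have la2 (m' : Mg) : lin (fun z => Mact z m') by apply: dg_linz hM m'.
move: z; apply: DG_eq => // g h.
have hb : bilin (fun z1 z2 => Defs.ad NB z1 (bD La) \ot Mact z2 m).
  split=> [z2|z1]; first by apply: lin_tpurel; apply: lz.
  by apply: lin_tpurer; apply: la2.
rewrite /top_act.
transitivity (\sw_(z1, z2 <- hcomul (DG_hopf k gT) (gelt k g \ot gdual k h))
   (Defs.ad NB z1 (bD La) \ot Mact z2 m)).
  apply: tlift_ext => z1 z2; rewrite (tlift_pure (f := fun d m => Defs.ad NB z1 d \ot Mact z2 m)) //.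
  by split=> ?; [apply: lin_tpurel; apply: lin_adr|apply: lin_tpurer].
rewrite (DG_comul_sw _ _ hb) (bigD1 t) //= big1 => [|s hs].
  rewrite addr0 ad_bD co_La eqxx act_La (dg_act hM) (dg_act hT) /twG /twW.
  rewrite (linZ (f := bD)); last by lint.
  rewrite (linZ (f := fun d => d \ot _)); last by lint.
  by rewrite (linZ (f := fun m => _ \ot m)) //; lint.
rewrite ad_bD co_La (negbTE hs) linear0 (lin0 (f := bD)); last by lint.
by apply: (lin0 (f := fun d => d \ot _)); lint.
Qed.

Lemma B_DD_linfun : linfun (B_DD NB) =1 bD.
Proof. by move=> x; rewrite linfunE //; apply: lin_B_DD. Qed.

Lemma top_iso : mod_iso twact (wholeT Mg) (top_act NB rho) (top_mod NB rho).
Proof.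
apply: (mod_iso_lin (f := fun m => bD La \ot m)).
- by lint.
- by move=> z m; rewrite top_act_La.
- move=> m e.
  have nb : bD La != 0.
    apply/eqP => /(congr1 (fun d => tens_ev d (hone (boson_hopf NB)))).
    rewrite ev_pure (dunitE (boson_axioms)) (ha_counit1 (boson_axioms)) scale1r.
    rewrite (lin0 (f := fun d => tens_ev d _)); last by lint.
    by move=> /ffunP/(_ 1%g); rewrite smashE eqxx ffunE => e0; case/eqP: La_neq0.
  have [l nl] := dual_neq0 nb.
  have hb : bilin (fun (d : DD) (m : Mg) => (l d : k) *: m).
    by split=> ?; [apply: lin_scalel; apply: lin_hom|apply: lin_scale]; apply: lin_id.
  have := tlift_pure (bD La) m hb; rewrite e (lin0 (f := fun t => tlift t _)); last first.
    by apply: lin_tlift; apply: lin_id.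
  by move=> /esym/eqP; rewrite scaler_eq0 (negbTE nl) => /eqP.
- move=> m; apply: tens_sub_mem; last exact: memvf.
  by rewrite -B_DD_linfun memv_img // (td_La td).
move=> y; apply: (tens_sub_ind (P := fun y => exists m, bD La \ot m = y)).
  have l : lin (fun m : Mg => bD La \ot m) by lint.
  split=> [|c _ _ [m <-] [m' <-]]; first by exists 0; rewrite (lin0 l).
  by exists (c *: m + m'); rewrite l.
move=> u w /memv_imgP [x hx ->] _; rewrite B_DD_linfun (td_span td hx).
exists ((phi x : k) *: w); rewrite (linZ (f := bD)); last by lint.
rewrite (linZ (f := fun d => d \ot _)); last by lint.
by rewrite (linZ (f := fun m => _ \ot m)) //; lint.
Qed.

Definition verma_socle (w : verma) : Prop :=
  forall Q, is_submodule vact Q -> (forall x, verma_top x -> Q x) -> Q w.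

Lemma verma_socle_submod : is_submodule vact verma_socle.
Proof.
split=> [Q [q0 _ _] _|c x y hx hy Q hQ TQ|d x hx Q hQ TQ] //.
  by case: (hQ) => _ ql _; apply: ql; [apply: hx|apply: hy].
by case: (hQ) => _ _; apply; apply: hx.
Qed.

Lemma verma_socle_T w : verma_top w -> verma_socle w.
Proof. by move=> hw Q _; apply. Qed.

Hypothesis irr : mx_irreducible rho.

Lemma submod_verma_top (P : verma -> Prop) : is_submodule vact P -> (exists2 x, P x & x != 0) ->
  forall w, verma_top w -> P w.
Proof.
move=> hP /(v_killed_exists hV hP) [w [Pw nw _ /integral_vten ew]].
have [_ _ hs] := verma_top_simple irr.
case: (hs (fun x => verma_top x /\ P x)) => [|x [] //|h|h x Tx].
- have [t0 tl ta] := verma_top_submod; have [p0 pl pa] := hP.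
  split=> // [c x y [Tx Px] [Ty Py]|z x [Tx Px]].
    by split; [apply: tl|apply: pl].
  by split; [apply: ta|apply: pa].
- by case/eqP: nw; apply: h; split=> //; exists (Theta phi w).
exact: (h x Tx).2.
Qed.

Lemma verma_top_neq0 : exists2 x, verma_top x & x != 0.
Proof. by case: (verma_top_simple irr). Qed.

Lemma verma_socle_simple : is_simple vact verma_socle.
Proof.
split; first exact: verma_socle_submod.
  by have [x Tx nx] := verma_top_neq0; exists x => //; apply: verma_socle_T.
move=> Q hQ QS; have [h0|hn0] := pselect (forall x, Q x -> x = 0); [by left|right=> x Sx].
apply: (Sx Q hQ); apply: submod_verma_top => //; apply: contrapT => h; apply: hn0 => y Qy.
by apply: contrapT => /eqP ny; apply: h; exists y.
Qed.

(** Every simple submodule contains [verma_top], hence lies inside the submodule it generates, which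
    is itself simple. *)
Lemma socle_verma : socle vact = verma_socle.
Proof.
apply/funext => w; apply/propext; split=> [hw|hw Q hQ hs].
  apply: (hw verma_socle verma_socle_submod) => P [hP hx hs] y Py.
  case: (hs (fun x => P x /\ verma_socle x)) => [|x [] //|h|h].
  - have [s0 sl sa] := verma_socle_submod; have [p0 pl pa] := hP.
    split=> // [c x z [Tx Px] [Ty Py']|z x [Tx Px]].
      by split; [apply: pl|apply: sl].
    by split; [apply: pa|apply: sa].
  - have [x Tx nx] := verma_top_neq0; case/eqP: nx; apply: h; split; last exact: verma_socle_T.
    exact: submod_verma_top Tx.
  exact: (h y Py).2.
by apply: (hs _ verma_socle_simple).
Qed.

Lemma verma_socle_lw : lw_gen vact verma_top verma_socle.
Proof.
split; [exact: verma_socle_T|exact: verma_top_simple|exact: verma_top_killed|].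
by move=> Q hQ TQ x; apply.
Qed.

End WithRho.
End TopVerma.

(** * Weights of simple modules and the classification *)

Lemma lw_pull (N N' : lmodType k) (a : DD -> N -> N) (a' : DD -> N' -> N') P P' M' :
  is_module (DD_hopf NB) a -> is_module (DD_hopf NB) a' ->
  is_submodule a P -> is_submodule a' P' -> mod_iso a P a' P' -> lw_gen a' M' P' ->
  exists M, lw_gen a M P /\
    mod_iso (fun z => a (DG_DD NB z)) M (fun z => a' (DG_DD NB z)) M'.
Proof.
move=> hN hN' [p0 pl pa] [p0' pl' pa'] [f [f1 f2 f3 f4 f5]] [MP' sM' VM' min'].
have [[m0 ml ma] _ _] := sM'.
have f0 : f 0 = 0 by have := f1 (-1) 0 0 p0 p0; rewrite scaler0 addr0 scaleN1r addNr.
pose M x := P x /\ M' (f x).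
have hM : is_submodule (fun z => a (DG_DD NB z)) M.
  split=> [|c x y [Px Mx] [Py My]|z x [Px Mx]]; first by rewrite /M f0.
    by split; [apply: pl|rewrite f1 //; apply: ml].
  by split; [apply: pa|rewrite f2 //; apply: ma].
have iso : mod_iso (fun z => a (DG_DD NB z)) M (fun z => a' (DG_DD NB z)) M'.
  exists f; split=> [c x y [Px _] [Py _]|z x [Px _]|x [] //|x y [Px _] [Py _]|y My].
  - exact: f1.
  - exact: f2.
  - exact: f4.
  by have [x Px e] := f5 _ (MP' _ My); exists x => //; split=> //; rewrite e.
exists M; split=> //; split; first by move=> x [].
- exact: mod_iso_simple hM (mod_iso_sym hM iso) sM'.
- move=> x [Px Mx] v; apply: f4 => //; first exact: pa.
  by rewrite f2 // f0; apply: VM'.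
move=> Q [q0 ql qa] MQ x Px.
have [|y My|x' [Px' Qx'] e] := min' (fun y => exists2 x, P x /\ Q x & f x = y) _ _ (f x) (f3 x Px).
- split=> [|c _ _ [u [Pu Qu] <-] [v [Pv Qv] <-]|d _ [u [Pu Qu] <-]].
  + by exists 0.
  + by exists (c *: u + v); [split; [apply: pl|apply: ql]|rewrite f1].
  by exists (a d u); [split; [apply: pa|apply: qa]|rewrite f2].
- have [z Pz e] := f5 _ (MP' _ My); exists z => //; split=> //.
  by apply: MQ; split=> //; rewrite e.
by rewrite -(f4 _ _ Px' Px e).
Qed.

Lemma lowest_weight_gen g n (rho : mx_representation k 'C[g] n) (N : lmodType k)
    (a : DD -> N -> N) P : is_lowest_weight NB rho a P ->
  exists2 M, lw_gen a M P &
    mod_iso (fun z => a (DG_DD NB z)) M (Mg_act rho) (wholeT (Mg rho)).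
Proof. by move=> [_ [M [MP sM iso VM min]]]; exists M => //; split=> // x Mx v; apply: VM. Qed.

(** The vectors killed by V form a nonzero D(G)-submodule, so they contain some M(g,rho), which
    generates [L] by simplicity. *)
Lemma simple_lw_gen (L : lmodType k) (a : DD -> L -> L) :
  is_module (DD_hopf NB) a -> is_simple a (wholeT L) ->
  exists (g : gT) (n : nat) (rho : mx_representation k 'C[g] n), mx_irreducible rho /\
  exists2 M, lw_gen a M (wholeT L) &
    mod_iso (Mg_act rho) (wholeT (Mg rho)) (fun z => a (DG_DD NB z)) M.
Proof.
move=> hL [hW hx hs]; have hD := md_dgmod hL.
have hk := v_killed_submod hL.
have hx' : exists2 x, v_killed a x & x != 0.
  by have [x [_ nx kx _]] := v_killed_exists hL hW hx; exists x.
have [g [n [rho [irr [f [lf fz f0 fk]]]]]] := dg_classify hD hk hx'.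
exists g, n, rho; split=> //; pose M x := exists m, f m = x.
have hM : is_submodule (fun z => a (DG_DD NB z)) M.
  split=> [|c _ _ [u <-] [v <-]|z _ [u <-]]; first by exists 0; apply: lin0 lf.
    by exists (c *: u + v); rewrite lf.
  by exists (Mg_act rho z u); rewrite fz.
have iso : mod_iso (Mg_act rho) (wholeT (Mg rho)) (fun z => a (DG_DD NB z)) M.
  by apply: (mod_iso_lin lf fz f0) => // m; exists m.
have sM := mod_iso_simple hM iso (Mg_simple irr).
exists M => //; split=> // [_ [m <-] //|Q hQ MQ x _].
have [_ [y My ny] _] := sM.
case: (hs Q hQ) => // [h|h]; last exact: h.
by case/eqP: ny; apply: h; apply: MQ.
Qed.

End NicholsDouble.

Theorem theorem4 (k : closedFieldType) (char0 : [pchar k] =i pred0)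
    (gT : finGroupType) (nonab : ~~ abelian [set: gT])
    (V : vectType k) (YV : yd_module gT V)
    (B : falgType k) (NB : nichols YV B) :
  (forall (g : gT) (n : nat) (rho : mx_representation k 'C[g] n),
     mx_irreducible rho ->
     let hat (gh : gT) (nh : nat) (rhoh : mx_representation k 'C[gh] nh) :=
       mx_irreducible rhoh /\
       mod_iso (Mg_act rhoh) (wholeT (Mg rhoh)) (top_act NB rho) (top_mod NB rho) in
     (exists (gh : gT) (nh : nat) (rhoh : mx_representation k 'C[gh] nh),
        hat gh nh rhoh) /\
     (forall (gh : gT) (nh : nat) (rhoh : mx_representation k 'C[gh] nh),
        hat gh nh rhoh ->
        [/\ is_simple (verma_act NB rho) (socle (verma_act NB rho)),
            is_lowest_weight NB rhoh (verma_act NB rho) (socle (verma_act NB rho))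
          & forall (L : lmodType k) (actL : DD gT B -> L -> L),
              is_module (DD_hopf NB) actL ->
              is_simple actL (wholeT L) ->
              is_lowest_weight NB rhoh actL (wholeT L) ->
              mod_iso actL (wholeT L)
                (verma_act NB rho) (socle (verma_act NB rho))]))
  /\
  (forall (L : lmodType k) (actL : DD gT B -> L -> L),
     is_module (DD_hopf NB) actL ->
     is_simple actL (wholeT L) ->
     exists (g : gT) (n : nat) (rho : mx_representation k 'C[g] n),
       [/\ mx_irreducible rho,
           mod_iso actL (wholeT L) (verma_act NB rho) (socle (verma_act NB rho))
         & forall (g' : gT) (n' : nat) (rho' : mx_representation k 'C[g'] n'),
             mx_irreducible rho' ->
             mod_iso actL (wholeT L)
               (verma_act NB rho') (socle (verma_act NB rho')) ->
             mod_iso (Mg_act rho') (wholeT (Mg rho'))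
               (Mg_act rho) (wholeT (Mg rho))]).
Proof.
have [phi [La [t td]]] := top_data_exists NB.
pose chi := topchar NB phi La.
have chiM : forall g h, chi (g * h)%g = chi g * chi h by apply: topcharM td.
have chi1 : chi 1%g = 1 by apply: topchar1 td.
have chi0 g : chi g != 0 by apply: topchar_neq0 td g.
have tC g : commute t g by apply: top_central td g.
(* The inverse character and inverse degree define the inverse twist, used to recover (g,rho) from
   its hat. *)
have chiVM g h : (chi (g * h)%g)^-1 = (chi g)^-1 * (chi h)^-1 by rewrite chiM invfM.
have chiV1 : (chi 1%g)^-1 = 1 by rewrite chi1 invr1.
have tVC g : commute t^-1%g g by apply/commute_sym/commuteV/commute_sym.
split=> [g n rho irr hat|L aL hL sL].
  have hM := Mg_dgmod rho.
  have top_iso' := top_iso td rho; have T_iso := verma_top_iso td rho.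
  split=> [|gh nh rhoh [irrh isoh]].
    have hT := twist_dgmod chiM chi1 tC hM.
    have [gh [nh [rhoh [irrh iso]]]] :=
      dg_classify_simple hT (twist_simple chiM chi1 tC hM (Mg_simple irr)).
    by exists gh, nh, rhoh; split=> //; apply: mod_iso_trans iso top_iso'.
  have isoT : mod_iso (fun z => verma_act NB rho (DG_DD NB z)) (verma_top La (rho := rho))
      (Mg_act rhoh) (wholeT (Mg rhoh)).
    apply: mod_iso_trans (mod_iso_sym (wholeT_submod _) T_iso) _.
    by apply: mod_iso_trans top_iso' (mod_iso_sym (wholeT_submod _) isoh).
  rewrite (socle_verma td irr); split; first exact: (verma_socle_simple td irr).
    split; first exact: verma_socle_submod.
    have [h1 h2 h3 h4] := verma_socle_lw td irr.
    exists (verma_top La (rho := rho)); split=> // v x Tx.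
    exact: h3.
  move=> L aL hL sL /lowest_weight_gen [M lM isoM].
  apply: (lw_unique hL (verma_module NB rho) sL (verma_socle_simple td irr) lM (verma_socle_lw td irr)).
  by apply: mod_iso_trans isoM (mod_iso_sym (verma_top_submod td rho) isoT).
(* [L] has some lowest weight [rhoh]; untwisting it gives the [rho] whose Verma socle has that
   lowest weight. *)
have [gh [nh [rhoh [irrh [M lM isoM]]]]] := simple_lw_gen hL sL.
have hMh := Mg_dgmod rhoh.
have [g [n [rho [irr iso0]]]] := dg_classify_simple (twist_dgmod chiVM chiV1 tVC hMh)
  (twist_simple chiVM chiV1 tVC hMh (Mg_simple irrh)).
have hM := Mg_dgmod rho.
have := twist_iso chi t hM (twist_dgmod chiVM chiV1 tVC hMh) iso0.
rewrite (twistK t hMh chi0) => iso1.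
have isoLS : mod_iso aL (wholeT L) (verma_act NB rho) (verma_socle (NB := NB) La (rho := rho)).
  apply: (lw_unique hL (verma_module NB rho) sL (verma_socle_simple td irr) lM (verma_socle_lw td irr)).
  apply: mod_iso_trans (mod_iso_sym (wholeT_submod _) isoM) _.
  by apply: mod_iso_trans (mod_iso_sym (wholeT_submod _) iso1) (verma_top_iso td rho).
exists g, n, rho; split=> //; first by rewrite (socle_verma td irr).
move=> g' n' rho' irr'; rewrite (socle_verma td irr') => isoLS'.
(* Uniqueness: isomorphic socles have isomorphic lowest weights, and cancelling the common twist
   identifies the original modules. *)
have j := mod_iso_trans (mod_iso_sym (wholeT_submod _) isoLS') isoLS.
have [M' [lM' isoM']] := lw_pull (verma_module NB rho') (verma_module NB rho)
  (@verma_socle_submod _ _ _ _ _ NB La _ _ rho') (@verma_socle_submod _ _ _ _ _ NB La _ _ rho) j (verma_socle_lw td irr).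
have isoTT := lw_weight_unique (verma_module NB rho') (@verma_socle_submod _ _ _ _ _ NB La _ _ rho')
  (verma_socle_lw td irr') lM'.
have hM' := Mg_dgmod rho'.
have iso2 : mod_iso (twA chi t (@Gm _ _ _ _ rho') (@Wm _ _ _ _ rho')) (wholeT (Mg rho'))
    (twA chi t (@Gm _ _ _ _ rho) (@Wm _ _ _ _ rho)) (wholeT (Mg rho)).
  apply: mod_iso_trans (verma_top_iso td rho') _.
  apply: mod_iso_trans isoTT _; apply: mod_iso_trans isoM' _.
  exact: mod_iso_sym (wholeT_submod _) (verma_top_iso td rho).
have := twist_iso (fun g => (chi g)^-1) t^-1%g (twist_dgmod chiM chi1 tC hM')
  (twist_dgmod chiM chi1 tC hM) iso2.
by rewrite (twistVK t hM' chi0) (twistVK t hM chi0).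
Qed.
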